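(* Let $p\ge2$ and let $\frac{dy}{dz}=B(z)y$, $y(z)\in\mathbb C^p$, be a linear differential system on the Riemann sphere $\overline{\mathbb C}$ with meromorphic coefficient matrix $B(z)$, whose singular points are exactly $a_1,\ldots,a_n$, all of them non-resonant irregular. Suppose that at each singular point $a_i$ the formal exponents $\lambda_i^1,\ldots,\lambda_i^p$ of the system are pairwise distinct and satisfy $$\mathrm{Re}\,\lambda_i^j>-\frac1{n(p-1)},\qquad j=1,\ldots,p,$$ and that for every pair $(\lambda_i^j,\lambda_i^l)$ with $j\ne l$ at least one of the following conditions holds: $$\mathrm{Re}\,\lambda_i^j-\mathrm{Re}\,\lambda_i^l\notin\mathbb Q\qquad\text{or}\qquad\mathrm{Im}\,\lambda_i^j\ne\mathrm{Im}\,\lambda_i^l .$$ Then the system is solvable by quadratures if and only if there exists a constant matrix $C\in\mathrm{GL}(p,\mathbb C)$ such that $CB(z)C^{-1}$ is upper-triangular.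
   Context: Singular points of the system on $\overline{\mathbb C}$ are the singular points of the matrix 1-form $B(z)\,dz$; if some $a_i=\infty$, local notions at $a_i$ are understood in the local coordinate $1/z$ in place of $z-a_i$. A singular point is regular if every solution has at most polynomial growth in any sector of small radius with vertex at this point and opening less than $2\pi$; otherwise it is irregular. Write the Laurent expansion at $a_i$ as $$B(z)=\frac{B_{-r_i-1}}{(z-a_i)^{r_i+1}}+\ldots+\frac{B_{-1}}{z-a_i}+B_0+\ldots,\qquad B_{-r_i-1}\neq0;$$ $r_i$ is the Poincaré rank of $a_i$. An irregular singular point $a_i$ is non-resonant if the eigenvalues $b_i^1,\ldots,b_i^p$ of the leading term $B_{-r_i-1}$ are pairwise distinct. Formal exponents: at a non-resonant irregular singular point $a_i$ fix $T_i$ with $T_i^{-1}B_{-r_i-1}T_i=\mathrm{diag}(b_i^1,\ldots,b_i^p)$. Then the system has a uniquely determined formal fundamental matrix of the form $$\widehat Y_i(z)=\widehat F_i(z)(z-a_i)^{\Lambda_i}e^{Q_i(z)},$$ where $\widehat F_i(z)$ is a matrix formal Taylor series in $z-a_i$ with $\widehat F_i(a_i)=T_i$; $\Lambda_i$ is a constant diagonal matrix; and $Q_i(z)=\mathrm{diag}(q_i^1(z),\ldots,q_i^p(z))$ with $q_i^j(z)$ polynomials in $(z-a_i)^{-1}$ of degree $r_i$ without constant term, $q_i^j(z)=-\frac{b_i^j}{r_i}(z-a_i)^{-r_i}+o((z-a_i)^{-r_i})$. The formal exponents $\lambda_i^1,\ldots,\lambda_i^p$ of the system at $a_i$ are the diagonal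 entries of $\Lambda_i$. Solvability by quadratures: let $Y(z)$ be a fundamental matrix of the system and let $F$ be the differential field obtained by adjoining all entries of $Y(z)$ to the field $\mathbb C(z)$ of rational functions (the Picard–Vessiot extension). The system is solvable by quadratures if there is a chain of differential fields $\mathbb C(z)=F_1\subseteq\cdots\subseteq F_m$ with $F\subseteq F_m$ and $F_{i+1}=F_i\langle x_i\rangle$ ($i=1,\ldots,m-1$), where each $x_i$ is either algebraic over $F_i$, or an exponential of an element of $F_i$, or an integral of an element of $F_i$. *)

(* Defs.v *)
(* The field of complex numbers is R[i] with R : realType; definitions that only
   use algebra are stated over an arbitrary field C. *)
From HB Require Import structures.
From mathcomp Require Export all_boot all_order all_algebra.
From mathcomp Require Export all_classical all_reals all_analysis.
From mathcomp Require Export complex.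
From mathcomp Require Import ring.
Export Order.TTheory GRing.Theory Num.Theory.
Export numFieldNormedType.Exports.

Set Implicit Arguments.
Unset Strict Implicit.
Unset Printing Implicit Defensive.

Local Open Scope classical_set_scope.
Local Open Scope ring_scope.

Notation ratfun C := {fraction {poly C}}.

Definition ratpoly (C : fieldType) (q : {poly C}) : ratfun C :=
  FracField.tofrac q.

Definition ratconst (C : fieldType) (c : C) : ratfun C := ratpoly c%:P.

Definition repnum (C : fieldType) (f : ratfun C) : {poly C} :=
  (frac (generic_quotient.repr f)).1.

Definition repden (C : fieldType) (f : ratfun C) : {poly C} :=
  (frac (generic_quotient.repr f)).2.

(* [repr] picks an arbitrary quotient representing [f]; after division by the
   gcd the roots of the denominator are exactly the finite poles of [f]. *)
Definition numr (C : fieldType) (f : ratfun C) : {poly C} :=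
  repnum f %/ gcdp (repnum f) (repden f).

Definition denr (C : fieldType) (f : ratfun C) : {poly C} :=
  repden f %/ gcdp (repnum f) (repden f).

Lemma repden_neq0 (C : fieldType) (f : ratfun C) : repden f != 0.
Proof. exact: denom_ratioP. Qed.

Lemma denr_neq0 (C : fieldType) (f : ratfun C) : denr f != 0.
Proof. by rewrite /denr dvdp_div_eq0 ?dvdp_gcdr ?repden_neq0. Qed.

Lemma coprime_numr_denr (C : fieldType) (f : ratfun C) :
  coprimep (numr f) (denr f).
Proof. by apply: coprimep_div_gcd; rewrite repden_neq0 orbT. Qed.

Lemma ratpoly_neq0 (C : fieldType) (q : {poly C}) : q != 0 -> ratpoly q != 0.
Proof. by rewrite /ratpoly tofrac_eq0. Qed.

Lemma ratfun_rep (C : fieldType) (f : ratfun C) :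
  ratpoly (repden f) * f = ratpoly (repnum f).
Proof.
rewrite -{2}[f]generic_quotient.reprK /ratpoly /repden /repnum.
move: (generic_quotient.repr f) => x; have x0 := denom_ratioP x.
rewrite -[LHS]/(FracField.mul _ _) !generic_quotient.piE.
apply/generic_quotient.eqmodP; rewrite /= FracField.equivfE /FracField.mulf.
rewrite !numden_Ratio ?oner_neq0 ?mul1r ?mulr1 //.
Qed.

Lemma ratfunE (C : fieldType) (f : ratfun C) :
  f = ratpoly (numr f) / ratpoly (denr f).
Proof.
have g0 : gcdp (repnum f) (repden f) != 0.
  by rewrite gcdp_eq0 negb_and repden_neq0 orbT.
apply: (canRL (mulfK _)); first by rewrite /ratpoly tofrac_eq0 denr_neq0.
apply: (@mulIf _ (ratpoly (gcdp (repnum f) (repden f)))).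
  by rewrite /ratpoly tofrac_eq0.
rewrite -mulrA /ratpoly -!tofracM !divpK ?dvdp_gcdl ?dvdp_gcdr //.
by rewrite mulrC; apply: ratfun_rep.
Qed.

Definition rderiv (C : fieldType) (f : ratfun C) : ratfun C :=
  ratpoly ((numr f)^`() * denr f - numr f * (denr f)^`()) / ratpoly (denr f) ^+ 2.

Lemma rderivE (C : fieldType) (a b : {poly C}) : b != 0 ->
  rderiv (ratpoly a / ratpoly b) =
  ratpoly (a^`() * b - a * b^`()) / ratpoly b ^+ 2.
Proof.
move=> b0; set f := ratpoly a / _; rewrite /rderiv.
have d0 := denr_neq0 f; have := ratfunE f.
move: (numr f) (denr f) d0 => n d d0 /eqP.
rewrite /f eqr_div ?ratpoly_neq0 // /ratpoly -!tofracM tofrac_eq => /eqP e.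
apply/eqP; rewrite eqr_div ?expf_neq0 ?ratpoly_neq0 //.
rewrite /ratpoly -!tofracXn -!tofracM tofrac_eq.
have := congr1 (fun q : {poly C} => q^`()) e; rewrite !derivM => e'.
move: (a^`()) (b^`()) (n^`()) (d^`()) e' => a' b' n' d' e'.
have -> : (n' * d - n * d') * b ^+ 2 =
  (n' * b + n * b') * (b * d) - (n * b) * (b' * d + b * d') by ring.
by apply/eqP; rewrite -e' -e; ring.
Qed.

Lemma rderivD (C : fieldType) (f g : ratfun C) :
  rderiv (f + g) = rderiv f + rderiv g.
Proof.
have df := denr_neq0 f; have dg := denr_neq0 g.
rewrite [f in LHS]ratfunE [g in LHS]ratfunE addf_div ?ratpoly_neq0 //.
rewrite /ratpoly -!tofracM -tofracD [LHS]rderivE ?mulf_neq0 //.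
rewrite /rderiv addf_div ?expf_neq0 ?ratpoly_neq0 //.
rewrite !derivD !derivM /ratpoly -!tofracXn -!tofracM -!tofracD -exprMn.
by congr (FracField.tofrac _ / FracField.tofrac _); ring.
Qed.

Lemma rderivM (C : fieldType) (f g : ratfun C) :
  rderiv (f * g) = rderiv f * g + f * rderiv g.
Proof.
have df := denr_neq0 f; have dg := denr_neq0 g.
rewrite {1 3}(ratfunE f) {1 2}(ratfunE g) mulf_div /ratpoly -!tofracM.
rewrite [LHS]rderivE ?mulf_neq0 // /rderiv !mulf_div /ratpoly.
rewrite -!tofracXn -!tofracM -?[RHS]/(_ / _ + _ / _).
rewrite addf_div ?tofrac_eq0 ?mulf_neq0 ?expf_neq0 //.
apply/eqP; rewrite eqr_div ?mulf_neq0 ?tofrac_eq0 ?mulf_neq0 ?expf_neq0 //.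
rewrite -!tofracM -!tofracD -!tofracM tofrac_eq !derivM; first by apply/eqP; ring.
Qed.

(* The composite f(g); meaningful for g non-constant, so that the denominator
   of f does not vanish at g. *)
Definition ratcomp (C : fieldType) (f g : ratfun C) : ratfun C :=
  (map_poly (@ratconst C) (numr f)).[g] / (map_poly (@ratconst C) (denr f)).[g].

Definition rateval (C : fieldType) (f : ratfun C) (t : C) : C :=
  (numr f).[t] / (denr f).[t].

(* Some a is the finite point a and None is the point at infinity. *)
Definition sphere (C : Type) := option C.

(* The 1-form B(z) dz written as M(t) dt in the local coordinate t at the given
   point: t = z - a at a finite point, t = 1/z at infinity. *)
Definition local_system (C : fieldType) (p : nat) (B : 'M[ratfun C]_p)
    (a : sphere C) : 'M[ratfun C]_p :=
  if a is Some a then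
    map_mx (fun f => ratcomp f (ratpoly ('X + a%:P))) B
  else
    map_mx (fun f => - (ratpoly 'X) ^- 2 * ratcomp f (ratpoly 'X)^-1) B.

Definition singular_point (C : fieldType) (p : nat) (B : 'M[ratfun C]_p)
    (a : sphere C) : Prop :=
  exists i j : 'I_p, root (denr (local_system B a i j)) 0.

Definition sector (R : realType) (rho alpha beta : R) : set R[i] :=
  [set t | exists s theta : R, [/\ 0 < s < rho, alpha < theta < beta &
    t = Complex (s * cos theta) (s * sin theta)]].

Definition solution_on (R : realType) (p : nat) (M : 'M[ratfun R[i]]_p)
    (S : set R[i]) (y : R[i] -> 'cV[R[i]]_p) : Prop :=
  forall (t : R[i]) (j : 'I_p), S t ->
    is_derive (t : R[i]^o) (1 : R[i]^o) ((fun u => y u j 0) : R[i]^o -> R[i]^o)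
      ((map_mx (fun f => rateval f t) M *m y t) j 0).

(* The radii are bounded by some rho0: on a sector reaching another singular
   point a solution need not be bounded away from the vertex. *)
Definition regular_at0 (R : realType) (p : nat) (M : 'M[ratfun R[i]]_p) :
    Prop :=
  exists2 rho0 : R, 0 < rho0 &
  forall rho alpha beta : R, 0 < rho <= rho0 ->
    alpha < beta < alpha + 2 * pi ->
  forall y : R[i] -> 'cV[R[i]]_p, solution_on M (sector rho alpha beta) y ->
  exists (N : nat) (c : R), forall t j, sector rho alpha beta t ->
    `|y t j 0| <= real_complex R c * `|t| ^- N.

Definition irregular_singular_point (R : realType) (p : nat)
    (B : 'M[ratfun R[i]]_p) (a : sphere R[i]) : Prop :=
  singular_point B a /\ ~ regular_at0 (local_system B a).

(* A formal Laurent series sum_k (u k) t^k is its family of coefficients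
   u : int -> A, vanishing below some index. *)
Definition laurent_series (A : pzRingType) (u : int -> A) : Prop :=
  exists N : int, forall k, k < N -> u k = 0.

(* The sum has finite support when u and v are Laurent series. *)
Definition lmul (A : pzRingType) (u v : int -> A) : int -> A :=
  fun k => \sum_(i \in [set: int]) u i * v (k - i).

Definition lderiv (A : pzRingType) (u : int -> A) : int -> A :=
  fun k => u (k + 1) *~ (k + 1).

Definition lpoly (A : nzRingType) (q : {poly A}) : int -> A :=
  fun k => if k is Posz m then q`_m else 0.

Definition laurent_expansion (C : fieldType) (f : ratfun C) (u : int -> C) :
    Prop :=
  laurent_series u /\ lmul (lpoly (denr f)) u = lpoly (numr f).

Definition mx_laurent_expansion (C : fieldType) (p : nat)
    (M : 'M[ratfun C]_p) (L : int -> 'M[C]_p) : Prop :=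
  forall i j, laurent_expansion (M i j) (fun k => L k i j).

Definition poincare_rank (C : fieldType) (p : nat) (L : int -> 'M[C]_p)
    (r : nat) : Prop :=
  L (- (r.+1)%:Z) != 0 /\ forall k : int, k < - (r.+1)%:Z -> L k = 0.

Definition nonresonant_at0 (C : fieldType) (p : nat) (M : 'M[ratfun C]_p) :
    Prop :=
  exists (L : int -> 'M[C]_p) (r : nat) (b : 'I_p -> C),
    [/\ mx_laurent_expansion M L, poincare_rank L r,
        char_poly (L (- (r.+1)%:Z)) = \prod_j ('X - (b j)%:P) & injective b].

Definition nonresonant_irregular_point (R : realType) (p : nat)
    (B : 'M[ratfun R[i]]_p) (a : sphere R[i]) : Prop :=
  irregular_singular_point B a /\ nonresonant_at0 (local_system B a).

Definition diagmx (C : fieldType) (p : nat) (b : 'I_p -> C) : 'M[C]_p :=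
  diag_mx (\row_j b j).

(* The Laurent series of diag(q_j(1/t)), for polynomials q_j. *)
Definition exponential_part (C : fieldType) (p : nat) (q : 'I_p -> {poly C}) :
    int -> 'M[C]_p :=
  fun k => if (k <= 0)%R then diagmx (fun j => (q j)`_`|k|%N) else 0.

(* Y = F t^Lambda e^Q satisfies Y' = (F' + F (Lambda / t + Q')) t^Lambda e^Q,
   because Lambda and Q are diagonal; hence Y is a formal fundamental matrix of
   y' = L y iff L F = F' + F (Lambda / t + Q') as Laurent series. *)
Definition formal_fundamental_matrix (C : fieldType) (p : nat)
    (L F : int -> 'M[C]_p) (lambda : 'I_p -> C) (q : 'I_p -> {poly C}) : Prop :=
  lmul L F = fun k => lderiv F k +
    lmul F (fun l => (if l == -1 then diagmx lambda else 0) +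
                     lderiv (exponential_part q) l) k.

(* The exponents at t = 0 of y' = M(t) y, in the order of the eigenvalues b. *)
Definition formal_exponents_at0 (C : fieldType) (p : nat)
    (M : 'M[ratfun C]_p) (lambda : 'I_p -> C) : Prop :=
  exists (L : int -> 'M[C]_p) (r : nat) (b : 'I_p -> C) (T : 'M[C]_p)
         (F : int -> 'M[C]_p) (q : 'I_p -> {poly C}),
    [/\ mx_laurent_expansion M L, poincare_rank L r,
        T \in unitmx /\ invmx T *m L (- (r.+1)%:Z) *m T = diagmx b,
        (forall k : int, k < 0 -> F k = 0) /\ F 0 = T &
        (forall j, [/\ (size (q j) <= r.+1)%N, (q j)`_0 = 0 &
                       (q j)`_r = - (b j / r%:R)]) /\
        formal_fundamental_matrix L F lambda q].

Definition formal_exponents (C : fieldType) (p : nat) (B : 'M[ratfun C]_p)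
    (a : sphere C) (lambda : 'I_p -> C) : Prop :=
  formal_exponents_at0 (local_system B a) lambda.

Definition is_derivation (K : fieldType) (D : K -> K) : Prop :=
  (forall x y, D (x + y) = D x + D y) /\
  (forall x y, D (x * y) = D x * y + x * D y).

Lemma rderiv_derivation (C : fieldType) : is_derivation (@rderiv C).
Proof. by split; [exact: rderivD | exact: rderivM]. Qed.

Definition diff_subfield (K : fieldType) (D : K -> K) (E : set K) : Prop :=
  [/\ E 1, forall x y, E x -> E y -> E (x - y),
      forall x y, E x -> E y -> E (x / y) & forall x, E x -> E (D x)].

Definition diff_adjoin (K : fieldType) (D : K -> K) (E X : set K) : set K :=
  [set x | forall G, diff_subfield D G -> E `<=` G -> X `<=` G -> G x].

Definition algebraic_elt (K : fieldType) (E : set K) (x : K) : Prop :=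
  exists P : {poly K}, [/\ P != 0, forall k, E P`_k & root P x].

Definition exponential_elt (K : fieldType) (D : K -> K) (E : set K) (x : K) :
    Prop :=
  x != 0 /\ exists2 f, E f & D x = D f * x.

Definition integral_elt (K : fieldType) (D : K -> K) (E : set K) (x : K) :
    Prop :=
  E (D x).

Definition quadrature_chain (K : fieldType) (D : K -> K) (E : set K) (m : nat)
    (Fs : nat -> set K) : Prop :=
  Fs 0%N = E /\ forall i, (i < m)%N -> exists x : K,
    [\/ algebraic_elt (Fs i) x, exponential_elt D (Fs i) x |
        integral_elt D (Fs i) x] /\
    Fs i.+1 = diff_adjoin D (Fs i) [set x].

(* (K, D) is a differential field extension of C(z) via iota, large enough to
   contain both the Picard-Vessiot extension generated by a fundamental matrix
   Y, whose field of constants is C, and all the fields of the chain. *)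
Definition solvable_by_quadratures (C : fieldType) (p : nat)
    (B : 'M[ratfun C]_p) : Prop :=
  exists (K : fieldType) (D : K -> K) (iota : {rmorphism ratfun C -> K})
         (Y : 'M[K]_p),
  let F := diff_adjoin D (range iota) [set x | exists i j, x = Y i j] in
  [/\ is_derivation D /\ (forall f, D (iota f) = iota (rderiv f)),
      Y \in unitmx /\ map_mx D Y = map_mx iota B *m Y,
      forall x, F x -> D x = 0 -> exists c : C, x = iota (ratconst c) &
      exists (m : nat) (Fs : nat -> set K),
        quadrature_chain D (range iota) m Fs /\ F `<=` Fs m].

Definition upper_triangular (A : pzRingType) (p : nat) (M : 'M[A]_p) : Prop :=
  forall i j : 'I_p, (j < i)%N -> M i j = 0.

(* Main.v *)
Require Import Defs.
From HB Require Import structures.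
From mathcomp Require Import separable ring zify.

(** Suppose that the system is solvable by quadratures.  A column of a fundamental
matrix spans a line stable under the system, defined over the top of the tower;
specialising the generators of the tower one after the other, we get a stable line
whose coordinates are algebraic over C(z).  At every point of the sphere the formal
normal form, whose exponents do not differ by rational numbers, forces these algebraic
functions to be unramified and to have only poles there, hence they are rational.  The
residue theorem applied to the connection form of the line then says that the degree of
a primitive polynomial generator, plus the sum over the singular points of one formal
exponent and a nonnegative integer, is zero; since each exponent has real part greater
than -1/n, the degree is zero and the line is constant.  The quotient by this line has
exponents among the original ones, and induction on p triangularises the system.

Conversely a triangular system is solved row by row from the bottom in the field of
Laurent series at a regular point, by integrals and exponentials of integrals. *)

Set Implicit Arguments.
Unset Strict Implicit.
Unset Printing Implicit Defensive.

Local Open Scope classical_set_scope.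
Local Open Scope ring_scope.

(** * Derivations *)

(** The tower may bring in new constants and carries no Galois group. Specialisation takes the place
    of the Lie-Kolchin argument, and it needs a stable line rather than a solution: dividing a
    vector by one of its coordinates only changes the connection form, so the vector can be made to
    survive reduction modulo a prime ideal. A transcendental generator x is replaced by s with D s
    in s E[s], namely s = x for an exponential and s = 1/x for an integral; this makes setting s = 0
    compatible with the derivation.

    The local analysis takes place in C((t)) at every point of the sphere. The arithmetic condition
    on exponents is turned into a statement about series: if c' = e (om_j - om_l) c with c nonzero
    and e > 0, then om_j = om_l, because comparing residues would otherwise make the difference of
    two exponents rational. Regular points obey the same normal form with om = 0, so one local lemma
    serves everywhere.

    The induction closes because the exponents of the quotient at each point are the old ones with
    one removed: the same bound eps, with n eps <= 1, holds at every stage. *)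

Definition derivation (A : pzRingType) (D : A -> A) : Prop :=
  (forall x y, D (x + y) = D x + D y) /\
  (forall x y, D (x * y) = D x * y + x * D y).

Section Derivation.
Variables (A : comNzRingType) (D : A -> A).
Hypothesis HD : derivation D.

Lemma drvD x y : D (x + y) = D x + D y. Proof. exact: HD.1. Qed.

Lemma drvM x y : D (x * y) = D x * y + x * D y. Proof. exact: HD.2. Qed.

Lemma drv0 : D 0 = 0.
Proof. by apply: (addrI (D 0)); rewrite -drvD !addr0. Qed.

Lemma drvN x : D (- x) = - D x.
Proof. by apply: (addrI (D x)); rewrite -drvD !subrr drv0. Qed.

Lemma drvB x y : D (x - y) = D x - D y.
Proof. by rewrite drvD drvN. Qed.

Lemma drv1 : D 1 = 0.
Proof. by apply: (addrI (D 1)); have := drvM 1 1; rewrite !mulr1 mul1r addr0. Qed.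

Lemma drv_sum I (r : seq I) P (f : I -> A) :
  D (\sum_(i <- r | P i) f i) = \sum_(i <- r | P i) D (f i).
Proof. exact: (big_morph D drvD drv0). Qed.

Lemma drvX x n : D (x ^+ n) = n%:R * x ^+ n.-1 * D x.
Proof.
elim: n => [|n IH]; first by rewrite expr0 drv1 !mul0r.
rewrite exprS drvM IH; case: n IH => [|n] _ /=.
  by rewrite !expr0; ring.
by rewrite -[n.+2]addn1 natrD exprS; ring.
Qed.

End Derivation.

Section FieldDerivation.
Variables (K : fieldType) (D : K -> K).
Hypothesis HD : is_derivation D.

Lemma drvV x : D x^-1 = - D x / x ^+ 2.
Proof.
have [->|x0] := eqVneq x 0; first by rewrite invr0 (drv0 HD) oppr0 mul0r.
have := drvM HD x x^-1; rewrite divff // (drv1 HD) => /eqP.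
rewrite eq_sym addr_eq0 => /eqP e; apply: (mulfI x0).
by rewrite -[LHS]opprK -e; field.
Qed.

Lemma drvDiv x y : y != 0 -> D (x / y) = (D x * y - x * D y) / y ^+ 2.
Proof. by move=> y0; rewrite (drvM HD) drvV; field. Qed.

End FieldDerivation.

(** * Fraction fields: extension of derivations and of injective morphisms *)

Section Fraction.
Variable A : idomainType.

Local Notation "x %:F" := (@FracField.tofrac A x).

Lemma frac_surj (x : {fraction A}) : exists n d, d != 0 /\ x = n%:F / d%:F.
Proof.
pose r := generic_quotient.repr x.
exists (frac r).1, (frac r).2; have r0 := denom_ratioP r; split=> //.
apply: (canRL (mulfK _)); first by rewrite tofrac_eq0.
rewrite mulrC -[x]generic_quotient.reprK -/r.
rewrite -[LHS]/(FracField.mul _ _) !generic_quotient.piE.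
apply/generic_quotient.eqmodP; rewrite /= FracField.equivfE /FracField.mulf.
by rewrite !numden_Ratio ?oner_neq0 ?mul1r ?mulr1.
Qed.

Definition fracn (x : {fraction A}) := sval (cid (frac_surj x)).
Definition fracd (x : {fraction A}) := sval (cid (svalP (cid (frac_surj x)))).

Lemma fracd_neq0 x : fracd x != 0.
Proof. by have [] := svalP (cid (svalP (cid (frac_surj x)))). Qed.

Lemma fracE x : x = (fracn x)%:F / (fracd x)%:F.
Proof. by have [] := svalP (cid (svalP (cid (frac_surj x)))). Qed.

Section FracDeriv.
Variable delta : A -> A.
Hypothesis Hdelta : derivation delta.

Definition frac_deriv (x : {fraction A}) : {fraction A} :=
  (delta (fracn x) * fracd x - fracn x * delta (fracd x))%:F / (fracd x)%:F ^+ 2.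

(** Independence of the chosen representative: differentiate the cross relation between two
    fractions with the same value. *)
Lemma frac_derivE a b : b != 0 ->
  frac_deriv (a%:F / b%:F) = (delta a * b - a * delta b)%:F / b%:F ^+ 2.
Proof.
move=> b0; set x := a%:F / _; rewrite /frac_deriv.
have d0 := fracd_neq0 x; have := fracE x.
move: (fracn x) (fracd x) d0 => n d d0 /eqP.
rewrite /x eqr_div ?tofrac_eq0 // -!tofracM tofrac_eq => /eqP e.
apply/eqP; rewrite eqr_div ?expf_neq0 ?tofrac_eq0 //.
rewrite -!tofracXn -!tofracM tofrac_eq.
have := congr1 delta e; rewrite !(drvM Hdelta) => e'.
have -> : (delta n * d - n * delta d) * b ^+ 2 =
  (delta n * b + n * delta b) * (b * d) - (n * b) * (delta b * d + b * delta d).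
  by ring.
apply/eqP; have -> : delta n * b + n * delta b = delta a * d + a * delta d.
  by rewrite e'; ring.
by rewrite -e; ring.
Qed.

Lemma frac_deriv_tofrac a : frac_deriv a%:F = (delta a)%:F.
Proof.
rewrite -[a%:F]divr1 -tofrac1 frac_derivE ?oner_neq0 // (drv1 Hdelta) tofrac1.
by rewrite mulr1 mulr0 subr0 expr1n divr1.
Qed.

Lemma frac_deriv_derivation : is_derivation frac_deriv.
Proof.
split=> x y.
  rewrite {1}(fracE x) {1}(fracE y); have dx := fracd_neq0 x.
  have dy := fracd_neq0 y.
  rewrite addf_div ?tofrac_eq0 // -!tofracM -tofracD.
  rewrite frac_derivE ?mulf_neq0 // /frac_deriv addf_div ?expf_neq0 ?tofrac_eq0 //.
  rewrite -!tofracXn -!tofracM -!tofracD -exprMn.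
  congr (FracField.tofrac _ / FracField.tofrac _).
  by rewrite (drvD Hdelta) !(drvM Hdelta); ring.
rewrite {1 3}(fracE x) {1 2}(fracE y); have dx := fracd_neq0 x.
have dy := fracd_neq0 y.
rewrite mulf_div -!tofracM frac_derivE ?mulf_neq0 // /frac_deriv !mulf_div.
rewrite -!tofracXn -!tofracM -?[RHS]/(_ / _ + _ / _).
rewrite addf_div ?tofrac_eq0 ?mulf_neq0 ?expf_neq0 //.
apply/eqP; rewrite eqr_div ?tofrac_eq0 ?mulf_neq0 ?expf_neq0 ?tofrac_eq0 ?mulf_neq0 ?expf_neq0 //.
rewrite -!tofracM -!tofracD -!tofracM tofrac_eq !(drvM Hdelta).
by apply/eqP; ring.
Qed.

End FracDeriv.

Section FracMap.
Variables (M : fieldType) (phi : {rmorphism A -> M}).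
Hypothesis phi0 : forall a, a != 0 -> phi a != 0.

Definition frac_map (x : {fraction A}) : M := phi (fracn x) / phi (fracd x).

Lemma frac_mapE a b : b != 0 -> frac_map (a%:F / b%:F) = phi a / phi b.
Proof.
move=> b0; set x := a%:F / _; rewrite /frac_map.
have d0 := fracd_neq0 x; have := fracE x.
move: (fracn x) (fracd x) d0 => n d d0 /eqP.
rewrite /x eqr_div ?tofrac_eq0 // -!tofracM tofrac_eq => /eqP e.
by apply/eqP; rewrite eqr_div ?phi0 // -!rmorphM e.
Qed.

Lemma frac_map_tofrac a : frac_map a%:F = phi a.
Proof. by rewrite -[a%:F]divr1 -tofrac1 frac_mapE ?oner_neq0 // rmorph1 divr1. Qed.

Lemma frac_map_zmod : zmod_morphism frac_map.
Proof.
move=> x y; rewrite {1}(fracE x) {1}(fracE y); have dx := fracd_neq0 x.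
have dy := fracd_neq0 y.
rewrite -mulNr addf_div ?tofrac_eq0 // -!tofracN -!tofracM -tofracD.
rewrite frac_mapE ?mulf_neq0 // /frac_map -mulNr addf_div ?phi0 //.
by rewrite -!rmorphN -!rmorphM -rmorphD.
Qed.

Lemma frac_map_monoid : monoid_morphism frac_map.
Proof.
split; first by rewrite -tofrac1 frac_map_tofrac rmorph1.
move=> x y; rewrite {1}(fracE x) {1}(fracE y); have dx := fracd_neq0 x.
have dy := fracd_neq0 y.
by rewrite mulf_div -!tofracM frac_mapE ?mulf_neq0 // /frac_map mulf_div -!rmorphM.
Qed.

Definition frac_rmorphism : {rmorphism {fraction A} -> M} :=
  HB.pack_for {rmorphism {fraction A} -> M} frac_map
    (GRing.isZmodMorphism.Build _ _ _ frac_map_zmod)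
    (GRing.isMonoidMorphism.Build _ _ _ frac_map_monoid).

End FracMap.
End Fraction.

Lemma rmorphism_of (A B : nzRingType) (f : A -> B) :
  (forall x y, f (x + y) = f x + f y) -> (forall x y, f (x * y) = f x * f y) ->
  f 1 = 1 -> exists g : {rmorphism A -> B}, g =1 f.
Proof.
move=> fD fM f1.
have f0 : f 0 = 0 by apply: (addrI (f 0)); rewrite -fD !addr0.
have fN x : f (- x) = - f x by apply: (addrI (f x)); rewrite -fD !subrr f0.
have fz : zmod_morphism f by move=> x y; rewrite fD fN.
have fm : monoid_morphism f by split.
by exists (HB.pack_for {rmorphism A -> B} f (GRing.isZmodMorphism.Build _ _ _ fz)
    (GRing.isMonoidMorphism.Build _ _ _ fm)).
Qed.

(** * Rings without zero divisors as integral domains, inverses being chosen classically *)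

Section ClassicalUnits.
Variable Q : comNzRingType.
Hypothesis Q_domain : forall x y : Q, x * y = 0 -> (x == 0) || (y == 0).

(* The dummy [let] makes the instances below depend on [Q_domain]. *)
Definition domain_type : Type := let _ := Q_domain in Q.

HB.instance Definition _ := GRing.ComNzRing.on domain_type.

Let has_inv (x : domain_type) := exists y, y * x = 1.
Let cunit : {pred domain_type} := [pred x | `[< has_inv x >]].
Let cinv (x : domain_type) : domain_type :=
  if pselect (has_inv x) is left h then sval (cid h) else x.

Let cmulVx : {in cunit, left_inverse 1 cinv *%R}.
Proof.
by move=> x /asboolP h; rewrite /cinv; case: pselect => // h'; case: cid.
Qed.

Let cunitPl (x y : domain_type) : y * x = 1 -> cunit x.
Proof. by move=> h; apply/asboolP; exists y. Qed.

Let cinv_out : {in [predC cunit], cinv =1 id}.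
Proof.
by move=> x /negP h; rewrite /cinv; case: pselect => // h'; case: h; apply/asboolP.
Qed.

HB.instance Definition _ := GRing.ComNzRing_hasMulInverse.Build domain_type
  cmulVx cunitPl cinv_out.
HB.instance Definition _ := GRing.ComUnitRing_isIntegral.Build domain_type Q_domain.

End ClassicalUnits.

(** * Residue field of a differential prime ideal of a subring *)

Section SubQuotient.
Variables (A : comNzRingType) (delta : A -> A) (S I : set A).

Definition subring_set := [/\ S 1, forall x y, S x -> S y -> S (x - y) &
  forall x y, S x -> S y -> S (x * y)].

Definition prime_ideal_set := [/\ I `<=` S, I 0, ~ I 1,
  forall x y, I x -> I y -> I (x - y) &
  (forall x y, S x -> I y -> I (x * y)) /\
  forall x y, S x -> S y -> I (x * y) -> I x \/ I y].

Hypotheses (Hdelta : derivation delta) (HS : subring_set) (HI : prime_ideal_set).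
Hypotheses (deltaS : forall x, S x -> S (delta x)).
Hypotheses (deltaI : forall x, I x -> I (delta x)).

Let Sp : {pred A} := [pred x | `[< S x >]].

Let Sp_subring : subring_closed Sp.
Proof.
case: HS => S1 SB SM; split; first by apply/asboolP.
  by move=> x y /asboolP Sx /asboolP Sy; apply/asboolP/SB.
by move=> x y /asboolP Sx /asboolP Sy; apply/asboolP/SM.
Qed.

HB.instance Definition _ := GRing.isSubringClosed.Build A Sp Sp_subring.

Let T := {x : A | x \in Sp}.
HB.instance Definition _ := SubChoice.on T.
HB.instance Definition _ := [SubChoice_isSubComNzRing of T by <:].

Let J : {pred T} := [pred x : T | `[< I (val x) >]].

Let J_ideal : idealr_closed J.
Proof.
case: HI => IS I0 I1 IB [IM IP]; split.
- by apply/asboolP.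
- by apply/asboolP.
move=> a x y /asboolP Ix /asboolP Iy; apply/asboolP.
rewrite rmorphD rmorphM -[X in I (_ + X)]opprK.
apply: (IB); last by rewrite -sub0r; apply: IB.
by apply: IM => //; have /asboolP := valP a.
Qed.

Let J_prime : prime_idealr_closed J.
Proof.
case: HI => IS I0 I1 IB [IM IP] x y /asboolP /= /IP h.
by have [] : I (val x) \/ I (val y);
  [apply: h; [have /asboolP := valP x | have /asboolP := valP y]|
   move=> h'; apply/orP; left; apply/asboolP |
   move=> h'; apply/orP; right; apply/asboolP].
Qed.

HB.instance Definition _ := isIdealr.Build T J J_ideal.
HB.instance Definition _ := isPrimeIdealrClosed.Build T J J_prime.

Let Q := domain_type (@Quotient.rquot_IdomainAxiom T J).

Let toT (x : A) : T := insubd (0 : T) x.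
Let valT x : S x -> val (toT x) = x.
Proof. by move=> Sx; rewrite insubdK //; apply/asboolP. Qed.
Let ST (x : T) : S (val x). Proof. by have /asboolP := valP x. Qed.
Let dT (x : T) : T := toT (delta (val x)).
Let val_dT x : val (dT x) = delta (val x).
Proof. by rewrite valT //; apply: deltaS. Qed.

Let piQ (x : T) : Q := \pi_({ideal_quot J})%qT x.
Let piQ_eq x y : (piQ x = piQ y) <-> I (val x - val y).
Proof.
rewrite /piQ; split=> [/eqP|h].
  by rewrite -(@Quotient.idealrBE T J) => /asboolP; rewrite rmorphB.
by apply/eqP; rewrite -(@Quotient.idealrBE T J); apply/asboolP; rewrite rmorphB.
Qed.
Let piQD x y : piQ (x + y) = piQ x + piQ y.
Proof. exact: (rmorphD (\pi_({ideal_quot J})%qT)). Qed.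
Let piQM x y : piQ (x * y) = piQ x * piQ y.
Proof. exact: (rmorphM (\pi_({ideal_quot J})%qT)). Qed.
Let piQ1 : piQ 1 = 1.
Proof. exact: (rmorph1 (\pi_({ideal_quot J})%qT)). Qed.
Let repQ (x : Q) : T := generic_quotient.repr (x : {ideal_quot J}).
Let repQK x : piQ (repQ x) = x.
Proof. exact: (@generic_quotient.reprK _ {ideal_quot J} x). Qed.
Let dQ (x : Q) : Q := piQ (dT (repQ x)).
Let dQ_pi x : dQ (piQ x) = piQ (dT x).
Proof.
apply/piQ_eq; rewrite !val_dT -(drvB Hdelta); apply: deltaI.
by apply/piQ_eq; rewrite repQK.
Qed.
Let dTD a b : dT (a + b) = dT a + dT b.
Proof.
apply: val_inj; apply: etrans (val_dT _) _; apply: etrans (congr1 delta (rmorphD val a b)) _.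
apply: etrans (drvD Hdelta _ _) _; apply: esym; apply: etrans (rmorphD val _ _) _.
by congr (_ + _); apply: val_dT.
Qed.
Let dTM a b : dT (a * b) = dT a * b + a * dT b.
Proof.
apply: val_inj; apply: etrans (val_dT _) _; apply: etrans (congr1 delta (rmorphM val a b)) _.
apply: etrans (drvM Hdelta _ _) _; apply: esym; apply: etrans (rmorphD val _ _) _.
apply: etrans (congr2 _ (rmorphM val _ _) (rmorphM val _ _)) _.
by congr (_ * _ + _ * _); apply: val_dT.
Qed.
Let piQ_surj (x : Q) : exists a, x = piQ a.
Proof. by exists (repQ x). Qed.
Let dQ_der : derivation dQ.
Proof.
split=> x y; have [a ->] := piQ_surj x; have [b ->] := piQ_surj y.
  by rewrite !dQ_pi -!piQD !dQ_pi dTD.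
by rewrite !dQ_pi -!piQM -!piQD !dQ_pi dTM.
Qed.

(** The field is Frac(S/I) with the induced derivation. The map [pi] is total on [A] for convenience
    and is meaningful on [S] only. It serves for the specialisation of a tower and for the extension
    of C((t)) defined by an irreducible factor. *)
Lemma subquotient_field : exists (F : fieldType) (DF : F -> F) (pi : A -> F),
  [/\ is_derivation DF /\ pi 1 = 1,
      forall x y, S x -> S y -> pi (x + y) = pi x + pi y,
      forall x y, S x -> S y -> pi (x * y) = pi x * pi y,
      forall x, S x -> pi (delta x) = DF (pi x) &
      (forall x, S x -> pi x = 0 <-> I x) /\
      forall z, exists x y, [/\ S x, S y, pi y != 0 & z = pi x / pi y]].
Proof.
have [S1 SB SM] := HS; have [IS I0 I1 IB [IM IP]] := HI.
have S0 : S 0 by rewrite -(subrr 1); apply: SB.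
have SD x y : S x -> S y -> S (x + y).
  by move=> Sx Sy; rewrite -[y]opprK; apply: (SB) => //; rewrite -sub0r; apply: SB.
pose pi x : {fraction Q} := FracField.tofrac (piQ (toT x)).
exists ({fraction Q} : fieldType), (frac_deriv dQ), pi; split.
- split; first exact: (frac_deriv_derivation dQ_der).
  by rewrite /pi -tofrac1 -piQ1; do 2!congr (_ _); apply: val_inj; rewrite valT ?rmorph1.
- move=> x y Sx Sy; rewrite /pi -tofracD -piQD; do 2!congr (_ _).
  apply: val_inj; apply: etrans (valT (SD _ _ Sx Sy)) _; apply: esym.
  by apply: etrans (rmorphD val _ _) _; congr (_ + _); apply: valT.
- move=> x y Sx Sy; rewrite /pi -tofracM -piQM; do 2!congr (_ _).
  apply: val_inj; apply: etrans (valT (SM _ _ Sx Sy)) _; apply: esym.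
  by apply: etrans (rmorphM val _ _) _; congr (_ * _); apply: valT.
- move=> x Sx; rewrite /pi frac_deriv_tofrac // dQ_pi; do 2!congr (_ _).
  by apply: val_inj; rewrite val_dT !valT //; apply: deltaS.
have piQ0 : piQ 0 = 0 by apply: (addrI (piQ 0)); rewrite -piQD !addr0.
split=> [x Sx|z].
  rewrite /pi; split=> [/eqP|Ix].
    by rewrite tofrac_eq0 -piQ0 => /eqP/piQ_eq; rewrite valT // rmorph0 subr0.
  by apply/eqP; rewrite tofrac_eq0 -piQ0; apply/eqP/piQ_eq; rewrite valT // rmorph0 subr0.
have [a [b [b0 ->]]] := frac_surj z.
have toTK (t : T) : toT (val t) = t by apply: val_inj; rewrite valT.
exists (val (repQ a)), (val (repQ b)).
by rewrite /pi !toTK !repQK tofrac_eq0; split.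
Qed.

End SubQuotient.

(** * Power series and Laurent series *)

(** Course-of-values recursion in fixed-point form: since [Phi n] looks only below [n], iterating k
    times settles the first k values. It yields inverses of series and solutions of differential
    equations. *)
Lemma rec_exists (A : Type) (Phi : nat -> (nat -> A) -> A) (a0 : A) :
  (forall n f g, (forall i, (i < n)%N -> f i = g i) -> Phi n f = Phi n g) ->
  exists f, forall n, f n = Phi n f.
Proof.
move=> Phi_loc.
pose step (f : nat -> A) := fun n => Phi n f.
pose F k := iter k step (fun=> a0).
have stab k n : (n < k)%N -> F k.+1 n = F k n.
  elim: k n => // k IH n nk; rewrite -[F k.+2]/(step (F k.+1)) -[F k.+1 in RHS]/(step (F k)).
  by apply: Phi_loc => i ilt; apply: IH; apply: leq_trans ilt _.
have stab2 k n : (n < k)%N -> F k n = F n.+1 n.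
  elim: k => // k IH; rewrite ltnS leq_eqVlt => /predU1P[-> //|nk].
  by rewrite stab // IH.
exists (fun n => F n.+1 n) => n; rewrite {1}(_ : F n.+1 n = Phi n (F n)) //.
by apply: Phi_loc => i ilt; rewrite (stab2 n).
Qed.

Section PowerSeries.
Variable C : fieldType.

Definition pseries := nat -> C.

HB.instance Definition _ := GRing.Zmodule.on pseries.

(** A coefficient of a product involves finitely many coefficients, so the ring laws are inherited
    from polynomials through truncation. *)
Let tr n (u : pseries) : {poly C} := \poly_(i < n.+1) u i.

Definition pseries_mul (u v : pseries) : pseries :=
  fun n => \sum_(i < n.+1) u i * v (n - i)%N.

Definition pseries_one : pseries := fun n => (n == 0%N)%:R.

Let coef_tr n u i : (i <= n)%N -> (tr n u)`_i = u i.
Proof. by move=> h; rewrite coef_poly ltnS h. Qed.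

Let coefM_eq (p q p' q' : {poly C}) n : (forall i, (i <= n)%N -> p`_i = p'`_i) ->
  (forall i, (i <= n)%N -> q`_i = q'`_i) -> (p * q)`_n = (p' * q')`_n.
Proof.
move=> hp hq; rewrite !coefM; apply: eq_bigr => i _.
by rewrite hp ?hq ?leq_subr // -ltnS.
Qed.

Let mulE m n u v : (n <= m)%N -> pseries_mul u v n = (tr m u * tr m v)`_n.
Proof.
move=> nm; rewrite coefM; apply: eq_bigr => i _.
rewrite !coef_tr //; first by apply: leq_trans (leq_subr _ _) nm.
by apply: leq_trans nm; rewrite -ltnS.
Qed.

Let coef_trM m n u v : (n <= m)%N -> (tr m (pseries_mul u v))`_n = (tr m u * tr m v)`_n.
Proof. by move=> nm; rewrite coef_tr // (mulE _ _ nm). Qed.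

Lemma pseries_mulC : commutative pseries_mul.
Proof. by move=> u v; apply/funext => n; rewrite !(@mulE n n) // mulrC. Qed.

Lemma pseries_mulA : associative pseries_mul.
Proof.
move=> u v w; apply/funext => n; rewrite !(@mulE n n) //.
transitivity (tr n u * (tr n v * tr n w))`_n.
  by apply: coefM_eq => i iN //; rewrite coef_trM.
by rewrite mulrA; apply: coefM_eq => i iN //; rewrite coef_trM.
Qed.

Lemma pseries_mul1 : left_id pseries_one pseries_mul.
Proof.
move=> u; apply/funext => n; rewrite /pseries_mul big_ord_recl /= subn0.
by rewrite mul1r big1 ?addr0 // => i _; rewrite mul0r.
Qed.

Lemma pseries_mulD : left_distributive pseries_mul +%R.
Proof.
move=> u v w; apply/funext => n; rewrite /pseries_mul -[RHS]big_split /=.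
by apply: eq_bigr => i _; rewrite mulrDl.
Qed.

Lemma pseries_one_neq0 : pseries_one != 0.
Proof. by apply/eqP => /(congr1 (fun f => f 0%N)) /eqP; rewrite /= oner_eq0. Qed.

HB.instance Definition _ := GRing.Zmodule_isComNzRing.Build pseries
  pseries_mulA pseries_mulC pseries_mul1 pseries_mulD pseries_one_neq0.

Lemma pseries_domain (u v : pseries) : u * v = 0 -> (u == 0) || (v == 0).
Proof.
move=> uv0; apply/norP => -[u0 v0].
have ex (w : pseries) : w != 0 -> exists n, w n != 0.
  move=> w0; apply/not_existsP => h; case/eqP: w0; apply/funext => n.
  by have /negP := h n; rewrite negbK => /eqP.
case: (ex_minnP (ex _ u0)) => m um hm; case: (ex_minnP (ex _ v0)) => n vn hn.
have := congr1 (fun f => f (m + n)%N) uv0.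
rewrite -[LHS]/(\sum_(i < (m + n).+1) u i * v (m + n - i)%N) => /eqP.
have lt : (m < (m + n).+1)%N by rewrite ltnS leq_addr.
rewrite (bigD1 (Ordinal lt)) //= big1 ?addr0 => [|i]; last first.
  rewrite -val_eqE /= => im; case: (ltngtP i m) im => // h _.
    suff -> : u i = 0 by rewrite mul0r.
    by apply/eqP/negP => /negP /hm; rewrite leqNgt h.
  suff -> : v (m + n - i)%N = 0 by rewrite mulr0.
  apply/eqP/negP => /negP /hn; rewrite leqNgt.
  by have := ltn_ord i; move: h; lia.
by rewrite addKn mulf_eq0 (negPf um) (negPf vn).
Qed.

Definition PS := domain_type pseries_domain.

HB.instance Definition _ := GRing.IntegralDomain.on PS.

Definition mkps (f : nat -> C) : PS := f.
Definition psc (u : PS) (n : nat) : C := (u : pseries) n.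

Lemma psP (u v : PS) : psc u =1 psc v -> u = v.
Proof. by move=> h; apply/funext => n; apply: h. Qed.

Lemma psc_mk f n : psc (mkps f) n = f n. Proof. by []. Qed.
Lemma pscD u v n : psc (u + v) n = psc u n + psc v n. Proof. by []. Qed.
Lemma pscB u v n : psc (u - v) n = psc u n - psc v n. Proof. by []. Qed.
Lemma psc0 n : psc 0 n = 0. Proof. by []. Qed.
Lemma psc1 n : psc 1 n = (n == 0%N)%:R. Proof. by []. Qed.
Lemma pscM u v n : psc (u * v) n = \sum_(i < n.+1) psc u i * psc v (n - i)%N.
Proof. by []. Qed.

Lemma psc_sum I (r : seq I) P (F : I -> PS) n :
  psc (\sum_(i <- r | P i) F i) n = \sum_(i <- r | P i) psc (F i) n.
Proof. exact: (big_morph (psc^~ n) (fun u v => pscD u v n) (psc0 n)). Qed.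

Lemma psc00 u v : psc (u * v) 0 = psc u 0 * psc v 0.
Proof. by rewrite pscM big_ord_recl big_ord0 addr0. Qed.

Definition ps0 (u : PS) : C := psc u 0.

Lemma ps0_zmod : zmod_morphism ps0. Proof. by []. Qed.
Lemma ps0_monoid : monoid_morphism ps0.
Proof. by split=> // u v; rewrite /ps0 psc00. Qed.
HB.instance Definition _ := GRing.isZmodMorphism.Build PS C ps0 ps0_zmod.
HB.instance Definition _ := GRing.isMonoidMorphism.Build PS C ps0 ps0_monoid.

Definition ps_poly (p : {poly C}) : PS := mkps (fun i => p`_i).

Lemma ps_poly_zmod : zmod_morphism ps_poly.
Proof. by move=> p q; apply: psP => n; rewrite pscB !psc_mk coefB. Qed.
Lemma ps_poly_monoid : monoid_morphism ps_poly.
Proof.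
split=> [|p q]; apply: psP => n; first by rewrite psc_mk psc1 coef1.
by rewrite psc_mk coefM pscM; apply: eq_bigr.
Qed.
HB.instance Definition _ := GRing.isZmodMorphism.Build {poly C} PS ps_poly ps_poly_zmod.
HB.instance Definition _ := GRing.isMonoidMorphism.Build {poly C} PS ps_poly ps_poly_monoid.

Lemma ps_poly_eq0 p : (ps_poly p == 0) = (p == 0).
Proof.
apply/eqP/eqP => [h|->]; last exact: rmorph0.
by apply/polyP => i; rewrite coef0 -[LHS]/(psc (ps_poly p) i) h.
Qed.

Definition psC (c : C) : PS := ps_poly c%:P.
Definition psX : PS := ps_poly 'X.

Lemma pscC c n : psc (psC c) n = if n == 0%N then c else 0.
Proof. by rewrite psc_mk coefC. Qed.

Lemma pscCM c u n : psc (psC c * u) n = c * psc u n.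
Proof.
rewrite pscM big_ord_recl /= subn0 pscC /= big1 ?addr0 // => i _.
by rewrite pscC mul0r.
Qed.

Lemma pscXnM n u i : psc (psX ^+ n * u) i = if (i < n)%N then 0 else psc u (i - n)%N.
Proof.
rewrite /psX -rmorphXn /= pscM.
case: ltnP => h.
  rewrite big1 // => j _; rewrite psc_mk coefXn.
  by rewrite (_ : nat_of_ord j == n = false) ?mul0r //; have := ltn_ord j; lia.
have lt : (n < i.+1)%N by [].
rewrite (bigD1 (Ordinal lt)) //= psc_mk coefXn eqxx mul1r big1 ?addr0 // => j.
by rewrite -val_eqE /= psc_mk coefXn => /negPf ->; rewrite mul0r.
Qed.

Lemma psX_neq0 : psX != 0.
Proof. by rewrite ps_poly_eq0 polyX_eq0. Qed.

Lemma ps_decomp u : u != 0 -> exists n v, u = psX ^+ n * v /\ psc v 0 != 0.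
Proof.
move=> u0; have ex : exists n, psc u n != 0.
  apply/not_existsP => h; case/eqP: u0; apply: psP => n.
  by have /negP := h n; rewrite negbK psc0 => /eqP.
case: (ex_minnP ex) => n un hn; exists n, (mkps (fun i => psc u (n + i)%N)).
split; last by rewrite psc_mk addn0.
apply: psP => i; rewrite pscXnM; case: ltnP => h; last by rewrite psc_mk subnKC.
by apply/eqP/negP => /negP /hn; rewrite leqNgt h.
Qed.

Lemma ps_inv u : psc u 0 != 0 -> exists v, u * v = 1.
Proof.
move=> u0; pose Phi n (f : nat -> C) :=
  if n == 0%N then (psc u 0)^-1 else - (psc u 0)^-1 * \sum_(i < n) psc u i.+1 * f (n - i.+1)%N.
have [|f Hf] := @rec_exists C Phi 0.
  move=> n f g h; rewrite /Phi; case: eqP => // /eqP n0; congr (_ * _).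
  by apply: eq_bigr => i _; rewrite h //; have := ltn_ord i; lia.
exists (mkps f); apply: psP => n; rewrite pscM psc1 big_ord_recl /= subn0 psc_mk Hf /Phi.
case: n => [|n] /=; first by rewrite big_ord0 addr0 divff.
by rewrite mulrA mulrN divff // mulN1r addrC subrr.
Qed.

Definition ps_deriv (u : PS) : PS := mkps (fun n => n.+1%:R * psc u n.+1).

Lemma psc_deriv u n : psc (ps_deriv u) n = n.+1%:R * psc u n.+1.
Proof. by []. Qed.

Lemma ps_deriv_derivation : derivation ps_deriv.
Proof.
split=> u v; apply: psP => n; first by rewrite pscD !psc_deriv pscD mulrDr.
rewrite psc_deriv pscM pscD !pscM mulr_sumr.
under eq_bigr => i _.
  rewrite (_ : _ * _ = i%:R * psc u i * psc v (n.+1 - i)%N +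
    psc u i * ((n.+1 - i)%:R * psc v (n.+1 - i)%N)); last first.
    have le : (i <= n.+1)%N by rewrite -ltnS.
    have -> : n.+1%:R = i%:R + (n.+1 - i)%:R :> C by rewrite -natrD subnKC.
    by ring.
  over.
rewrite big_split /=; congr (_ + _).
  rewrite big_ord_recl /= !mul0r add0r; apply: eq_bigr => i _.
  by rewrite psc_deriv.
rewrite big_ord_recr /= subnn mul0r mulr0 addr0; apply: eq_bigr => i _.
by rewrite psc_deriv subSn // -ltnS.
Qed.

Lemma ps_deriv_poly p : ps_deriv (ps_poly p) = ps_poly p^`().
Proof. by apply: psP => n; rewrite !psc_mk coef_deriv mulr_natl. Qed.

(** As a fraction field, C((t)) receives its field structure and its derivation from the general
    construction; [ls_decomp] shows that only powers of t have to be inverted. *)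
Definition LS := {fraction PS}.
HB.instance Definition _ := GRing.Field.on LS.

Definition ls (u : PS) : LS := FracField.tofrac u.
Lemma ls_zmod : zmod_morphism ls.
Proof. exact: (rmorphB (@FracField.tofrac PS)). Qed.
Lemma ls_monoid : monoid_morphism ls.
Proof. by split; [exact: tofrac1 | exact: tofracM]. Qed.
HB.instance Definition _ := GRing.isZmodMorphism.Build PS LS ls ls_zmod.
HB.instance Definition _ := GRing.isMonoidMorphism.Build PS LS ls ls_monoid.

Definition lsX : LS := ls psX.
Definition lsC (c : C) : LS := ls (psC c).
Definition ls_deriv : LS -> LS := frac_deriv ps_deriv.

Lemma ls_eq0 u : (ls u == 0) = (u == 0). Proof. exact: tofrac_eq0. Qed.
Lemma ls_inj : injective ls.
Proof. by move=> u v /eqP; rewrite tofrac_eq => /eqP. Qed.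

Lemma lsM u v : ls (u * v) = ls u * ls v. Proof. exact: rmorphM. Qed.
Lemma lsB u v : ls (u - v) = ls u - ls v. Proof. exact: rmorphB. Qed.
Lemma lsD u v : ls (u + v) = ls u + ls v. Proof. exact: rmorphD. Qed.
Lemma lsXn n : ls (psX ^+ n) = lsX ^+ n. Proof. exact: rmorphXn. Qed.

Lemma lsX_neq0 : lsX != 0. Proof. by rewrite ls_eq0 psX_neq0. Qed.

Lemma lsC_zmod : zmod_morphism lsC.
Proof. by move=> x y; rewrite /lsC /psC !rmorphB. Qed.
Lemma lsC_monoid : monoid_morphism lsC.
Proof. by split=> [|x y]; rewrite /lsC /psC ?rmorph1 // !rmorphM. Qed.
HB.instance Definition _ := GRing.isZmodMorphism.Build C LS lsC lsC_zmod.
HB.instance Definition _ := GRing.isMonoidMorphism.Build C LS lsC lsC_monoid.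

Lemma ls_deriv_derivation : is_derivation ls_deriv.
Proof. exact: (frac_deriv_derivation ps_deriv_derivation). Qed.

Lemma ls_derivE u : ls_deriv (ls u) = ls (ps_deriv u).
Proof. exact: (frac_deriv_tofrac ps_deriv_derivation). Qed.

Lemma ls_derivX : ls_deriv lsX = 1.
Proof. by rewrite /lsX ls_derivE /psX ps_deriv_poly derivX rmorph1 rmorph1. Qed.

Lemma ls_derivC c : ls_deriv (lsC c) = 0.
Proof. by rewrite /lsC ls_derivE /psC ps_deriv_poly derivC !rmorph0. Qed.

Lemma ls_unit u : psc u 0 != 0 -> exists v, (ls u)^-1 = ls v /\ psc v 0 != 0.
Proof.
move=> u0; have [v uv] := ps_inv u0; exists v; split.
  apply: (mulfI (_ : ls u != 0)).
    by rewrite ls_eq0; apply: contraNneq u0 => ->.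
  by rewrite divff ?ls_eq0 -?rmorphM ?uv ?rmorph1 //; apply: contraNneq u0 => ->.
have := congr1 (psc^~ 0%N) uv; rewrite psc00 psc1 => h.
by apply/eqP => v0; move: h; rewrite v0 mulr0 => /eqP; rewrite eq_sym oner_eq0.
Qed.

Lemma ls_decomp (f : LS) : f != 0 ->
  exists (n : int) (u : PS), f = lsX ^ n * ls u /\ psc u 0 != 0.
Proof.
have [a [b [b0 ->]]] := frac_surj f => f0.
have a0 : a != 0 by apply: contraNneq f0 => ->; rewrite tofrac0 mul0r.
have [m [u [-> u0]]] := ps_decomp a0; have [n [v [-> v0]]] := ps_decomp b0.
have [w [vw w0]] := ls_unit v0.
exists (m%:Z - n%:Z), (u * w); split; last by rewrite psc00 mulf_neq0.
rewrite -/(ls _) -/(ls (psX ^+ n * v)) !lsM !lsXn invfM vw.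
by rewrite expfzDr ?lsX_neq0 // -exprnP -invr_expz -exprnP; ring.
Qed.

Lemma ls_clear (f : LS) : exists (n : nat) (u : PS), f * lsX ^+ n = ls u.
Proof.
have [->|f0] := eqVneq f 0; first by exists 0%N, 0; rewrite mul0r rmorph0.
have [[n|n] [u [-> _]]] := ls_decomp f0.
  by exists 0%N, (psX ^+ n * u); rewrite mulr1 lsM lsXn.
exists n.+1, u; rewrite NegzE -invr_expz -exprnP mulrAC mulVf ?mul1r //.
by rewrite expf_neq0 ?lsX_neq0.
Qed.

Definition lsn (f : LS) : nat := sval (cid (ls_clear f)).
Definition lsu (f : LS) : PS := sval (cid (svalP (cid (ls_clear f)))).

Lemma lsnuE f : f * lsX ^+ lsn f = ls (lsu f).
Proof. exact: svalP (cid (svalP (cid (ls_clear f)))). Qed.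

(** The coefficient of t^k in t^(-n) u. A Laurent series is read through any power of t that clears
    its pole, and [lscE] makes the reading independent of that power. *)
Definition shiftc (n : nat) (u : PS) (k : int) : C :=
  if k + n%:Z is Posz m then psc u m else 0.

Definition lsc (f : LS) : int -> C := shiftc (lsn f) (lsu f).

Lemma lscE f n u : f * lsX ^+ n = ls u -> lsc f = shiftc n u.
Proof.
move=> h; rewrite /lsc; move: (lsn f) (lsu f) (lsnuE f) => m v h'.
have : psX ^+ m * u = psX ^+ n * v.
  apply: ls_inj; rewrite !lsM !lsXn -h -h'.
  by ring.
move=> e; apply/funext => k; rewrite /shiftc.
have ec l : (if (l < m)%N then 0 else psc u (l - m)%N) =
    (if (l < n)%N then 0 else psc v (l - n)%N).
  by have := congr1 (psc^~ l) e; rewrite !pscXnM.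
case E: (k + m%:Z) => [i|i]; case E': (k + n%:Z) => [j|j] //.
- have := ec (i + n)%N; case: ltnP => h1; case: ltnP => h2; try lia.
  by rewrite addnK (_ : i + n - m = j)%N //; lia.
- have := ec (i + n)%N; case: ltnP => h1; case: ltnP => h2; try lia.
  by rewrite addnK.
- have := ec (j + m)%N; case: ltnP => h1; case: ltnP => h2; try lia.
  by rewrite addnK.
Qed.

Lemma lsc_ls u k : lsc (ls u) k = if k is Posz m then psc u m else 0.
Proof. by rewrite (@lscE _ 0 u) ?mulr1 // /shiftc addr0. Qed.

Lemma lsc_inj f g : lsc f =1 lsc g -> f = g.
Proof.
move=> h; have [m [u hu]] := ls_clear f; have [n [v hv]] := ls_clear g.
have tt : lsX ^+ (m + n) != 0 by rewrite expf_neq0 ?lsX_neq0.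
apply: (mulIf tt); rewrite {1}exprD exprD mulrA hu [lsX ^+ m * _]mulrC mulrA hv.
rewrite -!lsXn -!lsM; congr ls; apply: psP => i.
rewrite ![_ * psX ^+ _]mulrC !pscXnM.
have := h (i%:Z - (m + n)%N%:Z); rewrite (lscE hu) (lscE hv) /shiftc.
case E: (_ + m%:Z) => [j|j]; case E': (_ + n%:Z) => [l|l] e.
- case: ltnP => ?; case: ltnP => ?; try lia.
  by rewrite (_ : i - n = j)%N 1?(_ : i - m = l)%N //; lia.
- by case: ltnP => ?; case: ltnP => ?; try lia; rewrite (_ : i - n = j)%N //; lia.
- by case: ltnP => ?; case: ltnP => ?; try lia; rewrite (_ : i - m = l)%N //; lia.
- by case: ltnP => ?; case: ltnP => ?; try lia.
Qed.

Lemma lscB f g k : lsc (f - g) k = lsc f k - lsc g k.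
Proof.
have [m [u hu]] := ls_clear f; have [n [v hv]] := ls_clear g.
rewrite (@lscE (f - g) (m + n) (psX ^+ n * u - psX ^+ m * v)); last first.
  by rewrite lsB !lsM !lsXn -hu -hv exprD; ring.
rewrite (lscE hu) (lscE hv) /shiftc.
case E: (k + (m + n)%N%:Z) => [j|j]; case E1: (k + m%:Z) => [i|i];
  case E2: (k + n%:Z) => [l|l]; rewrite ?pscB ?pscXnM; try lia.
- case: ltnP => ?; case: ltnP => ?; try lia.
  by rewrite (_ : j - n = i)%N 1?(_ : j - m = l)%N //; lia.
- case: ltnP => ?; case: ltnP => ?; try lia.
  by rewrite (_ : j - n = i)%N //; lia.
- case: ltnP => ?; case: ltnP => ?; try lia.
  by rewrite (_ : j - m = l)%N //; lia.
- by case: ltnP => ?; case: ltnP => ?; try lia.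
- by rewrite subrr.
Qed.

Lemma lsc0 k : lsc 0 k = 0.
Proof. by rewrite -(subrr (0 : LS)) lscB subrr. Qed.

Lemma lscN f k : lsc (- f) k = - lsc f k.
Proof. by rewrite -[- f]sub0r lscB lsc0 sub0r. Qed.

Lemma lscD f g k : lsc (f + g) k = lsc f k + lsc g k.
Proof. by rewrite -{1}[g]opprK lscB lscN opprK. Qed.

Lemma lsc_sum I (r : seq I) P (F : I -> LS) n :
  lsc (\sum_(i <- r | P i) F i) n = \sum_(i <- r | P i) lsc (F i) n.
Proof. exact: (big_morph (lsc^~ n) (fun u v => lscD u v n) (lsc0 n)). Qed.

Lemma lscXn f (n k : int) : lsc (lsX ^ n * f) k = lsc f (k - n).
Proof.
have [m [u hu]] := ls_clear f.
have X0 j : lsX ^ j != 0 by rewrite expfz_neq0 ?lsX_neq0.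
case: n => n.
  rewrite (@lscE _ m (psX ^+ n * u)); last first.
    by rewrite lsM lsXn -hu -exprnP; ring.
  rewrite (lscE hu) /shiftc.
  case E: (k + m%:Z) => [j|j]; case E': (k - n%:Z + m%:Z) => [i|i] //; rewrite ?pscXnM; try lia.
    by case: ltnP => ?; try lia; rewrite (_ : j - n = i)%N //; lia.
  by case: ltnP => ?; try lia.
rewrite (@lscE _ (m + n.+1) u); last first.
  rewrite -hu NegzE exprD -invr_expz -exprnP.
  have := X0 n.+1; rewrite -exprnP; move: (lsX ^+ n.+1) (lsX ^+ m) => x y x0.
  by rewrite mulrC mulrA mulfK // mulrC.
rewrite (lscE hu) /shiftc.
by case E: (k + (m + n.+1)%N%:Z) => [j|j]; case E': (k - Negz n + m%:Z) => [i|i] //;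
  try lia; congr psc; lia.
Qed.

Lemma lscCM c f k : lsc (lsC c * f) k = c * lsc f k.
Proof.
have [m [u hu]] := ls_clear f.
rewrite (@lscE _ m (psC c * u)) ?lsM -?hu -?mulrA // (lscE hu) /shiftc.
by case E: (_ + _) => [j|j]; rewrite ?pscCM ?mulr0.
Qed.

Lemma lsc_deriv f k : lsc (ls_deriv f) k = (k + 1)%:~R * lsc f (k + 1).
Proof.
have [m [u hu]] := ls_clear f.
have X0 : lsX != 0 := lsX_neq0.
have : ls_deriv f * lsX ^+ m.+1 = ls (psX * ps_deriv u - psC m%:R * u).
  have := congr1 (fun x => ls_deriv x * lsX) hu.
  rewrite (drvM ls_deriv_derivation) (drvX ls_deriv_derivation) ls_derivX ls_derivE.
  rewrite lsB !lsM -hu -/(lsC _) -/lsX rmorph_nat [lsX * _]mulrC => <-.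
  case: m {hu} => [|m] /=; rewrite ?expr0 ?exprS;
    move: (ls_deriv f) (f : LS) lsX {X0} => a b x; first by ring.
  by move: (x ^+ m) => y; ring.
move/lscE ->; rewrite (lscE hu) /shiftc.
case E: (k + m.+1%:Z) => [j|j]; case E': (k + 1 + m%:Z) => [i|i]; rewrite ?mulr0 //; try lia.
have -> : i = j by lia.
have ek : k + 1 = j%:Z - m%:Z by lia.
rewrite pscB pscCM -[psX]expr1 pscXnM ek intrB mulrBl; congr (_ - _).
case: j {E ek} => [|j] /=; first by rewrite mul0r.
by rewrite subn1 psc_deriv.
Qed.

End PowerSeries.

(** * Specialisation along a tower of quadratures *)

Section SubringSet.
Variables (A : comNzRingType) (S : set A).
Hypothesis HS : subring_set S.

Lemma subring1 : S 1. Proof. by case: HS. Qed.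
Lemma subringB x y : S x -> S y -> S (x - y). Proof. by case: HS => _ h _; apply: h. Qed.
Lemma subringM x y : S x -> S y -> S (x * y). Proof. by case: HS => _ _; apply. Qed.
Lemma subring0 : S 0. Proof. by rewrite -(subrr 1); apply: subringB; apply: subring1. Qed.
Lemma subringN x : S x -> S (- x).
Proof. by rewrite -sub0r; apply: subringB subring0. Qed.
Lemma subringD x y : S x -> S y -> S (x + y).
Proof. by move=> Sx Sy; rewrite -[y]opprK; apply: subringB => //; apply: subringN. Qed.
Lemma subringX x n : S x -> S (x ^+ n).
Proof.
move=> Sx; elim: n => [|n IH]; first exact: subring1.
by rewrite exprS; apply: subringM.
Qed.
Lemma subring_sum I (r : seq I) (P : pred I) (F : I -> A) :
  (forall i, P i -> S (F i)) -> S (\sum_(i <- r | P i) F i).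
Proof. by move=> h; apply: big_ind => //; [exact: subring0 | exact: subringD]. Qed.
Lemma subring_horner (p : {poly A}) x : (forall i, S p`_i) -> S x -> S p.[x].
Proof.
move=> Sp Sx; rewrite horner_coef; apply: subring_sum => i _.
by apply: subringM => //; apply: subringX.
Qed.

End SubringSet.

(** * Existence of valuation rings *)

Section ValuationRing.
Variables (K : fieldType) (R0 : set K) (s : K).
Hypotheses (HR0 : subring_set R0) (R0s : R0 s) (R0Vs : ~ R0 s^-1).

Let good (O : set K) := [/\ subring_set O, R0 `<=` O & ~ O s^-1].

Let s0 : s != 0.
Proof.
apply/eqP => s0; apply: R0Vs; rewrite s0 invr0; exact: subring0.
Qed.

Let polyO (O : set K) y : set K :=
  [set x | exists2 q : {poly K}, (forall i, O q`_i) & x = q.[y]].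

Let polyO_subring O y : subring_set O -> subring_set (polyO O y).
Proof.
move=> HO; split.
- by exists 1 => [i|]; rewrite ?coef1 ?hornerC //; case: eqP => _;
    [exact: subring1 | exact: subring0].
- move=> _ _ [q Oq ->] [r Or ->]; exists (q - r) => [i|]; last by rewrite !hornerE.
  by rewrite coefB; apply: subringB.
move=> _ _ [q Oq ->] [r Or ->]; exists (q * r) => [i|]; last by rewrite hornerM.
by rewrite coefM; apply: subring_sum => // j _; apply: subringM.
Qed.

Let maximal_good : exists2 O, good O & forall O', good O' -> O `<=` O' -> O' `<=` O.
Proof.
have gR0 : good R0 by split.
have [|O []] := @Zorn_bigcup K (fun O => good O \/ O = set0).
- move=> F FP totF.
  have [ [ O1 FO1 g1]|nF] := pselect (exists2 O, F O & good O); last first.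
    right; apply/seteqP; split=> // x [ O FO Ox].
    by have [gO|O0] := FP O FO; [case: nF; exists O | rewrite O0 in Ox].
  left; set U := \bigcup_(X in F) X.
  have gF O x : F O -> O x -> good O.
    by move=> FO Ox; have [//|O0] := FP O FO; rewrite O0 in Ox.
  have pick2 x y : U x -> U y -> exists O, [/\ F O, good O, O x & O y].
    move=> [ O FO Ox] [ O' FO' O'y]; have [h|h] := totF O O' FO FO'.
      by exists O'; split=> //; [exact: gF O'y | exact: h].
    by exists O; split=> //; [exact: gF Ox | exact: h].
  split; last by move=> [ O FO Ox]; have [_ _ /(_ Ox)] := gF _ _ FO Ox.
    split; first by exists O1 => //; have [h _ _] := g1; exact: subring1.
      move=> x y Ux Uy; have [ O [FO [h _ _] Ox Oy]] := pick2 x y Ux Uy.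
      by exists O => //; apply: subringB.
    move=> x y Ux Uy; have [ O [FO [h _ _] Ox Oy]] := pick2 x y Ux Uy.
    by exists O => //; apply: subringM.
  by move=> x R0x; exists O1 => //; have [_ h _] := g1; apply: h.
case=> [gO|O0] maxO.
  exists O => // O' gO' OO' x O'x; apply: contrapT => Ox.
  by apply: (maxO O'); [rewrite properEneq; split=> //; apply/eqP => e; case: Ox; rewrite e | left].
exfalso; apply: (maxO R0); last by left.
by rewrite O0; split=> // h; have := h _ R0s.
Qed.

(** A subring maximal among those that contain [R0] and omit 1/s is a valuation ring. If it
    contained neither y nor 1/y, maximality would make 1/s a polynomial in each of them; the two
    relations then shorten each other until one of them reads 1 = 0. *)
Lemma valuation_ring : exists O : set K,
  [/\ subring_set O, R0 `<=` O, ~ O s^-1 & forall y, O y \/ O y^-1].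
Proof.
have [ O gO maxO] := maximal_good; have [HO R0O OVs] := gO.
have Os := R0O _ R0s.
have adj y : ~ O y -> exists2 q : {poly K}, (forall i, O q`_i) & s^-1 = q.[y].
  move=> Oy; apply: contrapT => h; apply: Oy.
  apply: (maxO (polyO O y)).
  - split=> //; first exact: polyO_subring.
    move=> x R0x; exists x%:P => [i|]; last by rewrite hornerC.
    by rewrite coefC; case: eqP => _; [exact: R0O | exact: subring0].
  - move=> x Ox; exists x%:P => [i|]; last by rewrite hornerC.
    by rewrite coefC; case: eqP => _; [|exact: subring0].
  - exists 'X => [i|]; last by rewrite hornerX.
    by rewrite coefX; case: eqP => _; [exact: subring1 | exact: subring0].
(* Otherwise 1/s is a polynomial in (1 - s b)^-1; clearing denominators puts a power of 1 - s b into
   s O. That power is also 1 modulo s O, so 1 would lie in s O. *)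
have unit1 b : O b -> O (1 - s * b)^-1.
  move=> Ob; apply: contrapT => /adj [q Oq e].
  have u0 : 1 - s * b != 0.
    by apply/eqP => u0; apply: OVs; move/eqP: u0; rewrite subr_eq0 => /eqP u0;
       rewrite -[s^-1]mulr1 u0 mulrA mulVf // mul1r.
  have e1 : (1 - s * b) ^+ size q = s * (q.[(1 - s * b)^-1] * (1 - s * b) ^+ size q).
    by rewrite -e mulrA divff // mul1r.
  have Oqu : O (q.[(1 - s * b)^-1] * (1 - s * b) ^+ size q).
    rewrite horner_coef mulr_suml; apply: subring_sum => // i _.
    have sq : (size q = i + (size q - i))%N by rewrite subnKC // ltnW.
    rewrite -mulrA exprVn (_ : _ ^+ size q = (1 - s * b) ^+ i * (1 - s * b) ^+ (size q - i)).
      rewrite mulKf ?expf_neq0 //.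
      apply: subringM => //; apply: subringX => //.
      by apply: subringB => //; [exact: subring1 | exact: subringM].
    by rewrite -exprD -sq.
  have : exists2 c, O c & (1 - s * b) ^+ size q = 1 - s * c.
    elim: (size q) => [|n [c Oc IH]].
      by exists 0; [exact: subring0 | rewrite mulr0 subr0].
    exists (b + c - s * b * c); last by rewrite exprS IH; ring.
    by apply: subringB; [|apply: subringD|do !apply: subringM].
  move=> [c Oc ec]; apply: OVs.
  have -> : s^-1 = c + q.[(1 - s * b)^-1] * (1 - s * b) ^+ size q.
    apply: (mulfI s0); rewrite divff // mulrDr -e1 ec; ring.
  exact: subringD.
exists O; split=> // y; apply: contrapT => /not_orP [ Oy OVy].
have [q Oq eq] := adj _ Oy; have [r Or er] := adj _ OVy.
have y0 : y != 0 by apply/eqP => y0; apply: Oy; rewrite y0; exact: subring0.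
pose rep (z : K) n := exists2 a : nat -> K, (forall i, O (a i)) &
  1 = s * \sum_(i < n) a i * z ^+ i.
have repq : rep y (size q).
  by exists (fun i => q`_i) => //; rewrite -horner_coef -eq divff.
have repr : rep y^-1 (size r).
  by exists (fun i => r`_i) => //; rewrite -horner_coef -er divff.
have no0 z : ~ rep z 0%N.
  by move=> [a _ /eqP]; rewrite big_ord0 mulr0 oner_eq0.
(* The relation in 1/z is solved for 1 after division by the unit 1 - s b_0. Multiplied by the
   leading term a_n z^n, it rewrites this term with exponents from n - m to n - 1. *)
have red z n m : z != 0 -> (m <= n)%N -> rep z n.+1 -> rep z^-1 m.+1 -> rep z n.
  move=> z0 mn [a Oa ea] [b Ob eb].
  have Ou := unit1 _ (Ob 0%N); set u := (1 - s * b 0%N)^-1 in Ou.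
  have u0 : 1 - s * b 0%N != 0.
    apply/eqP => /eqP; rewrite subr_eq0 => /eqP u0; apply: OVs.
    by rewrite -[s^-1]mulr1 u0 mulrA mulVf // mul1r.
  have eb' : 1 = s * u * \sum_(i < m) b i.+1 * z^-1 ^+ i.+1.
    move: eb; rewrite big_ord_recl expr0 mulr1 mulrDr => eb.
    by rewrite mulrAC -(_ : 1 - s * b 0%N = s * _) ?divff // {1}eb addrC addKr.
  exists (fun i => a i + s * u * a n * (if (n - i <= m)%N then b (n - i)%N else 0)).
    move=> i; apply: subringD => //; apply: subringM => //.
      by do !apply: subringM.
    by case: ifP => // _; exact: subring0.
  rewrite {1}ea big_ord_recr /=; congr (_ * _).
  under [RHS]eq_bigr => i _ do rewrite mulrDl.
  rewrite big_split /=; congr (_ + _).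
  rewrite -[in LHS](mulr1 (_ * z ^+ n)) {1}eb'.
  under [RHS]eq_bigr => i _ do rewrite -mulrA.
  rewrite -mulr_sumr.
  rewrite (_ : _ * (s * u * _) = s * u * a n * (z ^+ n * \sum_(i < m) b i.+1 * z^-1 ^+ i.+1));
    last by ring.
  congr (_ * _); rewrite [RHS](reindex_inj rev_ord_inj) /=.
  have lts (i : nat) : (i < m)%N -> (i < n)%N by move=> h; apply: leq_trans h mn.
  rewrite [RHS](eq_bigr (fun i : 'I_n => if (i < m)%N then b i.+1 * z ^+ (n - i.+1) else 0));
    last first.
    move=> i _; have -> : (n - (n - i.+1) = i.+1)%N by rewrite subKn.
    by case: ifP => _; rewrite ?mul0r.
  rewrite -big_mkcond /= (big_ord_widen_cond n predT (fun i => b i.+1 * z^-1 ^+ i.+1)) //.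
  rewrite mulr_sumr; apply: eq_bigr => i _.
  rewrite -{1}(subnK (ltn_ord i)) exprD exprVn.
  by rewrite mulrCA -mulrA divff ?expf_neq0 // mulr1.
have key n m z : z != 0 -> (n + m <= size q + size r)%N -> rep z n -> rep z^-1 m -> False.
  move=> {repq repr eq er Oq Or}; move: (size q + size r)%N => N.
  elim: N n m z => [|N IH] n m z z0.
    by rewrite leqn0 addn_eq0 => /andP [/eqP -> _] /no0.
  case: n => [|n]; first by move=> _ /no0.
  case: m => [|m]; first by move=> _ _ /no0.
  move=> le rn rm; have [mn|nm] := leqP m n.
    by apply: (IH n m.+1 z) => //; exact: red rn rm.
  apply: (IH n.+1 m z) => //; first lia.
  by apply: (red _ _ n) => //; [rewrite invr_eq0 | exact: ltnW | rewrite invrK].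
exact: (key _ _ y y0 (leqnn _) repq repr).
Qed.

End ValuationRing.

(* [v] spans a line stable under [D - A], with connection form [u]. *)
Definition inv_line (K : fieldType) (D : K -> K) (p : nat) (A : 'M[K]_p)
    (v : 'I_p -> K) : Prop :=
  exists u, forall i, D (v i) = \sum_k A i k * v k - u * v i.

Lemma inv_line_scale (K : fieldType) (D : K -> K) (p : nat) (A : 'M[K]_p)
    (v : 'I_p -> K) c : is_derivation D -> c != 0 ->
  inv_line D A v -> inv_line D A (fun i => c * v i).
Proof.
move=> HD c0 [u Hu]; exists (u - D c / c) => i.
rewrite (drvM HD) Hu.
under [in RHS]eq_bigr => k _ do rewrite mulrCA.
rewrite -mulr_sumr; move: (\sum_k _) => S; by field.
Qed.

(* Minimality of [b a^n = s c] lowers [n] down to 0: this is the fact that minimal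
   primes over a differential ideal are differential in characteristic 0. *)
Lemma deriv_stable_prime (K : fieldType) (D : K -> K) (S P : set K) (s : K) :
  is_derivation D -> (forall n, n.+1%:R != 0 :> K) ->
  subring_set S -> (forall x, S x -> S (D x)) -> (forall n, S (n.+1%:R)^-1) ->
  P `<=` S -> ~ P 1 -> P s ->
  (forall x y, S x -> P y -> P (x * y)) ->
  (forall x y, S x -> S y -> P (x * y) -> P x \/ P y) ->
  (exists2 c, S c & D s = s * c) ->
  (forall a, P a -> exists (b : K) (n : nat),
     [/\ S b, ~ P b & exists2 c, S c & b * a ^+ n = s * c]) ->
  forall a, P a -> P (D a).
Proof.
move=> HD char0 HS DS VS PS P1 Ps PM Pprime [d Sd Ds] nilp a Pa.
have Ss := PS _ Ps; have Sa := PS _ Pa.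
apply: contrapT => PDa.
have key n b : S b -> ~ P b -> (exists2 c, S c & b * a ^+ n = s * c) -> False.
  elim: n b => [|n IH] b Sb Pb [c Sc e].
    by apply: Pb; move: e; rewrite expr0 mulr1 => ->; rewrite mulrC; apply: PM.
  have Pn : ~ P n.+1%:R.
    move=> Pn; apply: P1; rewrite -(mulVf (char0 n)); exact: PM.
  have Sn m : S m%:R.
    elim: m => [|m IHm]; first exact: subring0.
    by rewrite -addn1 natrD; apply: subringD => //; exact: subring1.
  apply: (IH (n.+1%:R * (b * (b * D a)))).
  - by do !apply: subringM => //; exact: DS.
  - move=> /Pprime [] //; first by do !apply: subringM => //; exact: DS.
    move=> /Pprime [] //; first by apply: subringM => //; exact: DS.
    by move=> /Pprime [] //; exact: DS.
  exists (b * (d * c + D c) - D b * c).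
    apply: subringB => //; apply: subringM => //; try exact: DS.
    by apply: subringD => //; [apply: subringM|exact: DS].
  have := congr1 (fun x => b * D x) e; rewrite !(drvM HD) (drvX HD) Ds /= => e'.
  have -> : s * (b * (d * c + D c) - D b * c) = b * (s * d * c + s * D c) - D b * (s * c).
    by ring.
  by rewrite -e' -e exprS; ring.
have [b [n [Sb Pb h]]] := nilp a Pa; exact: key Sb Pb h.
Qed.

Local Notation tofrac := (@FracField.tofrac _).

Lemma rational_den (A : idomainType) (q : {poly {fraction A}}) :
  exists (d : A) (r : {poly A}), d != 0 /\
  (FracField.tofrac d) *: q = map_poly (@FracField.tofrac A) r.
Proof.
elim/poly_ind: q => [|q c [d [r [d0 e]]]].
  by exists 1, 0; rewrite oner_neq0 rmorph0 scaler0.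
have [n [m [m0 ->]]] := frac_surj c.
exists (d * m), (m *: r * 'X + (d * n)%:P); split; first exact: mulf_neq0.
rewrite rmorphD !rmorphM /= map_polyX map_polyC map_polyZ -e scalerDr /=.
rewrite map_polyC scalerAl scalerA [tofrac m * _]mulrC; congr (_ + _).
rewrite -!polyCM -mul_polyC -polyCM; congr (_%:P) => /=.
have gen (K : fieldType) (x y z : K) : y != 0 -> x * y * (z / y) = x * z.
  by move=> y0; field.
by apply: gen; rewrite tofrac_eq0.
Qed.

Lemma polyX_neq0 (R : nzRingType) : 'X != 0 :> {poly R}.
Proof. by rewrite polyX_eq0. Qed.

(** * Elimination of one transcendental generator *)

Section Descent.
Variables (E K : fieldType) (DE : E -> E) (D : K -> K) (j : {rmorphism E -> K}).
Hypotheses (HD : is_derivation D) (jD : forall x, D (j x) = j (DE x)).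
Hypothesis char0 : forall n, n.+1%:R != 0 :> E.
Variables (p : nat) (B : 'M[E]_p).

(** Divisibility is total in a valuation ring, so some coordinate divides all the others; division
    by it leaves a vector over the ring with a coordinate equal to 1. *)
Lemma inv_line_pivot (O : set K) (v : 'I_p -> K) i0 :
  subring_set O -> (forall y, O y \/ O y^-1) -> v i0 != 0 ->
  exists i1, v i1 != 0 /\ forall i, O (v i / v i1).
Proof.
move=> HO Oval vi0.
suff [i1 [h1 h2]] : exists i1, v i1 != 0 /\ {in enum 'I_p, forall i, O (v i / v i1)}.
  by exists i1; split=> // i; apply: h2; rewrite mem_enum.
elim: (enum 'I_p) => [|k r [i1 [h1 h2]]]; first by exists i0.
have [|h] := Oval (v k / v i1).
  by move=> h; exists i1; split=> // i; rewrite inE => /predU1P [->|/h2].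
have [vk|vk] := eqVneq (v k) 0.
  exists i1; split=> // i; rewrite inE => /predU1P [->|/h2 //].
  by rewrite vk mul0r; exact: subring0.
exists k; split=> // i; rewrite inE => /predU1P [->|/h2 Oi].
  by rewrite divff //; exact: subring1.
have -> : v i / v k = (v i / v i1) * (v k / v i1)^-1 by field; rewrite vk h1.
exact: subringM.
Qed.

Variable s : K.

Definition eval_at : {rmorphism {poly E} -> K} := horner_eval s \o map_poly j.

Hypothesis s_transc : forall P : {poly E}, P != 0 -> eval_at P != 0.
Hypothesis s_deriv : exists c, D s = s * eval_at c.

Let js := frac_rmorphism s_transc.

Lemma algebraic_eval_at y : algebraicOver js y ->
  exists2 P : {poly {poly E}}, P != 0 & root (map_poly eval_at P) y.
Proof.
move=> [q q0 qy]; have [d [r [d0 e]]] := rational_den q.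
have e' : map_poly js (map_poly (@FracField.tofrac _) r) = map_poly eval_at r.
  rewrite -map_poly_comp; apply: eq_map_poly => x /=; exact: frac_map_tofrac.
exists r.
  apply: contraNneq q0 => r0; have /eqP := e; rewrite r0 rmorph0 scaler_eq0.
  by rewrite tofrac_eq0 (negPf d0).
by rewrite -e' -e map_polyZ rootE hornerZ (eqP qy) mulr0.
Qed.

Lemma eval_at_mod (P : {poly E}) : exists Q, eval_at P = j P`_0 - s * eval_at Q.
Proof.
exists (- (P %/ 'X)); rewrite rmorphN mulrN opprK {1}(divp_eq P 'X) rmorphD rmorphM addrC mulrC.
congr (_ + _ * _); last by rewrite /eval_at /= /horner_eval map_polyX hornerX.
rewrite -{1}['X]subr0 -polyC0 modp_XsubC /eval_at /= /horner_eval map_polyC hornerC.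
by rewrite horner_coef0.
Qed.

(** Clear denominators in an equation of y over E(s), then divide by s as long as all constant terms
    vanish; this stops, since the degree of the leading coefficient drops each time. The constant
    terms that remain form a nonzero P over E with P(y) in s E[s][y]. *)
Lemma reduce_relation y : algebraicOver js y ->
  exists P : {poly E}, P != 0 /\
  exists Q : {poly {poly E}}, (map_poly j P).[y] = s * (map_poly eval_at Q).[y].
Proof.
move=> /algebraic_eval_at [P P0 Py].
have [R [R0 Ry]] : exists R : {poly {poly E}}, map_poly (coefp 0) R != 0 /\
    root (map_poly eval_at R) y.
  have [N] := ubnP (size (lead_coef P)); elim: N P P0 Py => // N IH P P0 Py lt.
  have [e0|ne0] := eqVneq (map_poly (coefp 0) P) 0; last by exists P.
  pose P' : {poly {poly E}} := \poly_(i < size P) (P`_i %/ 'X).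
  have eP : P = 'X%:P * P'.
    apply/polyP => i; rewrite coefCM coef_poly; case: ltnP => h; last by rewrite mulr0 nth_default.
    rewrite mulrC divpK // -['X]subr0 -polyC0 dvdp_XsubCl rootE horner_coef0.
    by have /polyP/(_ i) := e0; rewrite coef_map coef0 /= => ->.
  have P'0 : P' != 0 by apply: contraNneq P0 => h; rewrite eP h mulr0.
  apply: (IH P') => //.
    have : root (map_poly eval_at P) y by [].
    rewrite {1}eP rmorphM /= map_polyC rootM => /orP [|//].
    by rewrite rootC (negPf (s_transc (polyX_neq0 E))).
  have e : size (lead_coef P) = (size (lead_coef P')).+1.
    by rewrite {1}eP lead_coefM lead_coefC size_mul ?polyX_eq0 ?lead_coef_eq0 // size_polyX.
  by rewrite e in lt.
exists (map_poly (coefp 0) R); split => //.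
pose q (P : {poly E}) := sval (cid (eval_at_mod P)).
have qE P1 : eval_at P1 = j P1`_0 - s * eval_at (q P1) by exact: svalP (cid (eval_at_mod P1)).
exists (\poly_(i < size R) q R`_i).
have : (map_poly eval_at R).[y] = 0 by apply/eqP.
rewrite (@horner_coef_wide _ (size R)); last exact: size_poly.
rewrite (@horner_coef_wide _ (size R) (map_poly j _)); last first.
  by apply: leq_trans (size_poly _ _) _; apply: leq_trans (size_poly _ _) _.
rewrite (@horner_coef_wide _ (size R) (map_poly eval_at (\poly_(i < _) _))); last first.
  by apply: leq_trans (size_poly _ _) _; exact: size_poly.
move=> e; apply/eqP; rewrite -subr_eq0 mulr_sumr -sumrB; apply/eqP.
apply: etrans _ e; apply: eq_bigr => i _; rewrite !coef_map coef_poly ltn_ord.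
apply: etrans _ (congr1 (fun z => z * _) (esym (qE _))).
by rewrite mulrBl !mulrA.
Qed.

Variables (v : 'I_p -> K) (i0 : 'I_p).
Hypotheses (vi0 : v i0 != 0) (v_line : inv_line D (map_mx j B) v).
Hypothesis v_alg : forall i, algebraicOver js (v i).

(* [v] is normalised in a valuation ring which contains [s] but not its inverse, so that
   reducing modulo the maximal ideal specialises [s] to 0 and keeps [v] nonzero. *)
Lemma inv_line_descent : exists (L : fieldType) (DL : L -> L) (jL : {rmorphism E -> L})
    (w : 'I_p -> L),
  [/\ is_derivation DL, forall x, DL (jL x) = jL (DE x),
      exists i, w i != 0, inv_line DL (map_mx jL B) w &
      forall i, algebraicOver jL (w i)].
Proof.
have s0 : s != 0.
  by have := s_transc (polyX_neq0 E); rewrite /eval_at /= /horner_eval map_polyX hornerX.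
pose R0 : set K := range eval_at.
have HR0 : subring_set R0.
  split; first by exists 1 => //; exact: rmorph1.
    by move=> _ _ [P _ <-] [Q _ <-]; exists (P - Q) => //; exact: rmorphB.
  by move=> _ _ [P _ <-] [Q _ <-]; exists (P * Q) => //; exact: rmorphM.
have R0j x : R0 (j x).
  by exists x%:P => //; rewrite /eval_at /= /horner_eval map_polyC hornerC.
have R0s : R0 s by exists 'X => //; rewrite /eval_at /= /horner_eval map_polyX hornerX.
have R0Vs : ~ R0 s^-1.
  move=> [P _ e].
  have /s_transc : P * 'X - 1 != 0.
    apply/eqP => /(congr1 (fun q => q.[0])); rewrite !hornerE => /eqP.
    by rewrite oppr_eq0 oner_eq0.
  rewrite rmorphB rmorphM rmorph1 e /eval_at /= /horner_eval map_polyX hornerX.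
  by rewrite mulVf // subrr eqxx.
have [V [HV R0V VVs Vval]] := valuation_ring HR0 R0s R0Vs.
have [i1 [vi1 Vv]] := inv_line_pivot HV Vval vi0.
pose w i := (v i1)^-1 * v i.
have w1 : w i1 = 1 by rewrite /w mulVf.
have Vw i : V (w i) by rewrite /w mulrC.
have [u Hu] : inv_line D (map_mx j B) w by apply: inv_line_scale => //; rewrite invr_eq0.
have w_alg i : algebraicOver js (w i) by rewrite /w mulrC; apply: algebraic_div.
clearbody w.
pose S : set K := [set y | forall G, subring_set G -> R0 `<=` G -> (forall i, G (w i)) -> G y].
have Smin G : subring_set G -> R0 `<=` G -> (forall i, G (w i)) -> S `<=` G.
  by move=> h1 h2 h3 y; apply.
have HS : subring_set S.
  split; first by move=> G h _ _; exact: subring1.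
    by move=> x y Sx Sy G h1 h2 h3; apply: subringB => //; [exact: Sx|exact: Sy].
  by move=> x y Sx Sy G h1 h2 h3; apply: subringM => //; [exact: Sx|exact: Sy].
have R0S : R0 `<=` S by move=> x R0x G _ h _; apply: h.
have Sw i : S (w i) by move=> G _ _.
clearbody S.
have SV : S `<=` V by apply: Smin.
have Sj x : S (j x) by apply: R0S.
(* The coordinate [w i1] is 1, with derivative 0, so its equation expresses [u] through the entries
   of [B] and the coordinates. *)
have Su : S u.
  have := Hu i1; rewrite w1 (drv1 HD) mulr1 => /eqP; rewrite eq_sym subr_eq0 => /eqP <-.
  by apply: subring_sum => // k _; rewrite mxE; apply: subringM.
have S_alg : S `<=` [set y | algebraicOver js y].
  apply: Smin => //.
    split; first exact: algebraic1.
      by move=> x y hx hy; exact: (algebraic_sub hx hy).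
    by move=> x y hx hy; exact: (algebraic_mul hx hy).
  move=> _ [P _ <-] /=; have := algebraic_id js (tofrac P).
  by rewrite (_ : js _ = eval_at P); last exact: frac_map_tofrac.
have Deval P : S (D (eval_at P)).
  elim/poly_ind: P => [|P c IH]; first by rewrite rmorph0 (drv0 HD); exact: subring0.
  rewrite rmorphD rmorphM (drvD HD) (drvM HD).
  have -> : eval_at 'X = s by rewrite /eval_at /= /horner_eval map_polyX hornerX.
  have -> : eval_at c%:P = j c by rewrite /eval_at /= /horner_eval map_polyC hornerC.
  have [d ->] := s_deriv; rewrite jD.
  have ? := R0S _ R0s; have ? : S (eval_at P) by apply: R0S; exists P.
  have ? : S (eval_at d) by apply: R0S; exists d.
  by do !(apply: subringD => // || apply: subringM => //).
have DS x : S x -> S (D x).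
  move=> Sx; suff [] : (S `&` [set x | S (D x)]) x by [].
  move: x Sx; apply: Smin.
  - split; first by split; [exact: subring1 | rewrite /= (drv1 HD); exact: subring0].
      move=> x y [Sx SDx] [Sy SDy]; split; first exact: subringB.
      by rewrite /= (drvB HD); exact: subringB.
    move=> x y [Sx SDx] [Sy SDy]; split; first exact: subringM.
    by rewrite /= (drvM HD); apply: subringD => //; exact: subringM.
  - by move=> _ [P _ <-]; split; [apply: R0S; exists P | exact: Deval].
  move=> i; split=> //=; rewrite Hu; apply: subringB => //; last exact: subringM.
  by apply: subring_sum => // k _; rewrite mxE; apply: subringM.
(* The maximal ideal of [V]. Zero is listed apart because 0^-1 = 0 belongs to [V]. *)
pose m : set K := [set y | V y /\ (y = 0 \/ ~ V y^-1)].
pose P : set K := S `&` m.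
have V0 : V 0 by exact: subring0.
have mM x y : V x -> m y -> m (x * y).
  move=> Vx [Vy hy]; split; first exact: subringM.
  have [x0|x0] := eqVneq x 0; first by left; rewrite x0 mul0r.
  have [y0|y0] := eqVneq y 0; first by left; rewrite y0 mulr0.
  right=> h; case: hy => [/eqP|]; first by rewrite (negPf y0).
  apply; have -> : y^-1 = x * (x * y)^-1 by field; rewrite x0 y0.
  exact: subringM.
have mB x y : m x -> m y -> m (x - y).
  have aux a b : m b -> V (a / b) -> b != 0 -> m (a - b).
    move=> mb Vab b0; have -> : a - b = (a / b - 1) * b by field.
    by apply: mM => //; apply: subringB => //; exact: subring1.
  move=> mx my; have [y0|y0] := eqVneq y 0; first by rewrite y0 subr0.
  have [x0|x0] := eqVneq x 0.
    rewrite x0 sub0r -mulN1r; apply: mM => //; apply: subringN => //; exact: subring1.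
  have [h|h] := Vval (x / y); first exact: aux.
  rewrite -opprB -mulN1r; apply: mM; first by apply: subringN => //; exact: subring1.
  by apply: aux => //; move: h; rewrite invf_div.
have m1 : ~ m 1.
  move=> [_ [/eqP|]]; first by rewrite oner_eq0.
  by rewrite invr1; case: HV.
have mprime x y : V x -> V y -> m (x * y) -> m x \/ m y.
  move=> Vx Vy [_ h].
  have [x0|x0] := eqVneq x 0; first by left; split=> //; left.
  have [y0|y0] := eqVneq y 0; first by right; split=> //; left.
  have [hx|hx] := pselect (V x^-1); last by left; split=> //; right.
  have [hy|hy] := pselect (V y^-1); last by right; split=> //; right.
  case: h => [/eqP|h]; first by rewrite mulf_eq0 (negPf x0) (negPf y0).
  by case: h; rewrite invfM; exact: subringM.
have Ps : P s.
  by split; [exact: R0S | split; [exact/SV/R0S | right]].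
have PI : prime_ideal_set S P.
  split.
  - by move=> x [].
  - by split; [exact: subring0 | split=> //; left].
  - by move=> [_ /m1].
  - by move=> x y [Sx mx] [Sy my]; split; [exact: subringB | exact: mB].
  split=> [x y Sx [Sy my]|x y Sx Sy [_ mxy]].
    by split; [exact: subringM | apply: mM => //; exact: SV].
  by have [h|h] := mprime _ _ (SV _ Sx) (SV _ Sy) mxy; [left|right].
have charK n : n.+1%:R != 0 :> K by rewrite -(rmorph_nat j) fmorph_eq0.
have Spoly (Q : {poly {poly E}}) a : S a -> S (map_poly eval_at Q).[a].
  move=> Sa; apply: subring_horner => // i; rewrite coef_map; apply: R0S; by exists Q`_i.
have Spolyj (Q : {poly E}) a : S a -> S (map_poly j Q).[a].
  by move=> Sa; apply: subring_horner => // i; rewrite coef_map; exact: Sj.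
have [PS P0' P1' PB [PM Pprime]] := PI.
have DP : forall a, P a -> P (D a).
  apply: (deriv_stable_prime HD charK HS DS _ PS P1' Ps PM Pprime).
  - by move=> n; rewrite -(rmorph_nat j) -fmorphV.
  - by have [d Dd] := s_deriv; exists (eval_at d) => //; apply: R0S; exists d.
  move=> a Pa; have Sa := PS _ Pa.
  have [T [T0 [Q eQ]]] := reduce_relation (S_alg _ Sa).
  (* Write T = T' X^n with T'(0) nonzero. Then b = T'(a) is congruent modulo [P] to the invertible
     constant T'(0), hence lies outside [P], while b a^n = T(a) is a multiple of s: this is
     minimality of [P] over s. *)
  have [n [T' nT' eT]] := multiplicity_XsubC T 0.
  have [k eT'] : exists k, T' = T'.[0]%:P + k * 'X.
    by exists (T' %/ 'X); rewrite -modp_XsubC polyC0 subr0 addrC -divp_eq.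
  exists (map_poly j T').[a], n; split.
  - exact: Spolyj.
  - move=> h; have : P (j T'.[0]).
      have -> : j T'.[0] = (map_poly j T').[a] - (map_poly j k).[a] * a.
        rewrite {2}eT' rmorphD rmorphM /= map_polyC map_polyX !hornerE /=; ring.
      by apply: PB => //; apply: PM => //; exact: Spolyj.
    move=> h'; apply: P1'; have t0 : j T'.[0] != 0.
      by rewrite fmorph_eq0; move: nT'; rewrite T0 implyTb.
    by rewrite -(mulVf t0); apply: PM => //; rewrite -fmorphV.
  exists (map_poly eval_at Q).[a]; first exact: Spoly.
  by rewrite -eQ eT subr0 rmorphM rmorphXn /= map_polyX !hornerE.
have [L [DL [pi [[HDL pi1] piD piM piDer [pi0 _]]]]] :=
  subquotient_field HD HS PI DS DP.
have [jL ejL] : exists jL : {rmorphism E -> L}, jL =1 pi \o j.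
  apply: rmorphism_of => [x y|x y|] /=; rewrite ?rmorphD ?rmorphM ?rmorph1 //;
    [exact: piD | exact: piM].
have pi00 : pi 0 = 0 by apply: (addrI (pi 0)); rewrite -piD ?addr0 //; exact: subring0.
have piN x : S x -> pi (- x) = - pi x.
  move=> Sx; apply: (addrI (pi x)); rewrite -piD ?subrr //; exact: subringN.
have pi_sum (I : Type) (r : seq I) (F : I -> K) : (forall i, S (F i)) ->
    pi (\sum_(i <- r) F i) = \sum_(i <- r) pi (F i).
  move=> SF; elim: r => [|i r IH]; first by rewrite !big_nil.
  by rewrite !big_cons piD ?IH //; apply: subring_sum.
have piX x n : S x -> pi (x ^+ n) = pi x ^+ n.
  move=> Sx; elim: n => [|n IH]; first by rewrite !expr0.
  by rewrite !exprS piM ?IH //; exact: subringX.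
exists L, DL, jL, (fun i => pi (w i)); split=> //.
- by move=> x; rewrite !ejL /= -piDer // jD.
- by exists i1; rewrite w1 pi1 oner_neq0.
- exists (pi u) => i; rewrite -piDer // Hu piD ?piN ?piM //.
  + rewrite pi_sum => [|k]; last by rewrite mxE; exact: subringM.
    congr (_ - _); apply: eq_bigr => k _.
    by rewrite !mxE piM // ejL.
  + exact: subringM.
  + by apply: subring_sum => // k _; rewrite mxE; exact: subringM.
  + by apply: subringN => //; exact: subringM.
(* In the residue field s becomes 0, and the reduced relation turns into an equation over E. *)
move=> i; have [T [T0 [Q eQ]]] := reduce_relation (w_alg i).
exists T => //; apply/eqP.
have : pi (map_poly j T).[w i] = 0.
  rewrite eQ piM //; [|exact: R0S|exact: Spoly].
  by rewrite (_ : pi s = 0) ?mul0r //; apply/(pi0 _ (R0S _ R0s)).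
move=> <-; rewrite !(@horner_coef_wide _ (size T)) ?size_poly // pi_sum => [|k].
  apply: eq_bigr => k _; rewrite !coef_map piM ?piX //; first by congr (_ * _); exact: ejL.
  - exact: Sj.
  - exact: subringX.
by rewrite coef_map; apply: subringM => //; [exact: Sj | exact: subringX].
Qed.

End Descent.

(** * Minimal polynomials and derivations *)

Section MinPoly.
Variables (M L : fieldType) (kappa : {rmorphism M -> L}).

Lemma min_annihilator y : algebraicOver kappa y ->
  exists2 P : {poly M}, P \is monic & forall Q, root (map_poly kappa Q) y = (P %| Q).
Proof.
move=> [Q Q0 Qy].
pose good n := `[< exists P : {poly M}, [/\ P != 0, size P = n & root (map_poly kappa P) y] >].
have ex : exists n, good n by exists (size Q); apply/asboolP; exists Q.
case: (ex_minnP ex) => n /asboolP [P [P0 sP Py]] minP.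
have lP0 : (lead_coef P)^-1 != 0 by rewrite invr_eq0 lead_coef_eq0.
exists ((lead_coef P)^-1 *: P).
  by rewrite monicE lead_coefZ mulVf // lead_coef_eq0.
move=> Q1; rewrite dvdpZl //; apply/idP/idP => [Q1y|/dvdpP [R ->]]; last first.
  by rewrite rmorphM rootM Py orbT.
rewrite /dvdp; apply: contraLR Q1y => r0; apply: contraNN r0 => Q1y.
apply/negPn/negP => r0.
have : (n <= size (Q1 %% P)%R)%N.
  apply: minP; apply/asboolP; exists (Q1 %% P); split=> //.
  move: Q1y; rewrite {1}(divp_eq Q1 P) rmorphD rmorphM rootE hornerD hornerM.
  by rewrite (eqP Py) mulr0 add0r.
by rewrite -sP leqNgt ltn_modp P0.
Qed.

Variables (DM : M -> M) (D : L -> L).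
Hypotheses (HDM : is_derivation DM) (HD : is_derivation D).
Hypothesis kD : forall x, D (kappa x) = kappa (DM x).

Definition coef_der (P : {poly M}) : {poly M} := map_poly DM P.

Lemma coef_coef_der P i : (coef_der P)`_i = DM P`_i.
Proof. by rewrite coef_map_id0 // (drv0 HDM). Qed.

Lemma coef_derMXaddC P c : coef_der (P * 'X + c%:P) = coef_der P * 'X + (DM c)%:P.
Proof.
apply/polyP => i; rewrite !(coef_coef_der, coefD, coefMX, coefC) (drvD HDM).
by case: i => [|i] //=; rewrite (drv0 HDM).
Qed.

Lemma deriv_horner (P : {poly M}) y : D (map_poly kappa P).[y] =
  (map_poly kappa (coef_der P)).[y] + (map_poly kappa P^`()).[y] * D y.
Proof.
elim/poly_ind: P => [|P c IH].
  by rewrite deriv0 /coef_der !map_poly0 !horner0 (drv0 HD) mul0r addr0.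
rewrite coef_derMXaddC derivD derivM derivX derivC addr0 mulr1.
rewrite !rmorphD !rmorphM /= !map_polyX !map_polyC !hornerE /=.
rewrite (drvD HD) (drvM HD) IH kD; ring.
Qed.

Hypothesis char0 : forall n, n.+1%:R != 0 :> M.

Lemma deriv_eq0_char0 (P : {poly M}) : P^`() = 0 -> (size P <= 1)%N.
Proof.
move=> e; apply/leq_sizeP => -[//|n] _.
have /polyP/(_ n)/eqP := e; rewrite coef_deriv coef0 -mulr_natl mulf_eq0.
by rewrite (negPf (char0 _)) => /eqP.
Qed.

Lemma dvdp_deriv_char0 (P : {poly M}) : (1 < size P)%N -> ~~ (P %| P^`()).
Proof.
move=> sP; apply/negP => h.
have [e|P'0] := eqVneq P^`() 0; first by have := deriv_eq0_char0 e; rewrite leqNgt sP.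
have := dvdp_leq P'0 h; rewrite leqNgt lt_size_deriv //.
by rewrite -size_poly_gt0; exact: ltnW.
Qed.

(** Differentiating P(y) = 0 for the minimal polynomial P expresses D y as a quotient with
    denominator P'(y), which is nonzero in characteristic 0. *)
Lemma algebraic_deriv y : algebraicOver kappa y -> algebraicOver kappa (D y).
Proof.
move=> ay; have [P monP Py] := min_annihilator ay.
have P0 : P != 0 := monic_neq0 monP.
have root_P : (map_poly kappa P).[y] = 0 by apply/eqP; rewrite -rootE Py.
have poly_alg Q : algebraicOver kappa (map_poly kappa Q).[y].
  apply/integral_algebraic; apply: integral_horner; last exact/integral_algebraic.
  by apply/integral_poly => i; rewrite coef_map; exact: integral_id.
have sP : (1 < size P)%N.
  rewrite ltnNge; apply/negP => h; have := Py P; rewrite dvdpp (size1_polyC h).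
  rewrite map_polyC rootC /= fmorph_eq0 => /eqP e.
  by move: P0; rewrite (size1_polyC h) e polyC0 eqxx.
have P'y : (map_poly kappa P^`()).[y] != 0.
  by rewrite -rootE Py; exact: dvdp_deriv_char0.
have := deriv_horner P y; rewrite root_P (drv0 HD) => /esym/eqP.
rewrite addrC addr_eq0 => /eqP e.
have -> : D y = - (map_poly kappa (coef_der P)).[y] / (map_poly kappa P^`()).[y].
  by rewrite -e mulrAC mulfV ?mul1r.
by apply: algebraic_div => //; apply: algebraic_opp.
Qed.

End MinPoly.

Section Subfield.
Variables (K : fieldType) (D : K -> K) (E : set K).
Hypotheses (HD : is_derivation D) (HE : diff_subfield D E).

Let Ep : {pred K} := [pred x | `[< E x >]].

Let Ep_divring : divring_closed Ep.
Proof.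
case: HE => E1 EB Ediv _; split; first by apply/asboolP.
  by move=> x y /asboolP Sx /asboolP Sy; apply/asboolP/EB.
by move=> x y /asboolP Sx /asboolP Sy; apply/asboolP/Ediv.
Qed.

HB.instance Definition _ := GRing.isDivringClosed.Build K Ep Ep_divring.

Let T := {x : K | x \in Ep}.
HB.instance Definition _ := SubChoice.on T.
HB.instance Definition _ := [SubChoice_isSubIntegralDomain of T by <:].
HB.instance Definition _ := [SubIntegralDomain_isSubField of T by <:].

(** The tower consists of sets inside [K], whereas the descent works over field types with
    embeddings; this converts one into the other. *)
Lemma subfield_type : exists (F : fieldType) (DF : F -> F) (g : {rmorphism F -> K}),
  [/\ is_derivation DF, forall x, D (g x) = g (DF x) & forall y, E y <-> exists x, y = g x].
Proof.
have ET (x : T) : E (val x) by have /asboolP := valP x.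
have [E1 EB Ediv ED] := HE.
pose toT (x : K) : T := insubd (0 : T) x.
have valT x : E x -> val (toT x) = x by move=> Ex; rewrite insubdK //; apply/asboolP.
pose DT (x : T) : T := toT (D (val x)).
have vD x : val (DT x) = D (val x) by rewrite valT //; exact: ED.
exists (T : fieldType), DT, (val : {rmorphism T -> K}); split.
- split=> x y; apply: val_inj; apply: etrans (vD _) _.
    apply: etrans (congr1 D (rmorphD val _ _)) _; apply: etrans (drvD HD _ _) _.
    apply: esym; apply: etrans (rmorphD val _ _) _.
    by congr (_ + _); exact: vD.
  apply: etrans (congr1 D (rmorphM val _ _)) _; apply: etrans (drvM HD _ _) _.
  apply: esym; apply: etrans (rmorphD val _ _) _.
  apply: etrans (congr2 _ (rmorphM val _ _) (rmorphM val _ _)) _.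
  by congr (_ * _ + _ * _); exact: vD.
- by move=> x; apply: esym; exact: vD.
move=> y; split=> [Ey|[x ->]]; last exact: ET.
by exists (toT y); apply: esym; exact: valT.
Qed.

End Subfield.

Section DiffSubfield.
Variables (K : fieldType) (D : K -> K) (E : set K).

Lemma diff_adjoin_subfield X : diff_subfield D (diff_adjoin D E X).
Proof.
split.
- by move=> G [].
- by move=> x y hx hy G hG EG XG; have [_ h _ _] := hG; apply: h; [exact: hx | exact: hy].
- by move=> x y hx hy G hG EG XG; have [_ _ h _] := hG; apply: h; [exact: hx | exact: hy].
by move=> x hx G hG EG XG; have [_ _ _ h] := hG; apply: h; exact: hx.
Qed.

Lemma sub_diff_adjoin X : E `<=` diff_adjoin D E X.
Proof. by move=> x Ex G _ EG _; exact: EG. Qed.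

Lemma mem_diff_adjoin X : X `<=` diff_adjoin D E X.
Proof. by move=> x Xx G _ _; apply. Qed.

Lemma diff_adjoin_min X G : diff_subfield D G -> E `<=` G -> X `<=` G ->
  diff_adjoin D E X `<=` G.
Proof. by move=> h1 h2 h3 x; apply. Qed.

End DiffSubfield.

Lemma range_subfield (k K : fieldType) (Dk : k -> k) (D : K -> K) (f : {rmorphism k -> K}) :
  (forall x, D (f x) = f (Dk x)) -> diff_subfield D (range f).
Proof.
move=> fD; split.
- by exists 1 => //; exact: rmorph1.
- by move=> _ _ [x _ <-] [y _ <-]; exists (x - y) => //; exact: rmorphB.
- by move=> _ _ [x _ <-] [y _ <-]; exists (x / y) => //; exact: fmorph_div.
by move=> _ [x _ <-]; exists (Dk x).
Qed.

Lemma eval_at_deriv (E K : fieldType) (DE : E -> E) (D : K -> K) (j : {rmorphism E -> K}) s :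
  is_derivation DE -> is_derivation D -> (forall x, D (j x) = j (DE x)) ->
  (exists c, D s = s * eval_at j s c) -> forall P, exists Q, D (eval_at j s P) = eval_at j s Q.
Proof.
move=> HDE HD jD [c Ds] P.
exists (coef_der DE P + P^`() * ('X * c)).
apply: etrans (deriv_horner HDE HD jD P s) _; rewrite Ds.
rewrite rmorphD !rmorphM (_ : eval_at j s 'X = s) //.
by rewrite /eval_at /= /horner_eval map_polyX hornerX.
Qed.

Section Tower.
Variables (k K : fieldType) (Dk : k -> k) (D : K -> K) (iota : {rmorphism k -> K}).
Hypotheses (HDk : is_derivation Dk) (HD : is_derivation D).
Hypothesis iotaD : forall x, D (iota x) = iota (Dk x).
Hypothesis char0 : forall n, n.+1%:R != 0 :> k.
Variables (p : nat) (B : 'M[k]_p).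

(** What has to hold at a floor of the tower. The extension L is unrelated to [K]: after a
    specialisation the line no longer lives in the original field, which is why floors are field
    types up to embedding. *)
Let concl (F : fieldType) (DF : F -> F) (h : {rmorphism k -> F}) : Prop :=
  exists (L : fieldType) (DL : L -> L) (jL : {rmorphism F -> L}) (w : 'I_p -> L),
  [/\ is_derivation DL, forall x, DL (jL x) = jL (DF x),
      exists i, w i != 0, inv_line DL (map_mx jL (map_mx h B)) w &
      forall i, algebraicOver jL (w i)].

(** Going down from E1 = E(x) to E: if the image of x in the current extension is algebraic over E,
    transitivity of algebraicity suffices; otherwise a parameter s built from x is specialised to
    0. *)
Let step (E E1 : set K) (x : K) : 
  [\/ algebraic_elt E x, exponential_elt D E x | integral_elt D E x] ->
  E1 = diff_adjoin D E [set x] ->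
  (forall (F : fieldType) (DF : F -> F) (g : {rmorphism F -> K}) (h : {rmorphism k -> F}),
     is_derivation DF -> (forall x, D (g x) = g (DF x)) ->
     (forall y, E1 y <-> exists x, y = g x) -> (forall a, g (h a) = iota a) ->
     concl DF h) ->
  forall (F : fieldType) (DF : F -> F) (g : {rmorphism F -> K}) (h : {rmorphism k -> F}),
     is_derivation DF -> (forall x, D (g x) = g (DF x)) ->
     (forall y, E y <-> exists x, y = g x) -> (forall a, g (h a) = iota a) ->
     concl DF h.
Proof.
move=> hx eE1 IH F DF g h HDF gD gE gh.
have HE1 : diff_subfield D E1 by rewrite eE1; exact: diff_adjoin_subfield.
have EE1 : E `<=` E1 by rewrite eE1; exact: sub_diff_adjoin.
have E1x : E1 x by rewrite eE1; exact: mem_diff_adjoin.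
have [F1 [D1 [g1 [HD1 g1D g1E]]]] := subfield_type HD HE1.
have inc a : exists b, g1 b = g a.
  by have [|b ->] := (g1E (g a)).1; [apply: EE1; apply/gE; exists a | exists b].
pose f0 a := sval (cid (inc a)).
have f0E a : g1 (f0 a) = g a := svalP (cid (inc a)).
have [f fE] : exists f : {rmorphism F -> F1}, f =1 f0.
  apply: rmorphism_of => [a b|a b|]; apply: (fmorph_inj g1).
  - by rewrite rmorphD !f0E rmorphD.
  - by rewrite rmorphM !f0E rmorphM.
  - by rewrite f0E !rmorph1.
have g1f a : g1 (f a) = g a by rewrite fE f0E.
have [L [DL [j1 [w [HDL j1D w0 w_line w_alg]]]]] := IH F1 D1 g1 (f \o h) HD1 g1D g1E
  (fun a => etrans (g1f (h a)) (gh a)).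
pose j : {rmorphism F -> L} := j1 \o f.
have fD a : D1 (f a) = f (DF a) by apply: (fmorph_inj g1); rewrite -g1D !g1f gD.
have jD a : DL (j a) = j (DF a) by rewrite /j /= j1D fD.
have w_line' : inv_line DL (map_mx j (map_mx h B)) w.
  by move: w_line; rewrite -!map_mx_comp.
have charF n : n.+1%:R != 0 :> F by rewrite -(rmorph_nat h) fmorph_eq0.
have [x1 ex1] := (g1E x).1 E1x.
(* Since x generates E1 over E, a differential subfield of L that contains the images of E and x
   contains the image of E1. *)
have gen (G : set L) : diff_subfield DL G -> (forall a, G (j a)) -> G (j1 x1) ->
    forall y, G (j1 y).
  move=> HG Gj Gx y.
  have [G1 GB Gdiv GD] := HG.
  suff : E1 `<=` [set z | exists2 b, z = g1 b & G (j1 b)].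
    move=> sub; have [|b e Gb] := sub (g1 y); first by apply/g1E; exists y.
    by rewrite (fmorph_inj _ e).
  rewrite {1}eE1; apply: diff_adjoin_min.
  - split.
    + by exists 1; rewrite rmorph1.
    + move=> _ _ [a -> Ga] [b -> Gb]; exists (a - b); rewrite rmorphB //; exact: GB.
    + move=> _ _ [a -> Ga] [b -> Gb]; exists (a / b); rewrite fmorph_div //; exact: Gdiv.
    + move=> _ [a -> Ga]; exists (D1 a); rewrite ?g1D // -j1D; exact: GD.
  - by move=> _ /gE [a ->]; exists (f a); rewrite ?g1f //; exact: Gj.
  - by move=> _ ->; exists x1.
have finish (M : fieldType) (kap : {rmorphism M -> L}) :
    (forall y, algebraicOver kap (j1 y)) -> forall i, algebraicOver kap (w i).
  move=> hk i; have [q q0 qw] := w_alg i.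
  apply/integral_algebraic; have q0' : map_poly j1 q != 0 by rewrite map_poly_eq0.
  apply: (integral_root q0' qw).
  by apply/integral_poly => n; rewrite coef_map; apply/integral_algebraic; exact: hk.
have [x_alg|x_tr] := pselect (algebraicOver j (j1 x1)).
  exists L, DL, j, w; split=> //; apply: finish.
  apply: (gen [set y | algebraicOver j y]) => //=; last exact: algebraic_id.
  split=> [|a b ha hb|a b ha hb|a ha]; first exact: algebraic1.
  - exact: algebraic_sub ha hb.
  - exact: algebraic_div ha hb.
  exact: (algebraic_deriv HDF HDL jD charF ha).
have x10 : j1 x1 != 0 by apply/eqP => e; apply: x_tr; rewrite e; exact: algebraic0.
(* For an exponential, s = x and D s = s D e with D e in E; for an integral, s = 1/x and D s = - s^2
   D x. In both cases s divides D s in E[s], so s = 0 is a differential specialisation. *)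
have [s [s_tr s_der s_x]] : exists s, [/\ ~ algebraicOver j s,
    exists c, DL s = s * eval_at j s c & s = j1 x1 \/ s = (j1 x1)^-1].
  case: hx => [[P [P0 EP Px]]|[x0 [e Ee Dx]]|Dx].
  - case: x_tr.
    have [q eq] : exists q : {poly F}, P = map_poly g q.
      have ex i : exists a, P`_i = g a by apply/gE.
      exists (\poly_(i < size P) sval (cid (ex i))).
      apply/polyP => i; rewrite coef_map coef_poly; case: ltnP => hi.
        exact: (svalP (cid (ex i))).
      by rewrite nth_default //; apply: esym; exact: rmorph0.
    exists q; first by apply: contraNneq P0 => q0; rewrite eq q0 rmorph0.
    rewrite /j map_poly_comp fmorph_root -(fmorph_root g1) -map_poly_comp.
    by rewrite -ex1 (eq_map_poly (g := g)) -?eq // => a /=; rewrite g1f.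
  - have [a ea] := (gE e).1 Ee.
    exists (j1 x1); split=> //; last by left.
    exists (DF a)%:P; rewrite /eval_at /= /horner_eval map_polyC hornerC.
    rewrite j1D /= -rmorphM; congr (j1 _); apply: (fmorph_inj g1).
    by rewrite rmorphM -g1D -ex1 Dx ea gD g1f mulrC.
  have [a ea] := (gE (D x)).1 Dx.
  exists (j1 x1)^-1; split; last by right.
    by move=> /algebraic_inv; rewrite invrK.
  exists (- (a *: 'X)); rewrite /eval_at /= /horner_eval rmorphN /= hornerN.
  rewrite map_polyZ map_polyX hornerZ hornerX /= drvV // j1D.
  have -> : D1 x1 = f a by apply: (fmorph_inj g1); rewrite -g1D -ex1 ea g1f.
  by move: (j1 (f a)) => z; field.
have s_transc (P : {poly F}) : P != 0 -> eval_at j s P != 0.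
  by move=> P0; apply/eqP => e; apply: s_tr; exists P => //; apply/eqP.
have [i wi] := w0.
apply: (inv_line_descent HDL jD charF (s_transc := s_transc) s_der wi w_line').
(* It remains to see that E1 lands in the field of rational functions of s, which is closed under
   the derivation and contains x. *)
apply: finish => y.
suff [r <-] : exists r, frac_rmorphism s_transc r = j1 y by exact: algebraic_id.
pose js := frac_rmorphism s_transc.
have G_sub : diff_subfield DL (range js).
  have [h1 h2 h3 _] := @range_subfield _ _ (fun x => x) (fun x => x) js (fun x => erefl).
  split=> // _ [r _ <-].
  have [n [d [d0 ->]]] := frac_surj r.
  have ee := eval_at_deriv HDF HDL jD s_der.
  have [n' en] := ee n; have [d' ed] := ee d.
  have jsE a : js (FracField.tofrac a) = eval_at j s a := frac_map_tofrac s_transc a.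
  exists (FracField.tofrac (n' * d - n * d') / FracField.tofrac (d ^+ 2)) => //.
  rewrite !fmorph_div !jsE drvDiv // ?s_transc // en ed.
  by rewrite rmorphB !rmorphM.
have := gen (range js) G_sub _ _ y; case.
- move=> a; exists (FracField.tofrac a%:P) => //.
  by apply: etrans (frac_map_tofrac s_transc _) _; rewrite /eval_at /= /horner_eval map_polyC hornerC.
- have Gs : range js s.
    exists (FracField.tofrac 'X) => //.
    by apply: etrans (frac_map_tofrac s_transc _) _; rewrite /eval_at /= /horner_eval map_polyX hornerX.
  case: s_x => [<-//|es]; have -> : j1 x1 = 1 / s by rewrite es div1r invrK.
  by have [h1 _ h3 _] := G_sub; exact: h3.
by move=> r _ e; exists r.
Qed.

(** At the top the coordinates lie in the field itself and are trivially algebraic over it; [step]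
    is then applied once per floor, [m - i] being the current floor. *)
Lemma liouville_line m (Fs : nat -> set K) (v : 'I_p -> K) :
  quadrature_chain D (range iota) m Fs -> (forall i, Fs m (v i)) ->
  (exists i, v i != 0) -> inv_line D (map_mx iota B) v ->
  exists (L : fieldType) (DL : L -> L) (jL : {rmorphism k -> L}) (w : 'I_p -> L),
  [/\ is_derivation DL, forall x, DL (jL x) = jL (Dk x),
      exists i, w i != 0, inv_line DL (map_mx jL B) w &
      forall i, algebraicOver jL (w i)].
Proof.
move=> [F0 chain] vF v0 v_line.
have key i : (i <= m)%N ->
    forall (F : fieldType) (DF : F -> F) (g : {rmorphism F -> K}) (h : {rmorphism k -> F}),
     is_derivation DF -> (forall x, D (g x) = g (DF x)) ->
     (forall y, Fs (m - i)%N y <-> exists x, y = g x) -> (forall a, g (h a) = iota a) ->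
     concl DF h.
  elim: i => [|i IH] im.
    move=> F DF g h HDF gD gE gh; exists K, D, g, v; split=> //.
      by move: v_line; rewrite -map_mx_comp (eq_map_mx _ gh).
    by move=> i; have [|a ->] := (gE (v i)).1; [rewrite subn0 | exact: algebraic_id].
  have lt : (m - i.+1 < m)%N by lia.
  have [x [hx e]] := chain _ lt.
  apply: (step hx e); rewrite -subSn // subSS; apply: IH; exact: ltnW.
have := key m (leqnn m) k Dk iota idfun HDk iotaD _ (fun a => erefl).
rewrite subnn F0; case.
  by move=> y; split=> [[x _ <-]|[x ->]]; exists x.
move=> L [DL [jL [w [h1 h2 h3 h4 h5]]]]; exists L, DL, jL, w; split=> //.
by move: h4; rewrite map_mx_id.
Qed.

End Tower.

(** * Expansions at the points of the sphere *)

Section Expansion.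
Variable C : numClosedFieldType.

Local Notation LS := (LS C).
Local Notation PS := (PS C).
Local Notation lsC := (@lsC C).
Local Notation lsX := (@lsX C).
Local Notation ls := (@ls C).
Local Notation ls_deriv := (@ls_deriv C).

(** The function z in terms of the local parameter t, and below it dz/dt: the form B dz becomes
    [jacobian x * expand x B] times dt. *)
Definition coordinate (x : sphere C) : LS :=
  if x is Some a then lsX + lsC a else lsX^-1.

Definition jacobian (x : sphere C) : LS := if x is Some a then 1 else - lsX ^- 2.

Lemma ls_deriv_coordinate x : ls_deriv (coordinate x) = jacobian x.
Proof.
have HD := @ls_deriv_derivation C.
case: x => [a|] /=; first by rewrite (drvD HD) ls_derivX ls_derivC addr0.
by rewrite (drvV HD) ls_derivX mulN1r.
Qed.

Lemma jacobian_neq0 x : jacobian x != 0.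
Proof.
case: x => [a|] /=; first exact: oner_neq0.
by rewrite oppr_eq0 invr_eq0 expf_neq0 ?lsX_neq0.
Qed.

Definition coord_eval x : {rmorphism {poly C} -> LS} :=
  horner_eval (coordinate x) \o map_poly lsC.

Lemma coord_evalE x P : coord_eval x P = (map_poly lsC P).[coordinate x].
Proof. by []. Qed.

Lemma coord_evalX x : coord_eval x 'X = coordinate x.
Proof. by rewrite coord_evalE map_polyX hornerX. Qed.

Lemma coord_evalC x c : coord_eval x c%:P = lsC c.
Proof. by rewrite coord_evalE map_polyC hornerC. Qed.

(** A factor z - c expands to a series with nonzero derivative dz/dt, hence is not zero. This allows
    the expansion to pass to rational functions. *)
Lemma coord_eval_neq0 x (P : {poly C}) : P != 0 -> coord_eval x P != 0.
Proof.
move=> P0; have [r eP] := closed_field_poly_normal P.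
rewrite eP -mul_polyC rmorphM coord_evalC mulf_neq0 //.
  by rewrite fmorph_eq0 lead_coef_eq0.
rewrite rmorph_prod prodf_seq_neq0; apply/allP => c _; rewrite implyTb rmorphB coord_evalX coord_evalC.
apply/eqP => /(congr1 ls_deriv) /eqP.
rewrite (drvB (@ls_deriv_derivation C)) ls_derivC ls_deriv_coordinate subr0.
by rewrite (drv0 (@ls_deriv_derivation C)) (negPf (jacobian_neq0 x)).
Qed.

Lemma expand_exists x : {f : {rmorphism ratfun C -> LS} | forall P, f (ratpoly P) = coord_eval x P}.
Proof.
exists (frac_rmorphism (@coord_eval_neq0 x)) => P.
exact: (frac_map_tofrac (@coord_eval_neq0 x)).
Qed.

Definition expand x : {rmorphism ratfun C -> LS} := sval (expand_exists x).

Lemma expand_poly x P : expand x (ratpoly P) = coord_eval x P.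
Proof. exact: (svalP (expand_exists x)). Qed.

Lemma expand_const x c : expand x (ratconst c) = lsC c.
Proof. by rewrite expand_poly coord_evalC. Qed.

Lemma ratfrac_surj (f : ratfun C) : exists n d, d != 0 /\ f = ratpoly n / ratpoly d.
Proof. by exists (numr f), (denr f); rewrite denr_neq0; split=> //; exact: ratfunE. Qed.

Lemma ls_deriv_coord_eval x P : ls_deriv (coord_eval x P) = coord_eval x P^`() * jacobian x.
Proof.
have H0 : is_derivation (fun _ : C => 0) by split=> *; rewrite ?mulr0 ?mul0r addr0.
rewrite !coord_evalE.
rewrite (deriv_horner H0 (@ls_deriv_derivation C) (kappa := lsC)); last first.
  by move=> y; rewrite rmorph0; exact: ls_derivC.
rewrite ls_deriv_coordinate (_ : coef_der _ P = 0) ?rmorph0 ?horner0 ?add0r //.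
by apply/polyP => i; rewrite (coef_coef_der H0) coef0.
Qed.

Lemma ls_deriv_expand x f : ls_deriv (expand x f) = jacobian x * expand x (rderiv f).
Proof.
have [n [d [d0 ->]]] := ratfrac_surj f.
rewrite rderivE // !fmorph_div rmorphXn !expand_poly.
rewrite (drvDiv (@ls_deriv_derivation C)) ?coord_eval_neq0 //.
rewrite !ls_deriv_coord_eval rmorphB !rmorphM.
move: (coord_eval x n) (coord_eval x d) (coord_eval x n^`()) (coord_eval x d^`()) (jacobian x).
by move=> a b c e j; ring.
Qed.

Lemma coord_eval0 P : coord_eval (Some 0) P = ls (ps_poly P).
Proof.
elim/poly_ind: P => [|P c IH]; first by rewrite !rmorph0.
by rewrite !rmorphD !rmorphM IH coord_evalX coord_evalC /= rmorph0 addr0.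
Qed.

Lemma coord_eval_fin a P : coord_eval (Some a) P = ls (ps_poly (P \Po ('X + a%:P))).
Proof.
elim/poly_ind: P => [|P c IH]; first by rewrite comp_poly0 !rmorph0.
rewrite comp_polyD comp_polyM comp_polyX comp_polyC.
have eX : coordinate (Some a) = ls (ps_poly ('X + a%:P)) by rewrite /= rmorphD lsD.
by rewrite !rmorphD !rmorphM IH coord_evalX coord_evalC eX.
Qed.

Lemma ps_comp_coef0 (P : {poly C}) a : psc (ps_poly (P \Po ('X + a%:P))) 0 = P.[a].
Proof. by rewrite psc_mk -horner_coef0 horner_comp !hornerE. Qed.

(** The series is the reversed polynomial t^m P(1/t), whose constant term is the coefficient of
    degree m. *)
Lemma coord_eval_inf (P : {poly C}) m : (size P <= m.+1)%N ->
  exists u : PS, coord_eval None P * lsX ^+ m = ls u /\ psc u 0 = P`_m.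
Proof.
move=> sP; exists (ps_poly (\poly_(i < m.+1) P`_(m - i))); split; last first.
  by rewrite psc_mk coef_poly subn0.
rewrite coord_evalE (@horner_coef_wide _ m.+1); last first.
  by apply: leq_trans (size_poly _ _) _.
rewrite -coord_eval0 coord_evalE (@horner_coef_wide _ m.+1 (map_poly lsC _)); last first.
  by apply: leq_trans (size_poly _ _) _; exact: size_poly.
rewrite mulr_suml (reindex_inj rev_ord_inj) /=; apply: eq_bigr => i _.
rewrite !coef_map coef_poly ltn_ord subSS -mulrA; congr (_ * _).
have X0 := lsX_neq0 C; rewrite rmorph0 addr0 exprVn.
apply: canLR (mulKf _) _; first by rewrite expf_neq0.
by rewrite -exprD subnK // -ltnS.
Qed.

(** Substituting the local parameter in a rational function and expanding at 0 amounts to expanding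
    at x. *)
Lemma expand_local_system (p : nat) (B : 'M[ratfun C]_p) x i j :
  expand (Some 0) (local_system B x i j) = jacobian x * expand x (B i j).
Proof.
have comp f g : expand (Some 0) g = coordinate x -> expand (Some 0) (ratcomp f g) = expand x f.
  move=> eg; rewrite [f in RHS]ratfunE /ratcomp !fmorph_div !expand_poly !coord_evalE.
  rewrite -!horner_map eg -!map_poly_comp.
  by congr (_.[_] / _.[_]); apply: eq_map_poly => c; exact: expand_const.
case: x comp => [a|] comp; rewrite /local_system /jacobian mxE.
  by rewrite mul1r comp // expand_poly coord_eval0 /= rmorphD lsD.
have eX : expand (Some 0) (ratpoly 'X) = lsX by rewrite expand_poly coord_eval0.
by rewrite rmorphM rmorphN fmorphV rmorphXn eX comp // fmorphV eX.
Qed.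

Definition is_ps (f : LS) : Prop := exists u, f = ls u.

Lemma is_ps_subring : subring_set is_ps.
Proof.
split; first by exists 1; rewrite rmorph1.
  by move=> _ _ [u ->] [v ->]; exists (u - v); rewrite lsB.
by move=> _ _ [u ->] [v ->]; exists (u * v); rewrite lsM.
Qed.

Lemma is_ps_finite f a : (denr f).[a] != 0 -> is_ps (expand (Some a) f).
Proof.
move=> da; rewrite [f]ratfunE fmorph_div !expand_poly !coord_eval_fin.
have [|v [-> _]] := @ls_unit C (ps_poly (denr f \Po ('X + a%:P))); first by rewrite ps_comp_coef0.
by exists (ps_poly (numr f \Po ('X + a%:P)) * v); rewrite lsM.
Qed.

Lemma is_ps_finiteP f a : is_ps (expand (Some a) f) <-> (denr f).[a] != 0.
Proof.
split=> [[u]|]; last exact: is_ps_finite.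
rewrite {1}[f]ratfunE fmorph_div => h; apply/eqP => da.
have d0 := denr_neq0 f.
have e : expand (Some a) (ratpoly (numr f)) = ls u * expand (Some a) (ratpoly (denr f)).
  by rewrite -h mulfVK // fmorph_eq0 ratpoly_neq0.
move: e; rewrite !expand_poly !coord_eval_fin -lsM => /ls_inj /(congr1 ((@psc C)^~ 0%N)).
rewrite psc00 !ps_comp_coef0 da mulr0 => na.
have na0 : root (numr f) a by rewrite /root na.
by have := coprimep_root (coprime_numr_denr f) na0; rewrite da eqxx.
Qed.

Lemma ratpoly_of_is_ps f : (forall a, is_ps (expand (Some a) f)) ->
  exists P, f = ratpoly P.
Proof.
move=> fps; have [sd|sd] := leqP (size (denr f)) 1; last first.
  have /closed_rootP [a /eqP da] : size (denr f) != 1%N by rewrite neq_ltn sd orbT.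
  by have /is_ps_finiteP := fps a; rewrite da eqxx.
exists (((denr f)`_0)^-1 *: numr f); rewrite {1}[f]ratfunE {1}(size1_polyC sd).
have d0 : (denr f)`_0 != 0.
  by have := denr_neq0 f; rewrite {1}(size1_polyC sd) polyC_eq0.
apply: (canLR (mulfK _)); first by rewrite ratpoly_neq0 // polyC_eq0.
by rewrite /ratpoly -tofracM -mul_polyC mulrAC -polyCM mulVf // mul1r.
Qed.

(** Without finite poles f is a polynomial P, and t^(deg P) P(1/t) has a nonzero constant term
    unless P = 0; vanishing at infinity excludes this. *)
Lemma no_pole_eq0 f : (forall a, is_ps (expand (Some a) f)) ->
  (exists u, expand None f = lsX * ls u) -> f = 0.
Proof.
move=> fps [u fu]; have [P eP] := ratpoly_of_is_ps fps; move: fu; rewrite eP expand_poly.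
have [->|P0] := eqVneq P 0; first by rewrite /ratpoly tofrac0.
have [v [ev v0]] := coord_eval_inf (leqSpred (size P)).
move=> fu; move: ev; rewrite fu.
have -> : lsX * ls u * lsX ^+ (size P).-1 = ls (psX C ^+ (size P) * u).
  rewrite -(prednK (n := size P)) ?size_poly_gt0 // exprS lsM lsM lsXn; ring.
move=> /ls_inj /(congr1 ((@psc C)^~ 0%N)); rewrite pscXnM size_poly_gt0 P0 v0 => /esym/eqP.
by rewrite -lead_coefE lead_coef_eq0 (negPf P0).
Qed.

Definition residue x f : C := lsc (jacobian x * expand x f) (- 1).

Lemma residueD x f g : residue x (f + g) = residue x f + residue x g.
Proof. by rewrite /residue rmorphD mulrDr lscD. Qed.

Lemma residueB x f g : residue x (f - g) = residue x f - residue x g.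
Proof. by rewrite /residue rmorphB mulrBr lscB. Qed.

Lemma residueC x c f : residue x (ratconst c * f) = c * residue x f.
Proof. by rewrite /residue rmorphM expand_const mulrCA lscCM. Qed.

Lemma lsc_deriv_residue f : lsc (ls_deriv f) (- 1) = 0.
Proof. by rewrite lsc_deriv addNr mul0r. Qed.

Lemma residue_deriv x f : residue x (rderiv f) = 0.
Proof. by rewrite /residue -ls_deriv_expand lsc_deriv_residue. Qed.

(** In characteristic 0 a polynomial has a primitive, and derivatives have no residue. *)
Lemma residue_poly x P : residue x (ratpoly P) = 0.
Proof.
pose Q : {poly C} := \poly_(i < (size P).+1) (i%:R^-1 * P`_i.-1).
have -> : ratpoly P = rderiv (ratpoly Q); last exact: residue_deriv.
have -> : ratpoly Q = ratpoly Q / ratpoly 1 by rewrite /ratpoly tofrac1 divr1.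
rewrite rderivE ?oner_neq0 // -polyC1 derivC mulr0 subr0 mulr1 polyC1 /ratpoly tofrac1 expr1n divr1.
congr (FracField.tofrac _); apply/polyP => i; rewrite coef_deriv coef_poly ltnS.
case: ltnP => h; last by rewrite mul0rn nth_default.
by rewrite -[RHS]mulr_natl mulrA divff ?mul1r // pnatr_eq0.
Qed.

Local Notation XC a := ('X - a%:P).

Lemma ratpolyXC_neq0 (a : C) : ratpoly (XC a) != 0.
Proof. by rewrite ratpoly_neq0 // polyXsubC_eq0. Qed.

Lemma residue_pow x (a : C) n : residue x (ratpoly (XC a) ^- n.+2) = 0.
Proof.
have e : rderiv (ratpoly 1 / ratpoly (XC a ^+ n.+1)) =
   ratconst (- n.+1%:R) * ratpoly (XC a) ^- n.+2.
  rewrite rderivE ?expf_neq0 ?polyXsubC_eq0 // -polyC1 derivC mul0r sub0r mul1r.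
  rewrite deriv_exp derivXsubC mul1r /= /ratconst.
  have t0 := ratpolyXC_neq0 a.
  have -> : XC a ^+ n *- n.+1 = (1 *- n.+1)%:P * XC a ^+ n.
    by rewrite polyCN (rmorph_nat (@polyC C)) mulNr mulr_natl.
  rewrite /ratpoly tofracM !tofracXn; move: t0; rewrite /ratpoly.
  move: (FracField.tofrac (XC a)) (FracField.tofrac (1 *- n.+1)%:P) => y w y0.
  have gen (K : fieldType) (b d e : K) : d != 0 -> e != 0 ->
    b * e / (d * e) ^+ 2 = b / (d * (d * e)) by move=> d0 e0; field; rewrite d0 e0.
  by rewrite (exprS y n.+1) (exprS y n) gen ?expf_neq0.
have := residue_deriv x (ratpoly 1 / ratpoly (XC a ^+ n.+1)).
by rewrite e residueC => /eqP; rewrite mulf_eq0 oppr_eq0 pnatr_eq0 /= => /eqP.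
Qed.

(** At infinity dz/(z - a) = - dt / (t (1 - a t)), whence -1. *)
Lemma residue_simple (a : C) x : residue x (ratpoly (XC a))^-1 =
  if x is Some b then (b == a)%:R else -1.
Proof.
rewrite /residue fmorphV expand_poly rmorphB coord_evalX coord_evalC.
case: x => [b|] /=.
  have -> : lsX + lsC b - lsC a = ls (psX C + psC (b - a)).
    by rewrite lsD -addrA -rmorphB.
  have [->|ba] := eqVneq b a.
    rewrite subrr /psC rmorph0 addr0 mul1r -/lsX.
    have -> : lsX^-1 = lsX ^ (-1) * ls 1 by rewrite rmorph1 mulr1.
    by rewrite lscXn subrr lsc_ls.
  have [|v [-> _]] := @ls_unit C (psX C + psC (b - a)).
    by rewrite pscD pscC /= psc_mk coefX add0r subr_eq0.
  by rewrite mul1r lsc_ls.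
have -> : lsX^-1 - lsC a = lsX^-1 * ls (1 - psX C * psC a).
  rewrite lsB lsM rmorph1 -/lsX -/(lsC a) mulrBr mulr1 mulKf //; exact: lsX_neq0.
have [|v [ev v0]] := @ls_unit C (1 - psX C * psC a).
  by rewrite pscB psc00 psc1 [psc (psX C) 0]psc_mk coefX mul0r subr0 oner_neq0.
rewrite [X in _ * X]invfM invrK ev.
have -> : - lsX ^- 2 * (lsX * ls v) = - (lsX ^ (-1) * ls v).
  have gen (K : fieldType) (b d : K) : d != 0 -> - d ^- 2 * (d * b) = - (d^-1 * b).
    by move=> d0; field.
  by rewrite gen // lsX_neq0.
rewrite lscN lscXn subrr (_ : lsc (ls v) 0 = psc v 0) ?lsc_ls //.
have : ls v * ls (1 - psX C * psC a) = 1.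
  by rewrite -ev mulVf // ls_eq0; apply: contraTneq v0 => e0; move: ev;
     rewrite e0 rmorph0 invr0 => /esym/eqP; rewrite ls_eq0 => /eqP ->; rewrite psc0 eqxx.
rewrite -lsM -(rmorph1 ls) => /ls_inj /(congr1 ((@psc C)^~ 0%N)).
rewrite psc00 psc1 pscB psc1 psc00 [psc (psX C) 0]psc_mk coefX mul0r subr0 mulr1 => ->.
by [].
Qed.

(** Partial fractions, by induction on the number of linear factors. Two distinct roots a, b are
    separated by 1/((z-a)(z-b)) = (1/(z-a) - 1/(z-b))/(a-b) up to one common factor; if all roots
    agree, division with remainder splits off a pure power of 1/(z-a). Only the first power has
    residues, 1 at a and -1 at infinity. *)
Lemma sum_residues_split (s : seq (sphere C)) (r : seq C) (P : {poly C}) :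
  uniq s -> None \in s -> {in r, forall a, Some a \in s} ->
  \sum_(x <- s) residue x (ratpoly P / ratpoly (\prod_(a <- r) XC a)) = 0.
Proof.
move=> us sN; have [n] := ubnP (size r); elim: n r P => // n IH r P.
case: r => [|a r] szr rs.
  rewrite big1 // => x _; rewrite big_nil /ratpoly tofrac1 divr1; exact: residue_poly.
have sa : Some a \in s by apply: rs; rewrite mem_head.
have rs' : {in r, forall a, Some a \in s} by move=> b br; apply: rs; rewrite inE br orbT.
have [/hasP [b br ba]|/hasPn allr] := boolP (has (predC1 a) r).
  have ab0 : a - b != 0 by rewrite subr_eq0 eq_sym.
  pose Q := \prod_(c <- rem b r) XC c.
  have eQ : \prod_(c <- r) XC c = XC b * Q by rewrite (big_rem b).
  have e : ratpoly P / ratpoly (\prod_(c <- a :: r) XC c) =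
     ratpoly ((a - b)^-1 *: P) / ratpoly (\prod_(c <- a :: rem b r) XC c)
     - ratpoly ((a - b)^-1 *: P) / ratpoly (\prod_(c <- r) XC c).
    have Q0 : ratpoly Q != 0.
      by rewrite ratpoly_neq0 // prodf_seq_neq0; apply/allP => c _; rewrite polyXsubC_eq0 implybT.
    rewrite !big_cons eQ -/Q -mul_polyC /ratpoly !tofracM.
    have ed : FracField.tofrac (XC b) = FracField.tofrac (XC a) + FracField.tofrac (a - b)%:P :> ratfun C.
      by rewrite -tofracD polyCB; congr (FracField.tofrac _); ring.
    have c0 : FracField.tofrac (a - b)%:P != 0 :> ratfun C by rewrite tofrac_eq0 polyC_eq0.
    have -> : FracField.tofrac (a - b)^-1%:P = (FracField.tofrac (a - b)%:P)^-1 :> ratfun C.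
      apply: (mulfI c0); rewrite divff // -tofracM -polyCM divff //.
    have gen (K : fieldType) (x y z t d : K) : x != 0 -> y != 0 -> z != 0 -> d != 0 ->
        y = x + d -> t / (x * (y * z)) = d^-1 * t / (x * z) - d^-1 * t / (y * z).
      by move=> x0 y0 z0 d0 e; rewrite e in y0 *; field; rewrite x0 y0 z0 d0.
    have t0 (b' : C) : FracField.tofrac (XC b') != 0 :> ratfun C := ratpolyXC_neq0 b'.
    rewrite /ratpoly in Q0; exact: (gen _ _ _ _ _ _ (t0 a) (t0 b) Q0 c0 ed).
  rewrite e (eq_bigr _ (fun x _ => residueB x _ _)).
  have sr : (size (rem b r)).+1 = size r.
    by rewrite size_rem // prednK //; case: (r) br.
  have rs'' : {in a :: rem b r, forall c, Some c \in s}.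
    by move=> c; rewrite inE => /predU1P [->//|/mem_rem]; exact: rs'.
  have lt1 : (size (a :: rem b r) < n)%N by rewrite /= sr; exact: szr.
  by rewrite sumrB !IH ?subr0.
have er : r = nseq (size r) a.
  by apply/all_pred1P/allP => c cr; have := allr c cr; rewrite /= negbK.
have ep m : ratpoly (\prod_(c <- nseq m a) XC c) = ratpoly (XC a) ^+ m.
  rewrite /ratpoly -tofracXn; congr (FracField.tofrac _).
  by elim: m => [|m IHm] /=; [rewrite big_nil | rewrite big_cons IHm exprS].
have t0 := ratpolyXC_neq0 a.
have e : ratpoly P / ratpoly (\prod_(c <- a :: r) XC c) =
   ratpoly (P %/ XC a) / ratpoly (\prod_(c <- r) XC c) +
   ratconst P.[a] * ratpoly (XC a) ^- (size r).+1.
  rewrite (_ : a :: r = nseq (size r).+1 a) ?ep; last by rewrite /= -er.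
  rewrite [in X in ratpoly X](_ : P = (P %/ XC a) * XC a + P.[a]%:P); last first.
    by rewrite -modp_XsubC -divp_eq.
  rewrite {2}er ep /ratpoly tofracD tofracM -/(ratpoly (XC a)) -/(ratconst _) exprS.
  have gen (K : fieldType) (b d y z : K) : y != 0 -> z != 0 ->
    (b * z + d) / (z * y) = b / y + d / (z * y) by move=> y0 z0; field; rewrite y0 z0.
  by apply: gen; rewrite ?expf_neq0.
rewrite e (eq_bigr _ (fun x _ => residueD x _ _)) big_split /= IH //.
rewrite add0r (eq_bigr _ (fun x _ => residueC x _ _)) -mulr_sumr; apply/eqP; rewrite mulf_eq0; apply/orP; right.
case: (size r) => [|m]; last by rewrite big1 // => x _; exact: residue_pow.
rewrite expr1 (eq_bigr _ (fun x _ => residue_simple a x)).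
rewrite (big_rem None) //= (big_rem (Some a)) /=; last by rewrite mem_rem_uniq // inE sa.
rewrite eqxx addrA addNr add0r big1_seq // => x /andP [_].
rewrite (mem_rem_uniq _ (rem_uniq None us)) inE (mem_rem_uniq _ us) inE => /andP [xa /andP [xN _]].
by case: x xa xN => [b|] // xa _; case: (eqVneq b a) xa => [->|//]; rewrite eqxx.
Qed.

Theorem sum_residues (s : seq (sphere C)) (f : ratfun C) : uniq s -> None \in s ->
  (forall a, Some a \notin s -> is_ps (expand (Some a) f)) ->
  \sum_(x <- s) residue x f = 0.
Proof.
move=> us sN fs; have [r er] := closed_field_poly_normal (denr f).
have d0 := denr_neq0 f.
have rs : {in r, forall a, Some a \in s}.
  move=> a ar; apply: contraT => /fs /is_ps_finiteP; rewrite er hornerZ.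
  suff -> : (\prod_(z <- r) ('X - z%:P)).[a] = 0 by rewrite mulr0 eqxx.
  by apply/eqP; rewrite -rootE root_prod_XsubC.
have lc0 : lead_coef (denr f) != 0 by rewrite lead_coef_eq0.
have e : f = ratconst (lead_coef (denr f))^-1 *
    (ratpoly (numr f) / ratpoly (\prod_(a <- r) ('X - a%:P))).
  have c0 : ratconst (lead_coef (denr f)) != 0 by rewrite ratpoly_neq0 // polyC_eq0.
  have -> : ratconst (lead_coef (denr f))^-1 = (ratconst (lead_coef (denr f)))^-1.
    by apply: (mulfI c0); rewrite divff // /ratconst /ratpoly -tofracM -polyCM divff.
  rewrite {1}[f]ratfunE {1}er -mul_polyC /ratpoly tofracM.
  by rewrite invfM mulrCA.
by rewrite e (eq_bigr _ (fun x _ => residueC x _ _)) -mulr_sumr sum_residues_split // mulr0.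
Qed.

End Expansion.

(** * Algebraic solutions of y' = om y *)

Section AlgebraicSolutions.
Variables (M L : fieldType) (kappa : {rmorphism M -> L}) (DM : M -> M) (D : L -> L).
Hypotheses (HDM : is_derivation DM) (HD : is_derivation D).
Hypothesis kD : forall x, D (kappa x) = kappa (DM x).

(** Differentiating P(y) = 0 and subtracting n om P(y), where n = deg P, gives a polynomial of
    degree less than n that kills y; all its coefficients therefore vanish. *)
Lemma algebraic_exponential_coef y om : algebraicOver kappa y ->
  D y = kappa om * y ->
  exists P : {poly M}, [/\ P \is monic, root (map_poly kappa P) y,
    (forall Q, root (map_poly kappa Q) y = (P %| Q)) &
    forall i, DM P`_i = ((size P).-1%:R - i%:R) * om * P`_i].
Proof.
move=> ay Dy; have [P monP Py] := min_annihilator ay.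
exists P; split=> // [|i]; first by rewrite Py dvdpp.
have P0 := monic_neq0 monP.
set n := (size P).-1.
pose Q := coef_der DM P + om *: ('X * P^`()) - (n%:R * om) *: P.
have QE j : Q`_j = DM P`_j + (j%:R - n%:R) * om * P`_j.
  rewrite !coefD coefN !coefZ coef_coef_der // coefXM coef_deriv.
  by case: j => [|j] /=; rewrite -1?mulr_natl; ring.
have Py0 : (map_poly kappa P).[y] = 0 by apply/eqP; rewrite -rootE Py dvdpp.
have : P %| Q.
  rewrite -Py rootE /Q rmorphB rmorphD /= !map_polyZ rmorphM /= map_polyX !hornerE.
  have := deriv_horner HDM HD kD P y; rewrite Py0 (drv0 HD) Dy => e.
  apply/eqP; rewrite mulr0 subr0 [RHS]e; congr (_ + _) => /=.
  by rewrite mulrC.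
have szQ : (size Q <= n)%N.
  apply/leq_sizeP => j; rewrite leq_eqVlt QE => /predU1P [<-|h].
    rewrite subrr !mul0r addr0 (_ : P`_n = 1) ?(drv1 HDM) //.
    by rewrite -/(lead_coef P) (monicP monP).
  by rewrite nth_default ?mulr0 ?(drv0 HDM) ?addr0 //; apply: leq_trans (leqSpred _) h.
have [Q0 _|Q0 /(dvdp_leq Q0)] := eqVneq Q 0; last first.
  by move=> h; have := leq_trans h szQ; rewrite /n -ltnS prednK ?ltnn // size_poly_gt0.
have := QE i; rewrite Q0 coef0 => /esym/eqP; rewrite addr_eq0 => /eqP ->; ring.
Qed.

(** The witness c is the constant coefficient of the minimal polynomial, up to sign the norm of y,
    and e is the degree: c is nonzero because y is. *)
Lemma algebraic_exponential y om : y != 0 -> algebraicOver kappa y ->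
  D y = kappa om * y ->
  exists (e : nat) (c : M), [/\ (0 < e)%N, c != 0 & DM c = e%:R * om * c].
Proof.
move=> y0 ay Dy; have [P [monP Py Pmin coefP]] := algebraic_exponential_coef ay Dy.
exists (size P).-1, P`_0; split; last by rewrite coefP subr0.
  rewrite lt0n; apply/eqP => s0.
  have sP : (size P <= 1)%N by lia.
  move: Py; rewrite (size1_polyC sP) map_polyC rootC fmorph_eq0 => /eqP e.
  by have := monic_neq0 monP; rewrite (size1_polyC sP) e polyC0 eqxx.
apply/eqP => e; have : root P 0 by rewrite rootE horner_coef0 e.
move=> /factor_theorem [R eR]; rewrite subr0 in eR.
have P0 := monic_neq0 monP.
have R0 : R != 0 by apply: contraNneq P0 => h; rewrite eR h mul0r.
move: Py; rewrite {1}eR rmorphM /= map_polyX rootM rootX (negPf y0) orbF Pmin.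
by move=> /(dvdp_leq R0); rewrite {1}eR size_mulX // ltnn.
Qed.

End AlgebraicSolutions.

Section LocalForm.
Variable C : numClosedFieldType.

Local Notation LS := (LS C).
Local Notation PS := (PS C).
Local Notation lsC := (@lsC C).
Local Notation ls := (@ls C).
Local Notation ls_deriv := (@ls_deriv C).

Lemma ls_deriv_eq0 (f : LS) : ls_deriv f = 0 -> exists c, f = lsC c.
Proof.
move=> f0; exists (lsc f 0); apply: lsc_inj => k.
rewrite lsc_ls; case: k => [[|n]|n]; rewrite ?pscC //.
  have := lsc_deriv f n; rewrite f0 lsc0 => /esym/eqP; rewrite mulf_eq0 intr_eq0.
  by rewrite (_ : n%:Z + 1 = n.+1) ?addn1 //; [move=> /eqP|lia].
have := lsc_deriv f (Negz n.+1); rewrite f0 lsc0 => /esym/eqP; rewrite mulf_eq0 intr_eq0.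
by rewrite (_ : Negz n.+1 + 1 = Negz n) //; [move=> /eqP|lia].
Qed.

(** With om = 0 the coefficients of the minimal polynomial are constants, and over the algebraically
    closed C it has its roots in C. *)
Lemma algebraic_constant (L : fieldType) (kappa : {rmorphism LS -> L}) (D : L -> L) y :
  is_derivation D -> (forall x, D (kappa x) = kappa (ls_deriv x)) ->
  algebraicOver kappa y -> D y = 0 -> exists c, y = kappa (lsC c).
Proof.
move=> HD kD ay Dy0.
have Dy : D y = kappa 0 * y by rewrite Dy0 rmorph0 mul0r.
have [P [monP Py _ coefP]] :=
  algebraic_exponential_coef (@ls_deriv_derivation C) HD kD ay Dy.
have cst i : exists c, P`_i = lsC c by apply: ls_deriv_eq0; rewrite coefP mulr0 mul0r.
have eP : P = map_poly lsC (\poly_(i < size P) sval (cid (cst i))).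
  apply/polyP => i; rewrite coef_map coef_poly; case: ltnP => h.
    exact: (svalP (cid (cst i))).
  by rewrite nth_default //; apply: esym; exact: rmorph0.
move: (\poly_(i < _) _) eP => R eP.
have R0 : R != 0 by apply: contraTneq (monic_neq0 monP) => h; rewrite eP h rmorph0 eqxx.
have [r er] := closed_field_poly_normal R.
move: Py; rewrite eP -map_poly_comp er map_polyZ /= rootE hornerZ mulf_eq0.
rewrite fmorph_eq0 fmorph_eq0 lead_coef_eq0 (negPf R0) /= rmorph_prod horner_prod.
rewrite prodf_seq_eq0 => /hasP [c _] /=; rewrite rmorphB /= map_polyX map_polyC.
by rewrite !hornerE subr_eq0 => /eqP ->; exists c.
Qed.

Variable p : nat.

Definition system_at x (B : 'M[ratfun C]_p) : 'M[LS]_p :=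
  jacobian x *: map_mx (expand x) B.

(* [om] is the logarithmic derivative of the diagonal factor [t^Lambda e^Q]; the last
   clause says that [exp (\int (om j - om l))] is algebraic over the Laurent series only
   if [om j = om l]. *)
Definition local_form x (B : 'M[ratfun C]_p) (F : 'M[PS]_p) (om : 'I_p -> LS) : Prop :=
  [/\ map_mx (@ps0 C) F \in unitmx,
      system_at x B *m map_mx ls F =
        map_mx ls_deriv (map_mx ls F) + map_mx ls F *m diag_mx (\row_j om j) &
      forall j l e c, (0 < e)%N -> c != 0 ->
        ls_deriv c = e%:R * (om j - om l) * c -> om j = om l].

Lemma local_form_unit x B F om : local_form x B F om -> map_mx ls F \in unitmx.
Proof.
move=> [uF _ _]; rewrite unitmxE unitfE det_map_mx ls_eq0.
apply/eqP => e; move: uF; rewrite unitmxE unitfE det_map_mx e.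
by rewrite rmorph0 eqxx.
Qed.

End LocalForm.

Lemma map_mx_derivM (K : fieldType) (D : K -> K) m n q (A : 'M[K]_(m, n)) (B : 'M[K]_(n, q)) :
  is_derivation D -> map_mx D (A *m B) = map_mx D A *m B + A *m map_mx D B.
Proof.
move=> HD; apply/matrixP => i j; rewrite !mxE (drv_sum HD) -big_split /=.
by apply: eq_bigr => k _; rewrite (drvM HD) !mxE.
Qed.

Section LocalAnalysis.
Variables (C : numClosedFieldType) (p : nat) (x : sphere C) (B : 'M[ratfun C]_p).
Variables (F : 'M[PS C]_p) (om : 'I_p -> LS C).
Hypothesis FB : local_form x B F om.

Local Notation ls := (@ls C).
Local Notation lsC := (@lsC C).
Local Notation ls_deriv := (@ls_deriv C).

Variables (L : fieldType) (D : L -> L) (kappa : {rmorphism LS C -> L}).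
Hypotheses (HD : is_derivation D) (kD : forall f, D (kappa f) = kappa (ls_deriv f)).

(** In the frame F the line W = F^-1 v satisfies W_j' = (om_j - u) W_j, so W_j / W_l is algebraic
    with logarithmic derivative om_j - om_l. The last clause of [local_form] forces om_j = om_l, and
    the quotient is then a constant. Hence v is h F c with c constant and supported on indices
    sharing one om. *)
Lemma local_inv_line (v : 'I_p -> L) i0 : v i0 != 0 ->
  (forall i, algebraicOver kappa (v i)) ->
  inv_line D (map_mx kappa (system_at x B)) v ->
  exists (h : L) (c : 'cV[C]_p) (l : 'I_p), [/\ h != 0, c l 0 != 0,
    forall j, c j 0 != 0 -> om j = om l &
    forall i, v i = h * kappa ((map_mx ls F *m map_mx lsC c) i 0)].
Proof.
move=> vi0 v_alg [u Hu]; have uF := local_form_unit FB; have [_ eF gap] := FB.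
pose Fk := map_mx kappa (map_mx ls F).
have uFk : Fk \in unitmx by rewrite map_unitmx.
pose V : 'cV[L]_p := \col_i v i; pose W := invmx Fk *m V.
have eV : V = Fk *m W by rewrite mulmxA mulmxV // mul1mx.
have eV' : map_mx D V = map_mx kappa (system_at x B) *m V - u *: V.
  by apply/matrixP => i j; rewrite !mxE Hu; congr (_ - _); apply: eq_bigr => k _; rewrite !mxE.
have eFk : map_mx D Fk = map_mx kappa (system_at x B) *m Fk
    - Fk *m map_mx kappa (diag_mx (\row_j om j)).
  rewrite -!map_mxM -map_mxB eF addrK -!map_mx_comp; apply/matrixP => i j.
  by rewrite !mxE /= kD.
have eW : map_mx D W = map_mx kappa (diag_mx (\row_j om j)) *m W - u *: W.
  have h : Fk *m map_mx D W = Fk *m (map_mx kappa (diag_mx (\row_j om j)) *m W - u *: W).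
    have := map_mx_derivM Fk W HD; rewrite -eV eV' eFk mulmxBl -!mulmxA -eV => e.
    rewrite mulmxBr -scalemxAr -eV.
    apply: (addrI (map_mx kappa (system_at x B) *m V - Fk *m (map_mx kappa (diag_mx (\row_j om j)) *m W))).
    by rewrite -e addrA subrK.
  by rewrite -[LHS](mulKmx uFk) h mulKmx.
have W' j : D (W j 0) = kappa (om j) * W j 0 - u * W j 0.
  have := congr1 (fun X : 'cV[L]_p => X j 0) eW; rewrite mxE => ->.
  rewrite [LHS]mxE mxE; congr (_ + _); last by rewrite !mxE.
  rewrite (bigD1 j) //= big1 ?addr0 => [|k kj]; first by rewrite !mxE eqxx mulr1n.
  by rewrite !mxE eq_sym (negPf kj) mulr0n rmorph0 mul0r.
have W_alg j : algebraicOver kappa (W j 0).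
  rewrite mxE; apply: (big_ind (fun z => algebraicOver kappa z)) => [|a b|k _].
  - exact: algebraic0.
  - exact: algebraic_add.
  apply: algebraic_mul; last by rewrite mxE.
  by rewrite /Fk -map_invmx mxE; exact: algebraic_id.
have [l Wl] : exists l, W l 0 != 0.
  apply: contrapT => /forallNP h; move: vi0.
  have -> : v i0 = V i0 0 by rewrite mxE.
  rewrite eV mxE big1 ?eqxx // => k _; have /negP := h k; rewrite negbK => /eqP ->.
  by rewrite mulr0.
have cst j : exists c, W j 0 = W l 0 * kappa (lsC c) /\ (c != 0 -> om j = om l).
  have [->|Wj] := eqVneq (W j 0) 0.
    by exists 0; rewrite !rmorph0 mulr0 eqxx.
  pose y := W j 0 / W l 0.
  have y0 : y != 0 by rewrite mulf_neq0 // invr_eq0.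
  have Dy : D y = kappa (om j - om l) * y.
    rewrite /y (drvDiv HD) // !W' rmorphB; move: Wl.
    by move: (W j 0) (W l 0) (kappa (om j)) (kappa (om l)) => a b d e b0; field.
  have ay : algebraicOver kappa y by apply: algebraic_div.
  have [e [d [e0 d0 Dd]]] := algebraic_exponential (@ls_deriv_derivation C) HD kD y0 ay Dy.
  have eom := gap j l e d e0 d0 Dd.
  have [c yc] : exists c, y = kappa (lsC c).
    by apply: (algebraic_constant HD kD ay); rewrite Dy eom subrr rmorph0 mul0r.
  by exists c; split=> //; rewrite -yc /y mulrC divfK.
pose c : 'cV[C]_p := \col_j sval (cid (cst j)).
have cE j : W j 0 = W l 0 * kappa (lsC (c j 0)) /\ (c j 0 != 0 -> om j = om l).
  have -> : c j 0 = sval (cid (cst j)) by rewrite mxE.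
  exact: (svalP (cid (cst j))).
exists (W l 0), c, l; split=> //.
- apply: contraNneq Wl => e; have [-> _] := cE l; by rewrite e !rmorph0 mulr0.
- by move=> j; have [_] := cE j.
move=> i; have -> : v i = V i 0 by rewrite mxE.
have -> : (map_mx ls F *m map_mx lsC c) i 0 = \sum_k ls (F i k) * lsC (c k 0).
  by rewrite mxE; apply: eq_bigr => k _; rewrite [map_mx ls F i k]mxE [map_mx lsC c k 0]mxE.
rewrite eV mxE rmorph_sum mulr_sumr; apply: eq_bigr => k _.
have [-> _] := cE k; rewrite rmorphM mulrCA; congr (_ * (_ * _)).
by rewrite /Fk !mxE.
Qed.

End LocalAnalysis.

(** * Algebraic stable lines are rational *)

(* Lagrange interpolation: [P mu'] and [\sum_w P(w) \prod_(w' != w) (X - w')] agree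
   at all the roots of [mu]. *)
Lemma trace_coef (M : fieldType) (r : seq M) (P : {poly M}) :
  let mu := \prod_(w <- r) ('X - w%:P) in uniq r ->
  ((P * mu^`()) %% mu)`_(size r).-1 = \sum_(w <- r) P.[w].
Proof.
move=> mu ur; pose m w := \prod_(w' <- rem w r) ('X - w'%:P).
have mE w : w \in r -> mu = ('X - w%:P) * m w by move=> wr; rewrite /mu (big_rem w).
have sm w : w \in r -> size (m w) = size r.
  by move=> wr; rewrite size_prod_XsubC size_rem // prednK //; case: (r) wr.
have smu : size mu = (size r).+1 by rewrite size_prod_XsubC.
pose R := \sum_(w <- r) P.[w] *: m w.
have sR : (size R <= size r)%N.
  rewrite /R big_seq; apply: (big_ind (fun Q : {poly M} => (size Q <= size r)%N)).
  - by rewrite size_poly0.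
  - by move=> Q Q' h h'; apply: leq_trans (size_polyD _ _) _; rewrite geq_max h h'.
  by move=> w wr; apply: leq_trans (size_scale_leq _ _) _; rewrite sm.
have RE w : w \in r -> R.[w] = P.[w] * (m w).[w].
  move=> wr; rewrite /R horner_sum (big_rem w) //= hornerZ big1_seq ?addr0 // => w' /andP [_ w'r].
  have w'r' := mem_rem w'r.
  rewrite hornerZ; suff -> : (m w').[w] = 0 by rewrite mulr0.
  apply/eqP; rewrite -rootE root_prod_XsubC mem_rem_uniq // inE wr andbT.
  by move: w'r; rewrite mem_rem_uniq // inE eq_sym => /andP [].
have mu'E w : w \in r -> mu^`().[w] = (m w).[w].
  by move=> wr; rewrite (mE w wr) derivM derivXsubC mul1r !hornerE subrr mul0r addr0.
have : mu %| P * mu^`() - R.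
  apply: uniq_roots_dvdp; last by rewrite uniq_rootsE.
  by apply/allP => w wr; rewrite rootE !hornerE mu'E // RE // subrr.
rewrite /dvdp modpD modpN subr_eq0 => /eqP ->.
rewrite modp_small ?smu // /R coef_sum big_seq [RHS]big_seq; apply: eq_bigr => w wr.
rewrite coefZ -(sm w wr) -lead_coefE (monicP (monic_prod_XsubC _ _ _)) mulr1.
by [].
Qed.

(** Test a nonzero element z0 against a polynomial X Q vanishing at all the other elements: the sum
    of its values is a multiple of (X Q)(z0) by a positive integer, and also a combination of power
    sums. *)
Lemma power_sums_eq0 (M : fieldType) (s : seq M) : (forall n, n.+1%:R != 0 :> M) ->
  (forall m, \sum_(z <- s) z ^+ m.+1 = 0) -> {in s, forall z, z = 0}.
Proof.
move=> char0 h z0 z0s; apply/eqP; apply: contraT => nz.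
pose Q : {poly M} := \prod_(u <- rem z0 (undup s)) ('X - u%:P).
have sumQ : \sum_(z <- s) ('X * Q).[z] = 0.
  rewrite (eq_bigr (fun z => \sum_(i < size Q) Q`_i * z ^+ i.+1)); last first.
    move=> z _; rewrite hornerM hornerX horner_coef mulr_sumr.
    by apply: eq_bigr => i _; rewrite mulrCA exprS.
  by rewrite exchange_big big1 //= => i _; rewrite -mulr_sumr h mulr0.
have Q0 : ('X * Q).[z0] != 0.
  rewrite hornerM hornerX mulf_neq0 // -rootE root_prod_XsubC.
  by rewrite mem_rem_uniq ?undup_uniq // inE eqxx.
move: sumQ; rewrite (bigID (pred1 z0)) /= [X in _ + X]big_seq_cond [X in _ + X]big1 => [|z /andP [zs zz]].
  rewrite addr0 (eq_bigr (fun=> ('X * Q).[z0])) => [|z /eqP -> //].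
  rewrite big_const_seq iter_addr_0 -mulr_natl => /eqP.
  rewrite mulf_eq0 (negPf Q0) orbF.
  have : (0 < count (pred1 z0) s)%N by rewrite -has_count has_pred1.
  by case: (count _ _) => // n _; rewrite (negPf (char0 n)).
apply/eqP; rewrite hornerM mulf_eq0; apply/orP; right.
by rewrite -rootE root_prod_XsubC mem_rem_uniq ?undup_uniq // inE zz mem_undup.
Qed.

Section ExtDerivation.
Variables (M : fieldType) (DM : M -> M).
Hypothesis HDM : is_derivation DM.

Lemma coef_der_derivation : derivation (coef_der DM).
Proof.
split=> P Q; apply/polyP => i; rewrite ?coefD !(coef_coef_der HDM) ?coefD ?(drvD HDM) //.
rewrite !coefM (drv_sum HDM) -big_split /=; apply: eq_bigr => j _.
by rewrite (drvM HDM) !(coef_coef_der HDM).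
Qed.

(** The derivation of M[X] that extends [DM] and sends X to h; it models differentiation of
    polynomials in an element y with y' = h(y). *)
Definition ext_der (h P : {poly M}) : {poly M} := coef_der DM P + h * P^`().

Lemma ext_der_derivation h : derivation (ext_der h).
Proof.
split=> P Q; rewrite /ext_der.
  by rewrite (drvD coef_der_derivation) derivD; ring.
by rewrite (drvM coef_der_derivation) derivM; ring.
Qed.

Lemma ext_derC h c : ext_der h c%:P = (DM c)%:P.
Proof.
rewrite /ext_der derivC mulr0 addr0; apply/polyP => i.
by rewrite (coef_coef_der HDM) !coefC; case: eqP => // _; rewrite (drv0 HDM).
Qed.

Variables (L : fieldType) (kappa : {rmorphism M -> L}) (D : L -> L).
Hypotheses (HD : is_derivation D) (kD : forall x, D (kappa x) = kappa (DM x)).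

Lemma map_ext_der h P : map_poly kappa (ext_der h P) =
  map_poly kappa (coef_der DM P) + map_poly kappa h * (map_poly kappa P)^`().
Proof. by rewrite /ext_der rmorphD rmorphM /= deriv_map. Qed.

Lemma ext_der_horner h P y : D y = (map_poly kappa h).[y] ->
  D (map_poly kappa P).[y] = (map_poly kappa (ext_der h P)).[y].
Proof.
move=> Dy; rewrite (deriv_horner HDM HD kD) Dy map_ext_der.
by rewrite hornerD hornerM mulrC deriv_map.
Qed.

End ExtDerivation.

(** The equation mu(w) = 0 multiplied by (d y)^n. In the application d clears denominators and y is
    the power of t that cancels the pole of d w. *)
Lemma monic_root_scaled (K : comNzRingType) (mu : {poly K}) (d y w : K) n :
  mu \is monic -> size mu = n.+1 -> root mu w ->
  (d * w * y) ^+ n + \sum_(i < n) (d ^+ (n - i) * mu`_i) * y ^+ (n - i) * (d * w * y) ^+ i = 0.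
Proof.
move=> monmu sz /eqP; rewrite horner_coef sz big_ord_recr /=.
have -> : mu`_n = 1 by have := monicP monmu; rewrite lead_coefE sz.
rewrite mul1r addrC => /(congr1 (fun z => z * d ^+ n * y ^+ n)).
rewrite !mul0r !mulrDl !mulr_suml => h; rewrite -[RHS]h; congr (_ + _).
  by rewrite -!exprMn; congr (_ ^+ n); ring.
apply: eq_bigr => i _; rewrite !exprMn.
have en z : z ^+ n = z ^+ (n - i) * z ^+ i :> K by rewrite -exprD subnK // ltnW.
by rewrite (en d) (en y); ring.
Qed.

Section RationalRoot.
Variable C : numClosedFieldType.

Local Notation k := (ratfun C).
Local Notation LS := (LS C).
Local Notation lsX := (@lsX C).
Local Notation lsC := (@lsC C).
Local Notation ls := (@ls C).
Local Notation ls_deriv := (@ls_deriv C).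

Let HDk : is_derivation (@rderiv C) := @rderiv_derivation C.
Let HDs : is_derivation ls_deriv := @ls_deriv_derivation C.

Lemma expand_ext_der x (h P : {poly k}) w :
  ls_deriv w = jacobian x * (map_poly (expand x) h).[w] ->
  ls_deriv (map_poly (expand x) P).[w] =
    jacobian x * (map_poly (expand x) (ext_der (@rderiv C) h P)).[w].
Proof.
move=> Dw; have := deriv_horner HDs HDs (kappa := idfun) (fun=> erefl) (map_poly (expand x) P) w.
rewrite !map_poly_id // => ->.
rewrite map_ext_der hornerD hornerM mulrDr Dw; congr (_ + _).
  rewrite -hornerZ; congr (_.[_]); apply/polyP => i.
  by rewrite (coef_coef_der HDs) coefZ !coef_map ls_deriv_expand (coef_coef_der HDk).
by rewrite mulrC mulrA.
Qed.

(** A root of mu in C((t)) obeys the equation imposed by h: differentiate mu(w) = 0, compare with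
    the vanishing of [ext_der] of mu at w, and cancel mu'(w), nonzero by separability. *)
Lemma ls_deriv_root x (h mu : {poly k}) w :
  coprimep mu mu^`() -> mu %| ext_der (@rderiv C) h mu ->
  root (map_poly (expand x) mu) w -> ls_deriv w = jacobian x * (map_poly (expand x) h).[w].
Proof.
move=> cop dv w0.
have mu'w : (map_poly (expand x) mu)^`().[w] != 0.
  by apply: coprimep_root w0; rewrite deriv_map coprimep_map.
have := deriv_horner HDs HDs (kappa := idfun) (fun=> erefl) (map_poly (expand x) mu) w.
rewrite !map_poly_id // (eqP w0) (drv0 HDs) => /esym/eqP; rewrite addrC addr_eq0 => /eqP e.
have : root (map_poly (expand x) (ext_der (@rderiv C) h mu)) w.
  by have [q ->] := dvdpP _ _ dv; rewrite rmorphM rootM w0 orbT.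
rewrite map_ext_der rootE hornerD hornerM => /eqP e'.
apply: (mulfI mu'w); rewrite e.
have -> : coef_der ls_deriv (map_poly (expand x) mu) =
    jacobian x *: map_poly (expand x) (coef_der (@rderiv C) mu).
  apply/polyP => i.
  by rewrite (coef_coef_der HDs) coefZ !coef_map ls_deriv_expand (coef_coef_der HDk).
rewrite hornerZ; move/eqP: e'; rewrite addr_eq0 => /eqP ->.
by rewrite mulrN opprK [in RHS]mulrC -mulrA.
Qed.

Lemma ls_not_ps (f : LS) : ~ is_ps f -> exists (m : nat) (u : PS C),
  f * lsX ^+ m.+1 = ls u /\ psc u 0 != 0.
Proof.
move=> nf; have [f0|f0] := eqVneq f 0.
  by case: nf; exists 0; rewrite f0 rmorph0.
have [[n|n] [u [e u0]]] := ls_decomp f0.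
  by case: nf; exists (psX C ^+ n * u); rewrite e lsM lsXn.
exists n, u; split; last exact: u0.
have gen (K : fieldType) (x y : K) : x != 0 -> x ^ Negz n * y * x ^+ n.+1 = y.
  by move=> x0; rewrite NegzE -invr_expz -exprnP mulrAC mulVf ?mul1r ?expf_neq0.
by rewrite e; apply: gen; exact: lsX_neq0.
Qed.

(** Power series are integrally closed: if d w had a pole of order m + 1, its equation multiplied by
    a power of t would make the n-th power of an invertible series divisible by t. *)
Lemma ls_integral (mu : {poly LS}) (d w : LS) : mu \is monic -> is_ps d ->
  (forall i, is_ps (d * mu`_i)) -> root mu w -> is_ps (d * w).
Proof.
move=> monmu dps cps w0; apply: contrapT => /ls_not_ps [m [u [e u0]]].
pose n := (size mu).-1.
have sz : size mu = n.+1 by rewrite prednK // size_poly_gt0 monic_neq0.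
have HP := is_ps_subring C.
have main : ls u ^+ n + \sum_(i < n) (d ^+ (n - i) * mu`_i) * lsX ^+ (m.+1 * (n - i)) * ls u ^+ i = 0.
  rewrite -[RHS](monic_root_scaled d (lsX ^+ m.+1) monmu sz w0) -e; congr (_ + _).
  by apply: eq_bigr => i _; rewrite (exprM lsX).
have [v ev] : is_ps (\sum_(i < n) (d ^+ (n - i) * mu`_i) * lsX ^+ (m.+1 * (n - i)).-1 * ls u ^+ i).
  apply: subring_sum => // i _; apply: subringM => //; last first.
    by apply: subringX => //; exists u.
  apply: subringM => //; last by apply: subringX => //; exists (psX C).
  have -> : (n - i = (n - i).-1.+1)%N by rewrite prednK // subn_gt0.
  by rewrite exprSr -mulrA; apply: subringM => //; apply: subringX.
have : u ^+ n + psX C * v = 0.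
  apply: (@ls_inj C); rewrite rmorph0 lsD rmorphXn lsM -main -ev mulr_sumr; congr (_ + _).
  apply: eq_bigr => i _.
  have -> : lsX ^+ (m.+1 * (n - i)) = lsX * lsX ^+ (m.+1 * (n - i)).-1.
    by rewrite -exprS prednK // muln_gt0 subn_gt0 ltn_ord.
  by rewrite [_ * (_ * lsX ^+ (m.+1 * (n - i)).-1)]mulrCA -!mulrA.
move=> e0; have : psc (u ^+ n) 0 = 0.
  have := congr1 (fun z => psc z 0) e0.
  by rewrite pscD psc00 [psc (psX C) 0]psc_mk coefX mul0r addr0 psc0.
rewrite -[psc _ 0]/(ps0 _) rmorphXn => /eqP.
by rewrite expf_eq0 (negPf u0) andbF.
Qed.

Definition ord (n : int) (f : LS) : Prop := forall k, k < n -> lsc f k = 0.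

Lemma ord_ex f : exists n, ord n f.
Proof.
have [n [u e]] := ls_clear f; exists (- n%:Z) => k kn; rewrite (lscE e) /shiftc.
by case E: (_ + _) => [m|m] //; lia.
Qed.

Lemma ord_le n m f : m <= n -> ord n f -> ord m f.
Proof. by move=> mn h k km; apply: h; apply: lt_le_trans km mn. Qed.

Lemma ord0_is_ps f : ord 0 f -> is_ps f.
Proof.
move=> h; exists (mkps (fun m => lsc f m)); apply: lsc_inj => k.
by rewrite lsc_ls; case: k => [m|m] //; apply: h.
Qed.

Lemma ord1_is_ps f : ord 1 f -> exists u, f = lsX * ls u.
Proof.
move=> h; have [|u eu] := @ord0_is_ps (lsX ^ (-1) * f).
  by move=> k k0; rewrite lscXn; apply: h; lia.
by exists u; rewrite -eu mulrA divff ?mul1r // lsX_neq0.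
Qed.

(** At infinity d/dz is - t^2 d/dt, which gains one order of vanishing. *)
Lemma ord_deriv_inf n f : ord n f -> ord (n + 1) ((jacobian None)^-1 * ls_deriv f).
Proof.
move=> h k kn; rewrite /jacobian invrN invrK mulNr lscN (_ : lsX ^+ 2 = lsX ^ 2%:Z) // lscXn.
rewrite lsc_deriv h ?mulr0 ?oppr0 //; lia.
Qed.

Lemma iter_deriv_eq0 N f : is_ps f -> iter N ls_deriv f = 0 ->
  exists P, f = ls (ps_poly P).
Proof.
move=> [u ->] e; exists (\poly_(i < N) psc u i); congr ls.
have key n g i : iter n ls_deriv g = 0 -> (n <= i)%N -> lsc g i = 0.
  elim: n i g => [|n IH] i g; first by move=> /= -> _; exact: lsc0.
  rewrite iterSr => h; case: i => // i ni.
  have /eqP := IH i _ h ni; rewrite lsc_deriv mulf_eq0 intr_eq0.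
  by rewrite (_ : i%:Z + 1 = i.+1) ?addn1 //; [move=> /eqP|lia].
apply: psP => i; rewrite -[RHS]/((\poly_(i < N) psc u i)`_i) coef_poly.
case: ltnP => // ni.
by have := key N _ _ e ni; rewrite lsc_ls.
Qed.

Variables (h mu : {poly k}).
Hypotheses (mon_mu : mu \is monic) (mu_size : (1 < size mu)%N).
Hypotheses (mu_sep : coprimep mu mu^`()) (mu_der : mu %| ext_der (@rderiv C) h mu).
Hypothesis mu_split : forall x, exists r : seq LS,
  map_poly (expand x) mu = \prod_(w <- r) ('X - w%:P).

(** The trace of P from k[X]/(mu) to k, by the formula of [trace_coef]; [(size mu).-2] is the degree
    minus one. Its expansion at any point is a sum over the local roots. *)
Let tr (P : {poly k}) : k := ((P * mu^`()) %% mu)`_(size mu).-2.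

Let expand_tr x r P : map_poly (expand x) mu = \prod_(w <- r) ('X - w%:P) ->
  expand x (tr P) = \sum_(w <- r) (map_poly (expand x) P).[w].
Proof.
move=> er; have ur : uniq r.
  rewrite -separable_prod_XsubC -er; rewrite separable_poly.unlock deriv_map coprimep_map.
  exact: mu_sep.
have sr : (size mu).-2 = (size r).-1.
  by rewrite -(size_map_poly (expand x)) er size_prod_XsubC.
rewrite -(trace_coef _ ur) -er -sr deriv_map -rmorphM -map_modp coef_map.
by [].
Qed.

(* For large [N] the traces of the powers of the [N]-th derivative of [d w], [w] a root of
   [mu], are rational functions without poles which vanish at infinity. Hence this
   derivative is zero and [d w] is a polynomial. *)
Lemma rational_root : exists t, root mu t.
Proof.
have Dw x r w : map_poly (expand x) mu = \prod_(w <- r) ('X - w%:P) -> w \in r ->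
    ls_deriv w = jacobian x * (map_poly (expand x) h).[w].
  by move=> er wr; apply: ls_deriv_root mu_sep mu_der _; rewrite er root_prod_XsubC.
(* The polynomial d clears the denominators of mu, so d w is a power series at every finite point
   for each local root w; [y N] represents the N-th derivative of d w as a polynomial in w. *)
have [d [r0 [d0 er0]]] := rational_den mu.
pose y N : {poly k} := iter N (ext_der (@rderiv C) h) ((ratpoly d)%:P * 'X).
have y0E x w : (map_poly (expand x) (y 0%N)).[w] = expand x (ratpoly d) * w.
  by rewrite /y /= rmorphM /= map_polyC map_polyX !hornerE.
have ySE x r w N : map_poly (expand x) mu = \prod_(w <- r) ('X - w%:P) -> w \in r ->
    (map_poly (expand x) (y N.+1)).[w] = (jacobian x)^-1 * ls_deriv (map_poly (expand x) (y N)).[w].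
  move=> er wr; rewrite (expand_ext_der _ (Dw x r w er wr)) mulKf //; exact: jacobian_neq0.
have fin a r w N : map_poly (expand (Some a)) mu = \prod_(w <- r) ('X - w%:P) -> w \in r ->
    is_ps (map_poly (expand (Some a)) (y N)).[w].
  move=> er wr; elim: N => [|N IH]; last first.
    rewrite (ySE _ _ _ _ er wr) /= invr1 mul1r; have [u ->] := IH.
    by exists (ps_deriv u); rewrite ls_derivE.
  have ps_poly_coef (P : {poly C}) : is_ps (expand (Some a) (ratpoly P)).
    by rewrite expand_poly coord_eval_fin; exists (ps_poly (P \Po ('X + a%:P))).
  rewrite y0E; apply: (@ls_integral (map_poly (expand (Some a)) mu)) => //.
  - by rewrite map_monic.
  - move=> i; rewrite coef_map -rmorphM.
    have := congr1 (fun P : {poly k} => P`_i) er0; rewrite coefZ coef_map => e.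
    by rewrite /ratpoly [X in expand _ X]e; exact: ps_poly_coef.
  by rewrite er root_prod_XsubC.
have [ri eri] := mu_split None.
(* There are finitely many roots at infinity, so their pole orders are bounded; each derivation in z
   raises the order by one. *)
have [N infN] : exists N, forall w, w \in ri -> ord 1 (map_poly (expand None) (y N)).[w].
  have [n hn] : exists n : nat, {in ri, forall w, ord (- n%:Z) (map_poly (expand None) (y 0%N)).[w]}.
    elim: (ri) => [|w s [n hn]]; first by exists 0%N.
    have [m hm] := ord_ex (map_poly (expand None) (y 0%N)).[w].
    exists (n + `|m|)%N => w'; rewrite inE => /predU1P [->|w's].
      by apply: (ord_le _ hm); lia.
    by apply: (ord_le _ (hn w' w's)); lia.
  exists n.+1 => w wr.
  have key j : ord (j%:Z - n%:Z) (map_poly (expand None) (y j)).[w].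
    elim: j => [|j IH]; first by rewrite sub0r; exact: hn.
    rewrite (ySE _ _ _ _ eri wr) (_ : j.+1%:Z - n%:Z = (j%:Z - n%:Z) + 1); last by lia.
    exact: ord_deriv_inf.
  by have := key n.+1; rewrite (_ : n.+1%:Z - n%:Z = 1) //; lia.
have tr0 m : tr (y N ^+ m.+1) = 0.
  apply: no_pole_eq0 => [a|].
    have [r er] := mu_split (Some a); rewrite (expand_tr _ er) big_seq.
    apply: subring_sum (is_ps_subring C) _ _ _ _ _ => w wr.
    rewrite rmorphXn horner_exp; apply: subringX (is_ps_subring C) _ _ _.
    exact: fin er wr.
  rewrite (expand_tr _ eri) big_seq.
  apply: (big_ind (fun f => exists u, f = lsX * ls u)) => [|_ _ [u ->] [v ->]|w wr].
  - by exists 0; rewrite rmorph0 mulr0.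
  - by exists (u + v); rewrite lsD mulrDr.
  rewrite rmorphXn horner_exp; have [u ->] := ord1_is_ps (infN w wr).
  exists (u * (psX C * u) ^+ m); rewrite exprS -mulrA lsM; congr (_ * (_ * _)).
  by rewrite -[lsX]/(ls (psX C)) -lsM; exact: esym (rmorphXn ls m _).
have [r er] := mu_split (Some 0).
have charLS n : n.+1%:R != 0 :> LS by rewrite -(rmorph_nat lsC) fmorph_eq0 pnatr_eq0.
have z0 : {in r, forall w, (map_poly (expand (Some 0)) (y N)).[w] = 0}.
  move=> w wr; apply: (power_sums_eq0 charLS (s := [seq (map_poly (expand (Some 0)) (y N)).[w] | w <- r])).
    move=> m; rewrite big_map; have := expand_tr (y N ^+ m.+1) er; rewrite tr0 rmorph0 => e.
    by apply: etrans _ (esym e); apply: eq_bigr => w' _; rewrite rmorphXn horner_exp.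
  by apply/mapP; exists w.
have [w wr] : exists w, w \in r.
  case: r er {z0} => [|w r] er; last by exists w; rewrite mem_head.
  by move: mu_size; rewrite -(size_map_poly (expand (Some 0))) er big_nil size_poly1.
have yw n : (map_poly (expand (Some 0)) (y n)).[w] = iter n ls_deriv (expand (Some 0) (ratpoly d) * w).
  by elim: n => [|n IH]; rewrite ?y0E // (ySE _ _ _ _ er wr) /= invr1 mul1r IH.
have dw_ps : is_ps (expand (Some 0) (ratpoly d) * w) by rewrite -y0E; exact: fin er wr.
have [|P eP] := iter_deriv_eq0 (N := N) dw_ps; first by rewrite -yw z0.
exists (ratpoly P / ratpoly d); rewrite -(fmorph_root (expand (Some 0))).
rewrite fmorph_div [expand _ (ratpoly P)]expand_poly coord_eval0 -eP mulrAC divff.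
  by rewrite mul1r er root_prod_XsubC.
by rewrite fmorph_eq0 ratpoly_neq0.
Qed.

End RationalRoot.

(** The last clause, theta in the ring generated by the family, carries local rationality of the
    coordinates of a line over to theta. *)
Lemma primitive_element (M L : fieldType) (kappa : {rmorphism M -> L}) (s : seq L) :
  (forall n, n.+1%:R != 0 :> M) -> {in s, forall y, algebraicOver kappa y} ->
  exists theta, [/\ algebraicOver kappa theta,
    {in s, forall y, exists P, (map_poly kappa P).[theta] = y} &
    forall G, subring_set G -> {in s, forall y, G y} -> G theta].
Proof.
move=> char0; elim: s => [|y s IH] alg.
  by exists 0; split=> // [|G HG _]; [exact: algebraic0 | exact: subring0].
have [|x [ax sx Gx]] := IH; first by move=> z zs; apply: alg; rewrite inE zs orbT.
have ay : algebraicOver kappa y by apply: alg; rewrite mem_head.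
have [q q0 qx] := ax; have [r r0 ry] := ay.
have pchar0 : [pchar M] =i pred0.
  by apply/pcharf0P => -[|n]; rewrite ?eqxx ?(negPf (char0 n)).
have [n [[Px ePx] [Py ePy]]] := pchar0_PET q0 qx r0 ry pchar0.
exists (y *+ n - x); split.
- apply: algebraic_sub => //; rewrite -mulr_natr; apply: algebraic_mul => //.
  by rewrite -(rmorph_nat kappa); exact: algebraic_id.
- move=> z; rewrite inE => /predU1P [->|/sx [P <-]]; first by exists Py.
  by exists (P \Po Px); rewrite map_comp_poly horner_comp ePx.
move=> G HG Gs; apply: subringB => //; last first.
  by apply: Gx => // z zs; apply: Gs; rewrite inE zs orbT.
elim: n {ePx ePy} => [|n IHn]; first by rewrite mulr0n; exact: subring0.
by rewrite mulrS; apply: subringD => //; apply: Gs; rewrite mem_head.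
Qed.

Section MinimalPrime.
Variables (M L : fieldType) (kappa : {rmorphism M -> L}) (theta : L) (mu : {poly M}).
Hypotheses (mon_mu : mu \is monic).
Hypothesis mu_min : forall Q, root (map_poly kappa Q) theta = (mu %| Q).

Lemma min_size : (1 < size mu)%N.
Proof.
rewrite ltnNge; apply/negP => h; have := mu_min mu; rewrite dvdpp (size1_polyC h).
rewrite map_polyC rootC /= fmorph_eq0 => /eqP e.
by have := monic_neq0 mon_mu; rewrite (size1_polyC h) e polyC0 eqxx.
Qed.

Lemma min_coprime Q : ~~ (mu %| Q) -> coprimep mu Q.
Proof.
move=> nQ; set d := gcdp mu Q.
have [e ee] := dvdpP _ _ (dvdp_gcdl mu Q).
have mu0 := monic_neq0 mon_mu.
have : mu %| e * d by rewrite -ee dvdpp.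
rewrite -mu_min rmorphM rootM !mu_min => /orP [h|h]; last first.
  by case/negP: nQ; apply: dvdp_trans h (dvdp_gcdr _ _).
have e0 : e != 0 by apply: contraNneq mu0 => e0; rewrite ee e0 mul0r.
have d0 : d != 0 by apply: contraNneq mu0 => d0; rewrite ee -/d d0 mulr0.
have := dvdp_leq e0 h; rewrite {1}ee -/d size_mul // => le.
rewrite /coprimep -/d; apply/eqP; have : (0 < size d)%N by rewrite size_poly_gt0.
have : (0 < size e)%N by rewrite size_poly_gt0.
by move: le; lia.
Qed.

Lemma min_inverse Q : ~~ (mu %| Q) -> exists R, (map_poly kappa R).[theta] * (map_poly kappa Q).[theta] = 1.
Proof.
move=> /min_coprime /Bezout_eq1_coprimepP [[u v] /= e].
have mt : (map_poly kappa mu).[theta] = 0 by apply/eqP; rewrite -rootE mu_min dvdpp.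
exists v; have := congr1 (fun P => (map_poly kappa P).[theta]) e.
by rewrite rmorphD !rmorphM rmorph1 hornerD !hornerM hornerC /= mt mulr0 add0r.
Qed.

End MinimalPrime.

Lemma irreducible_factor (M : fieldType) (P : {poly M}) : (1 < size P)%N ->
  exists2 g, irreducible_poly g & g %| P.
Proof.
move=> sP; pose good n := `[< exists g : {poly M}, [/\ (1 < size g)%N, size g = n & g %| P] >].
have ex : exists n, good n by exists (size P); apply/asboolP; exists P; rewrite dvdpp.
case: (ex_minnP ex) => n /asboolP [g [sg szg gP]] ming.
have g0 : g != 0 by rewrite -size_poly_gt0 ltnW.
exists g => //; split=> // q q1 qg.
have q0 : q != 0 by apply: contraNneq g0 => q0; rewrite q0 dvd0p in qg.
rewrite -dvdp_size_eqp // eqn_leq dvdp_leq //= szg; apply: ming; apply/asboolP.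
exists q; split=> //; last exact: dvdp_trans qg gP.
by move: q1 q0; rewrite -size_poly_gt0; case: (size q) => [|[|n']].
Qed.

Lemma split_of_linear_factors (M : fieldType) (P : {poly M}) : P \is monic ->
  (forall g, irreducible_poly g -> g %| P -> size g = 2) ->
  exists r, P = \prod_(w <- r) ('X - w%:P).
Proof.
have [n] := ubnP (size P); elim: n P => // n IH P sP monP lin.
have [s1|s1] := leqP (size P) 1.
  exists [::]; have := monicP monP.
  by rewrite (size1_polyC s1) lead_coefC big_nil => ->.
have [g irg gP] := irreducible_factor s1.
have [a ga] : exists a, root g a.
  by have [a ga] := poly2_root (lin g irg gP); exists a.
have : root P a by have [q ->] := dvdpP _ _ gP; rewrite rootM ga orbT.
move=> /factor_theorem [Q eQ].
have monQ : Q \is monic by rewrite -(monicMr _ (monicXsubC a)) -eQ.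
have [||r er] := IH Q _ monQ.
- by move: sP; rewrite eQ size_Mmonic ?monic_neq0 ?monicXsubC // size_XsubC addn2.
- by move=> g' h1 h2; apply: lin => //; rewrite eQ; exact: dvdp_mulr.
by exists (a :: r); rewrite big_cons -er mulrC.
Qed.

Lemma irreducible_prime (M : fieldType) (g P Q : {poly M}) : irreducible_poly g ->
  g %| P * Q -> g %| P \/ g %| Q.
Proof.
move=> [sg irg] h; have [gP|gP] := boolP (g %| P); [by left|right].
rewrite -(Gauss_dvdpr _ (_ : coprimep g P)) //.
apply: contraNT gP => nc; have := irg (gcdp g P) nc (dvdp_gcdl _ _).
by move=> e; rewrite -(eqp_dvdl _ e) dvdp_gcdr.
Qed.

Section RationalLine.
Variables (C : numClosedFieldType) (p : nat) (B : 'M[ratfun C]_p).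

Local Notation k := (ratfun C).
Local Notation LS := (LS C).
Local Notation lsC := (@lsC C).
Local Notation ls := (@ls C).
Local Notation ls_deriv := (@ls_deriv C).

Hypothesis B_local : forall x, exists F om, local_form x B F om.

Variables (L : fieldType) (D : L -> L) (iota : {rmorphism k -> L}).
Hypotheses (HD : is_derivation D) (iotaD : forall f, D (iota f) = iota (rderiv f)).

Let HDk : is_derivation (@rderiv C) := @rderiv_derivation C.
Let HDs : is_derivation ls_deriv := @ls_deriv_derivation C.

Let chark n : n.+1%:R != 0 :> k.
Proof.
rewrite -(rmorph_nat (@FracField.tofrac {poly C})) tofrac_eq0.
by rewrite -(rmorph_nat (@polyC C)) polyC_eq0 pnatr_eq0.
Qed.

Variables (v : 'I_p -> L) (i0 : 'I_p).
Hypotheses (v_alg : forall i, algebraicOver iota (v i)) (vi0 : v i0 = 1).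
Hypothesis v_line : inv_line D (map_mx iota B) v.

Section Splitting.
Variables (theta : L) (mu h : {poly k}) (V : 'I_p -> {poly k}) (x : sphere C) (g : {poly LS}).
Hypotheses (mon_mu : mu \is monic).
Hypothesis mu_min : forall Q, root (map_poly iota Q) theta = (mu %| Q).
Hypothesis theta_der : D theta = (map_poly iota h).[theta].
Hypothesis V_val : forall i, (map_poly iota (V i)).[theta] = v i.
Hypothesis theta_gen : forall G, subring_set G -> (forall i, G (v i)) -> G theta.
Hypotheses (g_irr : irreducible_poly g) (g_mu : g %| map_poly (expand x) mu).

Let hx := jacobian x *: map_poly (expand x) h.
Let delta := ext_der ls_deriv hx.
Let Hdelta : derivation delta := ext_der_derivation HDs hx.

Let delta_map P :
  delta (map_poly (expand x) P) = jacobian x *: map_poly (expand x) (ext_der (@rderiv C) h P).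
Proof.
rewrite map_ext_der scalerDr scalerAl /delta /ext_der; congr (_ + _).
apply/polyP => i.
by rewrite (coef_coef_der HDs) coefZ !coef_map ls_deriv_expand (coef_coef_der HDk).
Qed.

Lemma mu_ext_der : mu %| ext_der (@rderiv C) h mu.
Proof.
rewrite -mu_min rootE -(ext_der_horner HDk HD iotaD) //.
have : root (map_poly iota mu) theta by rewrite mu_min dvdpp.
by move/eqP => ->; rewrite (drv0 HD).
Qed.

Lemma mu_separable : coprimep mu mu^`().
Proof.
apply: (min_coprime mon_mu mu_min).
exact: (dvdp_deriv_char0 chark (min_size mon_mu mu_min)).
Qed.

(** The ideal (g) is differential. Write mu = g r; separability makes g and r coprime, and since g
    divides both delta mu and g delta r, it divides r delta g, hence delta g. *)
Let g_delta P : g %| P -> g %| delta P.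
Proof.
have [sg irg] := g_irr.
have dg : g %| delta g.
  have [r er] := dvdpP _ _ g_mu; rewrite mulrC in er.
  have gr : coprimep g r.
    apply: contraT => nc.
    have gr : g %| r.
      by rewrite -(eqp_dvdl _ (irg _ nc (dvdp_gcdl _ _))) dvdp_gcdr.
    have := mu_separable; rewrite -(coprimep_map (expand x)) -deriv_map => cop.
    have g' : g %| (map_poly (expand x) mu)^`().
      by rewrite er derivM; apply: dvdp_add; [exact: dvdp_mull | exact: dvdp_mulr].
    have := (coprimepP _ _ cop) g g_mu g'; rewrite -size_poly_eq1 => /eqP e.
    by rewrite e in sg.
  have : g %| delta (map_poly (expand x) mu).
    rewrite delta_map dvdpZr ?jacobian_neq0 //; apply: dvdp_trans g_mu _.
    by rewrite dvdp_map mu_ext_der.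
  rewrite er (drvM Hdelta) dvdp_addl; last exact: dvdp_mulr.
  by rewrite Gauss_dvdpl.
move=> /dvdpP [Q ->]; rewrite (drvM Hdelta); apply: dvdp_add; first exact: dvdp_mull.
exact: dvdp_mull.
Qed.

(** Theta is unramified at x. Over the extension LS[X]/(g) the line is proportional to F c with
    entries in C((t)); normalised to have one coordinate 1, it has all its coordinates in C((t)). As
    theta lies in the ring they generate, the class of X is in C((t)) too, and g has degree one. *)
Lemma factor_linear : size g = 2.
Proof.
have [sg irg] := g_irr.
pose I : set {poly LS} := [set P | g %| P].
have HI : prime_ideal_set setT I.
  split=> //.
  - by rewrite /I /= dvdp0.
  - move=> h1; have := dvdp_leq (oner_neq0 _) h1; rewrite size_poly1; move: sg.
    by case: (size g) => [|[|n]].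
  - by move=> P Q hP hQ; rewrite /I /= dvdp_sub.
  split=> [P Q _ hQ|P Q _ _]; first by rewrite /I /= dvdp_mull.
  exact: irreducible_prime.
have [Lh [Dh [pi [[HDh pi1] piD piM piDer [pi0 _]]]]] :=
  @subquotient_field {poly LS} delta setT I Hdelta (And3 Logic.I (fun _ _ _ _ => Logic.I) (fun _ _ _ _ => Logic.I)) HI
   (fun _ _ => Logic.I) g_delta.
have [f fE] : exists f : {rmorphism {poly LS} -> Lh}, f =1 pi.
  by apply: rmorphism_of => // [P Q|P Q]; [exact: piD | exact: piM].
have f0 P : f P = 0 <-> g %| P by rewrite fE; exact: pi0.
have fDer P : Dh (f P) = f (delta P) by rewrite !fE piDer.
pose kap : {rmorphism LS -> Lh} := f \o polyC.
have kapD y : Dh (kap y) = kap (ls_deriv y) by rewrite /kap /= fDer /delta (ext_derC HDs).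
have fhorner P : (map_poly kap P).[f 'X] = f P.
  elim/poly_ind: P => [|P c IH]; first by rewrite !rmorph0 horner0.
  by rewrite !rmorphD !rmorphM /= map_polyX map_polyC hornerD hornerM hornerX hornerC IH.
have X_alg : algebraicOver kap (f 'X).
  exists g; first by rewrite -size_poly_gt0 ltnW.
  by rewrite rootE fhorner; apply/eqP/f0.
have f_alg P : algebraicOver kap (f P).
  rewrite -fhorner; apply/integral_algebraic; apply: integral_horner; last exact/integral_algebraic.
  by apply/integral_poly => i; rewrite coef_map; exact: integral_id.
pose fm P : Lh := f (map_poly (expand x) P).
(* Since g divides the expansion of mu, the image of a polynomial depends only on its value at
   [theta]; identities in L thus pass to LS[X]/(g). *)
have fm_eq P Q : (map_poly iota P).[theta] = (map_poly iota Q).[theta] -> fm P = fm Q.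
  move=> e; apply/eqP; rewrite -subr_eq0 /fm -!rmorphB; apply/eqP/f0.
  apply: dvdp_trans g_mu _; rewrite dvdp_map -mu_min rootE rmorphB hornerD hornerN e subrr.
  by [].
pose w i := fm (V i).
have w1 : w i0 = 1.
  have -> : 1 = fm 1 :> Lh by rewrite /fm !rmorph1.
  by apply: fm_eq; rewrite V_val vi0 rmorph1 hornerC.
have evB P Q : (map_poly iota (P - Q)).[theta] =
    (map_poly iota P).[theta] - (map_poly iota Q).[theta].
  by rewrite rmorphB hornerD hornerN.
have evM P Q : (map_poly iota (P * Q)).[theta] =
    (map_poly iota P).[theta] * (map_poly iota Q).[theta].
  by rewrite rmorphM hornerM.
have ev_sum i : (map_poly iota (\sum_l (B i l)%:P * V l)).[theta] =
    \sum_l map_mx iota B i l * v l.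
  rewrite rmorph_sum horner_sum; apply: eq_bigr => l _.
  by rewrite evM map_polyC hornerC V_val mxE.
have w_line : inv_line Dh (map_mx kap (system_at x B)) w.
  have [u Hu] := v_line.
  pose U : {poly k} := \sum_l (B i0 l)%:P * V l.
  have eU : (map_poly iota U).[theta] = u.
    have := Hu i0; rewrite vi0 (drv1 HD) mulr1 => /esym/eqP; rewrite subr_eq0 => /eqP <-.
    by rewrite ev_sum.
  exists (kap (jacobian x) * fm U) => i.
  rewrite /w /fm fDer delta_map -mul_polyC rmorphM -[f _%:P]/(kap _) -/(fm _).
  rewrite (@fm_eq _ (\sum_l (B i l)%:P * V l - U * V i)); last first.
    have e1 := ext_der_horner HDk HD iotaD (V i) theta_der.
    rewrite V_val Hu in e1; apply: etrans (esym e1) _.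
    apply: esym; apply: etrans (evB _ _) _.
    by apply: congr2 (ev_sum i) _; rewrite evM eU V_val.
  rewrite /fm !rmorphB !rmorphM mulrBr mulrA; congr (_ - _).
  rewrite !rmorph_sum mulr_sumr; apply: eq_bigr => l _.
  by rewrite !rmorphM /= map_polyC !mxE rmorphM mulrA.
have [F [om FB]] := B_local x.
have wi0 : w i0 != 0 by rewrite w1 oner_neq0.
have [c0 [c [l [c00 _ _ wE]]]] := local_inv_line FB HDh kapD wi0 (fun i => f_alg _) w_line.
have w_range i : exists y, w i = kap y.
  have := wE i0; rewrite w1; set y0 := (_ *m _) i0 0 => e1.
  have y00 : kap y0 != 0 by apply: contraTneq (oner_neq0 Lh) => h0; rewrite e1 h0 mulr0 eqxx.
  exists (y0^-1 * (map_mx ls F *m map_mx lsC c) i 0).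
  rewrite wE rmorphM; congr (_ * _); rewrite fmorphV.
  by apply: (mulIf y00); rewrite -e1 mulVf.
have [y ey] : exists y, f 'X = kap y.
  have [|i|P [eP [y ey]]] := @theta_gen [set z | exists P, (map_poly iota P).[theta] = z /\ exists y, fm P = kap y].
  - split.
    + by exists 1; rewrite rmorph1 hornerC; split=> //; exists 1; rewrite /fm !rmorph1.
    + move=> _ _ [P [<- [a ea]]] [Q [<- [b eb]]]; exists (P - Q).
      rewrite rmorphB hornerD hornerN; split=> //; exists (a - b).
      by rewrite /fm !rmorphB -/(fm P) -/(fm Q) ea eb.
    + move=> _ _ [P [<- [a ea]]] [Q [<- [b eb]]]; exists (P * Q).
      rewrite rmorphM hornerM; split=> //; exists (a * b).
      by rewrite /fm !rmorphM -/(fm P) -/(fm Q) ea eb.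
  - exists (V i); rewrite V_val; split=> //; exact: w_range.
  exists y; rewrite -ey -(@fm_eq 'X P); first by rewrite /fm map_polyX.
  by rewrite map_polyX hornerX eP.
have : g %| 'X - y%:P by apply/f0; rewrite rmorphB ey subrr.
move=> h1; have := dvdp_leq (negbT (polyXsubC_eq0 y)) h1.
by rewrite size_XsubC; move: sg; case: (size g) => [|[|[|n]]].
Qed.

End Splitting.

(** The minimal polynomial of a primitive element of the coordinates splits over C((t)) at every
    point, so it has a rational root; by minimality this root is the element itself. *)
Lemma rational_line : exists w : 'I_p -> k, (exists i, w i != 0) /\ inv_line (@rderiv C) B w.
Proof.
have [|theta [t_alg t_val t_gen]] := @primitive_element _ _ iota (codom v) chark.
  by move=> _ /codomP [i ->].
have [mu mon_mu mu_min] := min_annihilator t_alg.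
have V_ex i : exists P, (map_poly iota P).[theta] = v i by apply: t_val; exact: codom_f.
pose V i := sval (cid (V_ex i)).
have V_val i : (map_poly iota (V i)).[theta] = v i := svalP (cid (V_ex i)).
have t_gen' G : subring_set G -> (forall i, G (v i)) -> G theta.
  by move=> HG Gv; apply: t_gen => // _ /codomP [i ->].
have root_mu : (map_poly iota mu).[theta] = 0 by apply/eqP; rewrite -rootE mu_min dvdpp.
have [h theta_der] : exists h, D theta = (map_poly iota h).[theta].
  have nmu : ~~ (mu %| mu^`()).
    exact: (dvdp_deriv_char0 chark (min_size mon_mu mu_min)).
  have [R eR] := min_inverse mon_mu mu_min nmu.
  exists (- (coef_der (@rderiv C) mu * R)).
  have := deriv_horner HDk HD iotaD mu theta; rewrite root_mu (drv0 HD) => e.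
  rewrite rmorphN rmorphM hornerN hornerM -[LHS]mul1r -eR -mulrA.
  have -> : (map_poly iota mu^`()).[theta] * D theta = - (map_poly iota (coef_der (@rderiv C) mu)).[theta].
    by apply/eqP; rewrite -addr_eq0 addrC -e.
  by rewrite mulrN mulrC.
have split x : exists r : seq LS, map_poly (expand x) mu = \prod_(w <- r) ('X - w%:P).
  apply: split_of_linear_factors; first by rewrite map_monic.
  move=> g irg gmu; exact: (factor_linear mon_mu mu_min theta_der V_val t_gen' irg gmu).
have [t mut] := rational_root mon_mu (min_size mon_mu mu_min) (mu_separable mon_mu mu_min)
  (mu_ext_der mu_min theta_der) split.
have /factor_theorem [Q eQ] := mut.
have et : theta = iota t.
  have : root (map_poly iota (Q * ('X - t%:P))) theta by rewrite -eQ rootE root_mu.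
  rewrite rmorphM rootM rmorphB /= map_polyX map_polyC root_XsubC mu_min => /orP [h1|/eqP //].
  have Q0 : Q != 0 by apply: contraTneq (monic_neq0 mon_mu) => Q0; rewrite eQ Q0 mul0r eqxx.
  have := dvdp_leq Q0 h1; rewrite eQ size_Mmonic ?monicXsubC // size_XsubC addn2 /=.
  by rewrite ltnn.
have vE i : v i = iota (V i).[t] by rewrite -V_val et horner_map.
have [u Hu] := v_line.
have eu : u = iota (\sum_l B i0 l * (V l).[t]).
  have := Hu i0; rewrite vi0 (drv1 HD) mulr1 => /esym/eqP; rewrite subr_eq0 => /eqP <-.
  by rewrite rmorph_sum; apply: eq_bigr => l _; rewrite rmorphM mxE vE.
exists (fun i => (V i).[t]); split.
  exists i0; rewrite -(fmorph_eq0 iota) -vE vi0; exact: oner_neq0.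
exists (\sum_l B i0 l * (V l).[t]) => i; apply: (fmorph_inj iota).
rewrite -iotaD -vE Hu rmorphB rmorphM -eu -vE; congr (_ - _).
by rewrite rmorph_sum; apply: eq_bigr => l _; rewrite rmorphM mxE vE.
Qed.

End RationalLine.

(** * Rational stable lines are constant *)

Section RatConst.
Variable C : fieldType.
Lemma ratconst_zmod : zmod_morphism (@ratconst C).
Proof. by move=> x y; rewrite /ratconst /ratpoly polyCB tofracB. Qed.
Lemma ratconst_monoid : monoid_morphism (@ratconst C).
Proof. by split=> [|x y]; rewrite /ratconst /ratpoly ?tofrac1 // polyCM tofracM. Qed.
HB.instance Definition _ := GRing.isZmodMorphism.Build C (ratfun C) (@ratconst C) ratconst_zmod.
HB.instance Definition _ := GRing.isMonoidMorphism.Build C (ratfun C) (@ratconst C) ratconst_monoid.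
End RatConst.

Lemma drv_exprz (K : fieldType) (D : K -> K) (x : K) (e : int) :
  is_derivation D -> x != 0 -> D (x ^ e) = e%:~R * x ^ e / x * D x.
Proof.
move=> HD x0; case: e => n.
  rewrite -exprnP (drvX HD); case: n => [|n] /=; first by rewrite !mul0r.
  by rewrite exprSr mulrA mulfK.
rewrite NegzE -invr_expz -exprnP (drvV HD) (drvX HD) /= mulrNz -pmulrn (exprSr x n).
have xn : x ^+ n != 0 by rewrite expf_neq0.
by move: (n.+1%:R : K) => m; field; rewrite x0.
Qed.

Lemma dlog_exprzM (K : fieldType) (D : K -> K) (x y : K) (e : int) :
  is_derivation D -> x != 0 -> y != 0 ->
  D (x ^ e * y) / (x ^ e * y) = x ^ (- 1) * (e%:~R * D x) + D y / y.
Proof.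
move=> HD x0 y0; have xe : x ^ e != 0 by rewrite expfz_neq0.
rewrite (drvM HD) drv_exprz // -[x ^ (- 1)]/(x^-1).
by field; rewrite x0 y0.
Qed.

Section ConstantLine.
Variable C : numClosedFieldType.

Local Notation k := (ratfun C).
Local Notation LS := (LS C).
Local Notation lsX := (@lsX C).
Local Notation lsC := (@lsC C).
Local Notation ls := (@ls C).
Local Notation ls_deriv := (@ls_deriv C).

Let HDk : is_derivation (@rderiv C) := @rderiv_derivation C.
Let HDs : is_derivation ls_deriv := @ls_deriv_derivation C.

Lemma rderiv_const c : rderiv (@ratconst C c) = 0.
Proof.
apply: (fmorph_inj (expand (Some 0))); rewrite rmorph0.
have := ls_deriv_expand (Some 0) (ratconst c).
by rewrite expand_const ls_derivC /= mul1r => <-.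
Qed.

Lemma lsc_dlog (e : int) (u : PS C) : psc u 0 != 0 ->
  lsc (ls_deriv (lsX ^ e * ls u) / (lsX ^ e * ls u)) (- 1) = e%:~R.
Proof.
move=> u0; have [v [ev v0]] := ls_unit u0.
have uu : ls u != 0 by rewrite ls_eq0; apply: contraNneq u0 => ->; rewrite psc0.
rewrite (dlog_exprzM _ HDs (lsX_neq0 C) uu) ls_derivX -(rmorph1 ls) ls_derivE ev -lsM.
rewrite lscD lsc_ls addr0 lscXn subrr.
by rewrite -(rmorph_int lsC) lscCM (_ : lsc (ls 1) 0 = 1) ?mulr1 // lsc_ls.
Qed.

Variables (q : nat) (B : 'M[k]_q).

Lemma inv_line_expand x v : inv_line (@rderiv C) B v ->
  inv_line ls_deriv (map_mx idfun (system_at x B)) (fun i => expand x (v i)).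
Proof.
move=> [u Hu]; exists (jacobian x * expand x u) => i.
rewrite ls_deriv_expand Hu rmorphB rmorph_sum rmorphM mulrBr mulrA; congr (_ - _).
by rewrite mulr_sumr; apply: eq_bigr => l _; rewrite rmorphM !mxE mulrA.
Qed.

(* [e] is the order at [x] of the generator [v] of the line. *)
Lemma inv_line_exponent x F om v u e (g : 'I_q -> PS C) :
  local_form x B F om ->
  (forall i, rderiv (v i) = \sum_l B i l * v l - u * v i) ->
  (forall i, expand x (v i) = lsX ^ e * ls (g i)) -> (exists i, psc (g i) 0 != 0) ->
  exists (w : PS C) (c : 'cV[C]_q) (l : 'I_q), [/\ psc w 0 != 0, c l 0 != 0,
    forall i, expand x (v i) = lsX ^ e * ls w * (map_mx ls F *m map_mx lsC c) i 0 &
    residue x u = lsc (om l) (- 1) - e%:~R].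
Proof.
move=> FB Hu vE [i0 gi0].
have Xe : lsX ^ e != 0 by rewrite expfz_neq0 // lsX_neq0.
have ls0 w : psc w 0 != 0 -> ls w != 0.
  by move=> w0; rewrite ls_eq0; apply: contraNneq w0 => ->; rewrite psc0.
have vi0 : expand x (v i0) != 0 by rewrite vE mulf_neq0 // ls0.
have line : inv_line (@rderiv C) B v by exists u.
have [h [c [l [h0 cl om_c vF]]]] := local_inv_line FB (kappa := idfun) HDs (fun=> erefl) vi0
   (fun i => algebraic_id idfun (expand x (v i))) (inv_line_expand x line).
rewrite /= in vF.
pose f : 'cV[PS C]_q := F *m map_mx (@psC C) c.
have fE i : (map_mx ls F *m map_mx lsC c) i 0 = ls (f i 0).
  rewrite !mxE rmorph_sum; apply: eq_bigr => j _; rewrite !mxE.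
  exact: esym (lsM _ _).
have [uF eF _] := FB.
(* F(0) is invertible and c is nonzero, so F c does not vanish at t = 0; the factor h therefore has
   exactly the order e of the generator. *)
have [j fj] : exists j, psc (f j 0) 0 != 0.
  apply: contrapT => /forallNP nf.
  have : map_mx (@ps0 C) F *m c = 0.
    apply/matrixP => i z; rewrite ord1 [RHS]mxE.
    have := nf i => /negP; rewrite negbK => /eqP; rewrite -[psc _ 0]/(ps0 _) => <-.
    rewrite !mxE rmorph_sum; apply: eq_bigr => s _; rewrite rmorphM !mxE; congr (_ * _).
    exact: esym (pscC _ 0).
  move/(congr1 (mulmx (invmx (map_mx (@ps0 C) F)))); rewrite mulmxA mulVmx // mul1mx mulmx0 => c0.
  by move: cl; rewrite c0 mxE eqxx.
have [t [ft t0]] := ls_unit fj.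
pose w := g j * t.
have hE : h = lsX ^ e * ls w.
  have := vF j; rewrite fE vE => e1.
  rewrite /w lsM -ft mulrA e1.
  exact: esym (mulfK (ls0 _ fj) _).
have w0 : psc w 0 != 0.
  have : g i0 = w * f i0 0.
    apply: (@ls_inj C); rewrite lsM; apply: (mulfI Xe).
    by rewrite -vE vF fE hE mulrA.
  by move=> e1; move: gi0; rewrite e1 psc00 mulf_eq0 negb_or => /andP [].
exists w, c, l; split=> //; first by move=> i; rewrite vF hE.
rewrite /residue; suff -> : jacobian x * expand x u = om l - ls_deriv h / h.
  by rewrite lscB; congr (_ - _); rewrite hE; exact: lsc_dlog.
pose fv := map_mx ls F *m map_mx lsC c.
have Dfv : map_mx ls_deriv fv = system_at x B *m fv - om l *: fv.
  rewrite (map_mx_derivM _ _ HDs).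
  have -> : map_mx ls_deriv (map_mx lsC c) = 0.
    by apply/matrixP => i z; rewrite !mxE ls_derivC.
  rewrite mulmx0 addr0 mulmxA eF mulmxDl -addrA -mulmxA.
  have -> : diag_mx (\row_j om j) *m map_mx lsC c = om l *: map_mx lsC c.
    apply/matrixP => i z; rewrite ord1 mul_diag_mx !mxE.
    by have [->|ci] := eqVneq (c i 0) 0; [rewrite rmorph0 !mulr0 | rewrite om_c].
  by rewrite -scalemxAr subrr addr0.
have fvE i : fv i 0 = ls (f i 0) by exact: fE.
have := ls_deriv_expand x (v j); rewrite vF -/fv (drvM HDs) Hu.
have -> : ls_deriv (fv j 0) = (system_at x B *m fv) j 0 - om l * fv j 0.
  have := congr1 (fun M : 'cV[LS]_q => M j 0) Dfv.
  by rewrite [X in X = _]mxE => ->; rewrite mxE; congr (_ + _); rewrite !mxE.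
have eS : jacobian x * expand x (\sum_l0 B j l0 * v l0) = h * (system_at x B *m fv) j 0.
  rewrite rmorph_sum mxE !mulr_sumr; apply: eq_bigr => s _.
  rewrite rmorphM vF -/fv [system_at x B j s]mxE [map_mx _ B j s]mxE.
  have gen (K : comRingType) (b1 b2 b3 b4 : K) : b1 * (b2 * (b3 * b4)) = b3 * (b1 * b2 * b4) by ring.
  exact: gen.
rewrite rmorphB [jacobian x * (_ - _)]mulrBr eS rmorphM vF -/fv.
have f0 : fv j 0 != 0 by rewrite fvE ls0.
have gen (K : fieldType) (J U o h1' h1 b A : K) : h1 != 0 -> b != 0 ->
    h1' * b + h1 * (A - o * b) = h1 * A - J * (U * (h1 * b)) -> J * U = o - h1' / h1.
  move=> n0 b0 e1; apply: (mulIf (mulf_neq0 n0 b0)).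
  have -> : J * U * (h1 * b) = h1 * A - (h1 * A - J * (U * (h1 * b))) by ring.
  by rewrite -e1; field.
exact: gen.
Qed.

Variables (Rr : realFieldType) (re : C -> Rr).
Hypotheses (reD : forall x y, re (x + y) = re x + re y) (re_nat : forall n, re n%:R = n%:R).
Variables (n : nat) (a : 'I_n -> sphere C) (eps : Rr).
Hypotheses (a_inj : injective a) (eps_bound : n%:R * eps <= 1).

(** Points other than the [a i] get exponent 0, so that the residue theorem can be applied on any
    finite set of points containing the [a i] and the poles of the connection form. *)
Definition exponent_bound (x : sphere C) (r : C) : Prop :=
  ((exists i, x = a i) -> - eps < re r) /\ (~ (exists i, x = a i) -> r = 0).

Definition good_system : Prop := forall x, exists F om, local_form x B F om /\
  forall j, exponent_bound x (lsc (om j) (- 1)).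

(** Clear denominators and take a polynomial generator of minimal total size: a common root could be
    divided out, contradicting minimality. *)
Lemma primitive_vector v : inv_line (@rderiv C) B v -> (exists i, v i != 0) ->
  exists P : 'I_q -> {poly C}, [/\ inv_line (@rderiv C) B (fun i => ratpoly (P i)),
    exists i, P i != 0 & forall b, exists i, (P i).[b] != 0].
Proof.
move=> line [i0 vi0].
pose good N := `[< exists P : 'I_q -> {poly C}, [/\ inv_line (@rderiv C) B (fun i => ratpoly (P i)),
    exists i, P i != 0 & (\sum_i size (P i))%N = N] >].
have ex : exists N, good N.
  have [d [r [d0 er]]] := rational_den (\poly_(i < q) (if insub i is Some j then v j else 0)).
  have ec (i : 'I_q) : ratpoly r`_i = ratpoly d * v i.
    have := congr1 (fun P : {poly k} => P`_i) er.
    by rewrite coefZ coef_map coef_poly ltn_ord valK => ->.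
  exists (\sum_(i < q) size (r`_i)%R)%N; apply/asboolP; exists (fun i : 'I_q => r`_i); split=> //.
    have [u Hu] := inv_line_scale HDk (ratpoly_neq0 d0) line.
    exists u => i; rewrite ec Hu; congr (_ - _).
    by apply: eq_bigr => l _; rewrite ec.
  exists i0; apply: contraTneq vi0 => r0; have := ec i0.
  rewrite r0 /ratpoly tofrac0 => /esym/eqP; rewrite mulf_eq0 tofrac_eq0 (negPf d0) /= => /eqP ->.
  by rewrite eqxx.
case: (ex_minnP ex) => N /asboolP [P [lineP [i1 Pi1] sP]] minN.
exists P; split=> //; first by exists i1.
move=> b; apply: contrapT => /forallNP nP.
have Pb i : root (P i) b by have /negP := nP i; rewrite negbK.
pose Q i := P i %/ ('X - b%:P).
have PQ i : P i = Q i * ('X - b%:P) by rewrite divpK // dvdp_XsubCl.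
have b0 : ratpoly ('X - b%:P) != 0 by rewrite ratpoly_neq0 // polyXsubC_eq0.
have Qi1 : Q i1 != 0 by apply: contraNneq Pi1 => Q0; rewrite PQ Q0 mul0r.
have : (N <= \sum_i size (Q i))%N.
  apply: minN; apply/asboolP; exists Q; split=> //; last by exists i1.
  have e i : ratpoly (Q i) = (ratpoly ('X - b%:P))^-1 * ratpoly (P i).
    by rewrite [in RHS]PQ /ratpoly tofracM mulrCA mulVf ?mulr1.
  have [|u Hu] := @inv_line_scale _ _ _ _ _ (ratpoly ('X - b%:P))^-1 HDk _ lineP.
    by rewrite invr_eq0.
  exists u => i; rewrite e Hu; congr (_ - _).
  by apply: eq_bigr => l _; rewrite e.
rewrite -sP leqNgt => /negP []; rewrite (bigD1 i1) //= [X in (_ < X)%N](bigD1 i1) //=.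
rewrite -addSn leq_add //.
  by rewrite [in X in (_ < X)%N]PQ size_Mmonic ?monicXsubC // size_XsubC addn2.
apply: leq_sum => i _; have [Q0|Q0] := eqVneq (Q i) 0; first by rewrite Q0 size_poly0.
by rewrite [in X in (_ <= X)%N]PQ size_Mmonic ?monicXsubC // size_XsubC addn2 /=.
Qed.

(* By the residue theorem, [deg P] plus the sum of the exponents of the line is zero. *)
Lemma constant_line v : good_system -> inv_line (@rderiv C) B v -> (exists i, v i != 0) ->
  exists c : 'I_q -> C, inv_line (@rderiv C) B (fun i => ratconst (c i)) /\ exists i, c i != 0.
Proof.
move=> goodB line v0; have [P [[u Hu] [i0 Pi0] Pprim]] := primitive_vector line v0.
pose m := (\max_i (size (P i)).-1)%N.
have sP i : (size (P i) <= m.+1)%N.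
  by apply: leq_trans (leqSpred _) _; rewrite ltnS; exact: (leq_bigmax i).
have [im Pm] : exists i, (P i)`_m != 0.
  have cq : (0 < #|'I_q|)%N by apply/card_gt0P; exists i0.
  have [i ei] := bigop.eq_bigmax (fun i => (size (P i)).-1) cq.
  have [Pi|Pi] := eqVneq (P i) 0; last by exists i; rewrite /m ei -lead_coefE lead_coef_eq0.
  have m0 : m = 0%N by rewrite /m ei Pi size_poly0.
  exists i0; have := sP i0; rewrite m0 => s1.
  by move: Pi0; rewrite (size1_polyC s1) coefC polyC_eq0.
(* The order of the generator: 0 at finite points by primitivity, minus its degree m at infinity. *)
pose ex (x : sphere C) : int := if x is None then - m%:Z else 0.
have res x : exists r, exponent_bound x r /\ residue x u = r - (ex x)%:~R.
  have [F [om [FB ombd]]] := goodB x.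
  have gex : exists g : 'I_q -> PS C, (forall i, expand x (ratpoly (P i)) = lsX ^ ex x * ls (g i)) /\
      exists i, psc (g i) 0 != 0.
    case: x {FB ombd} => [b|].
      exists (fun i => ps_poly (P i \Po ('X + b%:P))); split=> [i|].
        by rewrite expand_poly coord_eval_fin /= expr0z mul1r.
      by have [i Pb] := Pprim b; exists i; rewrite ps_comp_coef0.
    have gi i := coord_eval_inf (sP i).
    exists (fun i => sval (cid (gi i))); split=> [i|].
      have [e _] := svalP (cid (gi i)); rewrite -e /ex expand_poly -invr_expz -exprnP.
      by rewrite mulrCA mulVf ?mulr1 // expf_neq0 // lsX_neq0.
    by exists im; have [_ ->] := svalP (cid (gi im)).
  have [g [gE g0]] := gex.
  have [w [c [l [_ _ _ ->]]]] := inv_line_exponent FB Hu gE g0.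
  by exists (lsc (om l) (- 1)).
pose rho x := sval (cid (res x)).
have rhoP x : exponent_bound x (rho x) /\ residue x u = rho x - (ex x)%:~R := svalP (cid (res x)).
have [r er] := closed_field_poly_normal (denr u).
pose s : seq (sphere C) := undup (None :: codom a ++ map Some r).
have us : uniq s := undup_uniq _.
have s_None : None \in s by rewrite mem_undup mem_head.
have s_a i : a i \in s by rewrite mem_undup inE mem_cat codom_f orbT.
have s_poles b : Some b \notin s -> is_ps (expand (Some b) u).
  move=> bs; apply: is_ps_finite; apply: contra bs => db.
  rewrite mem_undup inE mem_cat; apply/orP; right; apply/orP; right.
  rewrite mem_map; last by move=> ? ? [].
  move: db; rewrite er hornerZ mulf_eq0 lead_coef_eq0 (negPf (denr_neq0 u)) /= -rootE.
  by rewrite root_prod_XsubC.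
have sum0 := sum_residues (undup_uniq _) s_None s_poles.
have re0 : re 0 = 0 by apply: (addrI (re 0)); rewrite -reD !addr0.
have sum_rho : \sum_(x <- s) rho x = - m%:R.
  have := sum0; rewrite (eq_bigr (fun x => rho x - (ex x)%:~R)) => [|x _]; last by have [] := rhoP x.
  rewrite sumrB => /eqP; rewrite subr_eq0 => /eqP ->.
  rewrite (big_rem None) //= big1_seq ?addr0 ?mulrNz // => x /andP [_].
  by rewrite (mem_rem_uniq _ us) inE => /andP [xN _]; case: x xN.
have sum_re : \sum_(x <- s) re (rho x) = - m%:R.
  rewrite -(big_morph re reD re0) sum_rho; apply: (addrI m%:R).
  by rewrite subrr -{1}re_nat -reD subrr re0.
have sum_a : \sum_(x <- s) re (rho x) = \sum_(i < n) re (rho (a i)).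
  rewrite (bigID (mem (codom a))) /= [X in _ + X]big1 ?addr0 => [|x xa]; last first.
    have [[_ h] _] := rhoP x; rewrite h ?re0 // => -[i xi]; case/negP: xa.
    by rewrite xi codom_f.
  rewrite -big_filter (perm_big (codom a)) /=; last first.
    apply: uniq_perm; first by rewrite filter_uniq // undup_uniq.
      by rewrite map_inj_uniq // enum_uniq.
    move=> x; rewrite mem_filter; case xa: (x \in codom a) => //=.
    by have /codomP [i ->] := xa; rewrite s_a.
  by rewrite big_map big_enum.
(* Each of the n terms of -m exceeds -eps, so m < n eps <= 1. For n = 0 the sum is empty, and
   strictness comes from 0 < 1. *)
have m0 : m = 0%N.
  apply/eqP; rewrite -leqn0 -ltnS -(ltr_nat Rr) -[m%:R]opprK -sum_re sum_a -sumrN.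
  case: (posnP n) => [n0|n0].
    rewrite big1 ?ltr01 // => i _; have := ltn_ord i; by rewrite {2}n0.
  apply: lt_le_trans eps_bound; rewrite mulr_natl -[in X in _ < X](card_ord n) -sumr_const.
  apply: ltr_sum => [|i _]; first by apply/hasP; exists (Ordinal n0); rewrite ?mem_index_enum.
  by have [[h _] _] := rhoP (a i); rewrite ltrNl; apply: h; exists i.
have Pc i : P i = ((P i)`_0)%:P by apply: size1_polyC; have := sP i; rewrite m0.
exists (fun i => (P i)`_0); split; last first.
  by exists i0; apply: contraNneq Pi0 => h; rewrite Pc h polyC0.
exists u => i; rewrite /ratconst -Pc Hu; congr (_ - _).
by apply: eq_bigr => l _; rewrite -Pc.
Qed.

End ConstantLine.

(** * Triangularisation *)

Lemma exists_pivot_mx (C : fieldType) q (c : 'cV[C]_q.+1) : c != 0 ->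
  exists2 T : 'M[C]_q.+1, T \in unitmx & T *m c = delta_mx 0 0.
Proof.
move=> c0.
have rc : \rank c = 1%N.
  by apply/eqP; rewrite eqn_leq rank_leq_col lt0n mxrank_eq0.
have e := mulmx_ebase c; rewrite rc in e.
have uL := col_ebase_unit c; have uU := row_ebase_unit c.
set U := row_ebase c in e uU.
have U0 : U 0 0 != 0.
  by move: uU; rewrite unitmxE unitfE det_mx11.
exists ((U 0 0)^-1 *: invmx (col_ebase c)).
  by rewrite unitmxZ ?unitmx_inv // unitfE invr_eq0.
rewrite -{2}e -scalemxAl -!mulmxA mulKmx //.
apply/matrixP => i j; rewrite !ord1 !mxE big_ord1 !mxE.
by case: i => [[|i] ilt]; rewrite /= ?mul1r ?mulVf ?mul0r ?mulr0.
Qed.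

(** * The quotient by a constant stable line *)

Section Quotient.
Variable C : numClosedFieldType.

Local Notation k := (ratfun C).
Local Notation LS := (LS C).
Local Notation lsC := (@lsC C).
Local Notation ls := (@ls C).
Local Notation ls_deriv := (@ls_deriv C).
Local Notation cst := (map_mx (@ratconst C)).

Let HDs : is_derivation ls_deriv := @ls_deriv_derivation C.

Variables (Rr : realFieldType) (re : C -> Rr) (n : nat) (a : 'I_n -> sphere C) (eps : Rr).

Local Notation good B := (good_system B re a eps).

Definition minor0 (A : Type) q (M : 'M[A]_q.+1) : 'M[A]_q := \matrix_(i, j) M (lift 0 i) (lift 0 j).

(** After the change of basis the line is spanned by the first vector, so row 0 of the frame T F can
    be deleted. At each point the line is F d with some d_l nonzero, and column l is deleted with
    it: what remains is a normal form whose exponents are the others. *)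
Lemma quotient_good q (B : 'M[k]_q.+1) (c : 'I_q.+1 -> C) (T : 'M[C]_q.+1) :
  good B -> inv_line (@rderiv C) B (fun i => ratconst (c i)) ->
  T \in unitmx -> T *m (\col_i c i) = delta_mx 0 0 ->
  let B1 := cst T *m B *m cst (invmx T) in
  (forall i : 'I_q, B1 (lift 0 i) 0 = 0) /\ good (minor0 B1).
Proof.
move=> goodB [u Hu] uT Tc B1.
have c_ne0 : exists i, c i != 0.
  apply: contrapT => /forallNP h; move: Tc.
  have -> : \col_i c i = 0.
    by apply/matrixP => i j; rewrite !mxE; have /negP := h i; rewrite negbK => /eqP.
  rewrite mulmx0 => /matrixP/(_ 0 0); rewrite !mxE eqxx => /eqP.
  by rewrite eq_sym oner_eq0.
have uT' : cst T \in unitmx by rewrite map_unitmx.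
have eB1 : B1 *m cst T = cst T *m B.
  by rewrite /B1 -mulmxA -map_mxM mulVmx // map_mx1 mulmx1.
have low i : B1 (lift 0 i) 0 = 0.
  have Bc : B *m cst (\col_i c i) = u *: cst (\col_i c i).
    apply/matrixP => l j; rewrite !mxE.
    have := Hu l; rewrite rderiv_const => /esym/eqP; rewrite subr_eq0 => /eqP <-.
    by apply: eq_bigr => s _; rewrite !mxE.
  have : B1 *m cst (delta_mx 0 0 : 'cV_q.+1) = u *: cst (delta_mx 0 0).
    by rewrite -Tc map_mxM mulmxA eB1 -mulmxA Bc scalemxAr.
  move=> /matrixP/(_ (lift 0 i) 0); rewrite !mxE (bigD1 0) //= big1 ?addr0.
    by rewrite !mxE eqxx rmorph1 mulr1 => ->; rewrite rmorph0 mulr0.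
  by move=> s s0; rewrite !mxE (negPf s0) rmorph0 mulr0.
split=> // x.
have [F [om [FB ombd]]] := goodB x.
have [uF eF gap] := FB.
have vE i : expand x (ratconst (c i)) = @lsX C ^ 0 * ls (psC (c i)).
  by rewrite expand_const expr0z mul1r.
have c0_ne0 : exists i, psc (psC (c i)) 0 != 0 by have [i ci] := c_ne0; exists i; rewrite pscC.
have [w [d [l [w0 dl vF _]]]] := inv_line_exponent FB Hu vE c0_ne0.
pose F1 := map_mx (@psC C) T *m F.
pose F0 := map_mx (@ps0 C) F1.
have eF0 : F0 = T *m map_mx (@ps0 C) F.
  rewrite /F0 map_mxM -map_mx_comp; congr (_ *m _); apply/matrixP => i j.
  by rewrite !mxE /= /ps0 pscC.
have uF0 : F0 \in unitmx by rewrite eF0 unitmx_mul uT.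
have F0d : psc w 0 *: (F0 *m d) = delta_mx 0 0.
  rewrite -Tc eF0 -mulmxA scalemxAr; congr (_ *m _); apply/matrixP => i j.
  rewrite ord1 !mxE; have := vF i; rewrite expand_const expr0z mul1r.
  have -> : (map_mx ls F *m map_mx lsC d) i 0 = ls (\sum_s F i s * psC (d s 0)).
    rewrite mxE rmorph_sum; apply: eq_bigr => s _; rewrite !mxE; exact: esym (lsM _ _).
  rewrite -lsM => /ls_inj /(congr1 (fun z => psc z 0)); rewrite psc00 pscC /= => ->.
  congr (_ * _); rewrite psc_sum; apply: eq_bigr => s _.
  by rewrite psc00 pscC mxE.
exists (\matrix_(i, j) F1 (lift 0 i) (lift l j)), (fun j => om (lift l j)).
split; last by move=> j; exact: ombd.
have eA : system_at x B1 *m map_mx lsC T = map_mx lsC T *m system_at x B.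
  rewrite /system_at -scalemxAl -scalemxAr; congr (_ *: _).
  have -> : map_mx lsC T = map_mx (expand x) (cst T).
    by apply/matrixP => i j; rewrite !mxE expand_const.
  by rewrite -!map_mxM eB1.
have eF1 : map_mx ls F1 = map_mx lsC T *m map_mx ls F.
  by rewrite /F1 map_mxM -map_mx_comp.
have sysF1 : system_at x B1 *m map_mx ls F1 =
    map_mx ls_deriv (map_mx ls F1) + map_mx ls F1 *m diag_mx (\row_j om j).
  rewrite eF1 mulmxA eA -mulmxA eF mulmxDr mulmxA; congr (_ + _).
  rewrite (map_mx_derivM _ _ HDs) (_ : map_mx ls_deriv (map_mx lsC T) = 0) ?mul0mx ?add0r //.
  by apply/matrixP => i j; rewrite !mxE ls_derivC.
split.
- rewrite -unitmx_tr -row_free_unit; apply: inj_row_free => z zG.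
  (* A kernel vector of the truncated frame, extended by 0 at l, is sent by F_0 onto the line, so it
     is a multiple of d; its entry at l is 0 while d_l is not, hence it vanishes. *)
  pose zt : 'cV[C]_q.+1 := \col_s (if unlift l s is Some j then z 0 j else 0).
  have Fzt : F0 *m zt = (F0 *m zt) 0 0 *: delta_mx 0 0.
    apply/matrixP => i j; rewrite ord1 [RHS]mxE [delta_mx _ _ _ _]mxE eqxx andbT.
    have [i' ->|->] := unliftP 0 i.
      rewrite eq_sym (negPf (neq_lift _ _)) mulr0.
      have := congr1 (fun M : 'rV[C]_q => M 0 i') zG; rewrite mxE [RHS]mxE => e0; apply: etrans _ e0.
      rewrite mxE (bigD1_ord l) //= [zt l 0]mxE unlift_none mulr0 add0r.
      by apply: eq_bigr => s _; rewrite !mxE liftK mulrC.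
    by rewrite eqxx mulr1.
  have ezt : zt = ((F0 *m zt) 0 0 * psc w 0) *: d.
    by apply: (can_inj (mulKmx uF0)); rewrite -scalemxAr -scalerA F0d.
  have al : (F0 *m zt) 0 0 = 0.
    have := congr1 (fun M : 'cV[C]_q.+1 => M l 0) ezt.
    rewrite [X in X = _]mxE unlift_none mxE => /esym/eqP.
    by rewrite !mulf_eq0 (negPf w0) (negPf dl) !orbF => /eqP.
  have zt0 : zt = 0 by rewrite ezt al mul0r scale0r.
  apply/matrixP => i j; rewrite ord1 [RHS]mxE.
  have := congr1 (fun M : 'cV[C]_q.+1 => M (lift l j) 0) zt0.
  by rewrite !mxE liftK.
- apply/matrixP => i j.
  have := congr1 (fun M : 'M[LS]_q.+1 => M (lift 0 i) (lift l j)) sysF1.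
  rewrite [in X in X -> _]mxE big_ord_recl.
  have -> : system_at x B1 (lift 0 i) 0 = 0 by rewrite /system_at mxE [X in _ * X]mxE low rmorph0 mulr0.
  rewrite mul0r add0r => e; rewrite [LHS]mxE.
  have -> : \sum_s system_at x (minor0 B1) i s * map_mx ls (\matrix_(i, j) F1 (lift 0 i) (lift l j)) s j =
     \sum_s system_at x B1 (lift 0 i) (lift 0 s) * map_mx ls F1 (lift 0 s) (lift l j).
    by apply: eq_bigr => s _; rewrite ![system_at _ _ _ _]mxE !mxE.
  rewrite e !mul_mx_diag [LHS]mxE [RHS]mxE; congr (_ + _); by rewrite !mxE.
move=> i j e0 c0 h1 h2 h3; exact: gap h3.
Qed.

End Quotient.

Lemma upper_triangular_lift (A : comUnitRingType) q (M : 'M[A]_(1 + q)) (T : 'M[A]_q) :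
  T \in unitmx -> dlsubmx M = 0 -> upper_triangular (T *m drsubmx M *m invmx T) ->
  upper_triangular (lift0_mx T *m M *m lift0_mx (invmx T)).
Proof.
move=> uT M0 triT; rewrite -[M]submxK M0 /lift0_mx !mulmx_block.
rewrite !(mul0mx, mulmx0, mul1mx, mulmx1, addr0, add0r) => i j.
case: (split_ordP i) => i' ->; case: (split_ordP j) => j' -> lt.
- by move: lt; rewrite !ord1 ltnn.
- by move: lt; rewrite /= !ord1.
- by rewrite block_mxEdl mxE.
by rewrite block_mxEdr; apply: triT; move: lt; rewrite /= ltn_add2l.
Qed.

Lemma drsubmx_minor0 (A : Type) q (M : 'M[A]_q.+1) : drsubmx (M : 'M[A]_(1 + q)) = minor0 M.
Proof. by apply/matrixP => i j; rewrite !mxE !rshift1. Qed.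

Lemma row_free_row' (F : fieldType) q N (Z : 'M[F]_(q.+1, N)) : row_free Z -> row_free (row' 0 Z).
Proof.
move=> freeZ; apply: inj_row_free => z zZ.
pose y : 'rV[F]_q.+1 := \row_s (if unlift 0 s is Some j then z 0 j else 0).
have yZ : y *m Z = 0.
  rewrite -zZ; apply/matrixP => i j; rewrite !mxE (bigD1_ord 0) //= !mxE unlift_none mul0r add0r.
  by apply: eq_bigr => s _; rewrite !mxE liftK ord1.
have y0 : y = 0 by apply/eqP; rewrite -(mulmx_free_eq0 y freeZ) yZ.
apply/matrixP => i j; rewrite ord1 [RHS]mxE.
by have := congr1 (fun M : 'rV[F]_q.+1 => M 0 (lift 0 j)) y0; rewrite !mxE liftK.
Qed.

Lemma diff_subfield_subring (K : fieldType) (D : K -> K) (E : set K) :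
  diff_subfield D E -> subring_set E.
Proof.
move=> [E1 EB Ediv _]; split=> // x y Ex Ey; have [->|y0] := eqVneq y 0.
  by rewrite mulr0 -(subrr 1); exact: EB.
rewrite -[y]invrK; apply: (Ediv) => //; rewrite -[y^-1]mul1r; exact: Ediv.
Qed.

(** * Induction on the size of the system *)

Section Triangularize.
Variable C : numClosedFieldType.

Local Notation k := (ratfun C).
Local Notation cst := (map_mx (@ratconst C)).

Variables (Rr : realFieldType) (re : C -> Rr) (n : nat) (a : 'I_n -> sphere C) (eps : Rr).
Hypotheses (reD : forall x y, re (x + y) = re x + re y) (re_nat : forall n, re n%:R = n%:R).
Hypotheses (a_inj : injective a) (eps_bound : n%:R * eps <= 1).

Variables (K : fieldType) (D : K -> K) (iota : {rmorphism k -> K}).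
Hypotheses (HD : is_derivation D) (iotaD : forall f, D (iota f) = iota (rderiv f)).
Variables (m : nat) (Fs : nat -> set K).
Hypothesis chain : quadrature_chain D (range iota) m Fs.

Lemma chain_subfield i : (i <= m)%N -> diff_subfield D (Fs i) /\ range iota `<=` Fs i.
Proof.
have [F0 step] := chain; elim: i => [|i IH] im.
  by rewrite F0; split=> //; exact: range_subfield iotaD.
have [x [_ ->]] := step i im; have [_ h] := IH (ltnW im).
by split; [exact: diff_adjoin_subfield | exact: subset_trans h (@sub_diff_adjoin _ _ _ _)].
Qed.

Let char0 i : i.+1%:R != 0 :> k.
Proof. by rewrite -(rmorph_nat (@ratconst C)) fmorph_eq0 pnatr_eq0. Qed.

Lemma triangularize q (B : 'M[k]_q) N (Z : 'M[K]_(q, N)) :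
  good_system B re a eps -> row_free Z -> map_mx D Z = map_mx iota B *m Z ->
  (forall i j, Fs m (Z i j)) ->
  exists T : 'M[C]_q, T \in unitmx /\ upper_triangular (cst T *m B *m cst (invmx T)).
Proof.
elim: q B Z => [|q IH] B Z goodB freeZ DZ FZ.
  by exists 1%:M; split; [exact: unitmx1 | case].
have [[FB1 FBB FBdiv _] FBr] := chain_subfield (leqnn m).
have HF : subring_set (Fs m) by have [/diff_subfield_subring] := chain_subfield (leqnn m).
have [jj Zj] : exists j, Z 0 j != 0.
  apply: contrapT => /forallNP h.
  have /eqP : delta_mx 0 0 *m Z = 0 :> 'rV_N.
    rewrite -rowE; apply/matrixP => i j; rewrite !mxE.
    by have /negP := h j; rewrite negbK => /eqP.
  rewrite mulmx_free_eq0 // => /eqP /matrixP/(_ 0 0); rewrite !mxE !eqxx => /eqP.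
  by rewrite oner_eq0.
have lineZ : inv_line D (map_mx iota B) (fun i => Z i jj).
  exists 0 => i; have := congr1 (fun M : 'M[K]_(q.+1, N) => M i jj) DZ.
  by rewrite mxE => ->; rewrite mxE mul0r subr0.
have [|L [DL [jL [w [HDL jLD [i0 wi0] w_line w_alg]]]]] :=
  liouville_line (@rderiv_derivation C) HD iotaD char0 chain (fun i => FZ i jj) _ lineZ.
  by exists 0.
have B_local x : exists F om, local_form x B F om.
  by have [F [om [h _]]] := goodB x; exists F, om.
pose w1 i := (w i0)^-1 * w i.
have w1_alg i : algebraicOver jL (w1 i) by rewrite /w1 mulrC; exact: algebraic_div.
have w1i0 : w1 i0 = 1 by rewrite /w1 mulVf.
have w1_line : inv_line DL (map_mx jL B) w1 by apply: inv_line_scale => //; rewrite invr_eq0.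
have [v [v0 v_line]] := rational_line B_local HDL jLD w1_alg w1i0 w1_line.
have [c [c_line [ic c0]]] := constant_line reD re_nat a_inj eps_bound goodB v_line v0.
have cc0 : \col_i c i != 0.
  by apply: contraNneq c0 => /matrixP/(_ ic 0); rewrite !mxE => ->.
have [T uT Tc] := exists_pivot_mx cc0.
have [] := quotient_good goodB c_line uT Tc; set B1 := cst T *m B *m cst (invmx T) => low good1.
pose Z1 := map_mx iota (cst T) *m Z.
have DZ1 : map_mx D Z1 = map_mx iota B1 *m Z1.
  rewrite /Z1 (map_mx_derivM _ _ HD) (_ : map_mx D (map_mx iota (cst T)) = 0); last first.
    by apply/matrixP => i j; rewrite !mxE iotaD rderiv_const rmorph0.
  rewrite mul0mx add0r DZ !mulmxA -!map_mxM /B1; congr (map_mx _ _ *m _).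
  by rewrite -[RHS]mulmxA -map_mxM mulVmx // map_mx1 mulmx1.
have FZ1 i j : Fs m (Z1 i j).
  rewrite mxE; apply: subring_sum => // s _; apply: subringM => //.
  by apply: FBr; rewrite !mxE; exists (ratconst (T i s)).
have freeZ1 : row_free Z1.
  have uT' : map_mx iota (cst T) \in unitmx by rewrite !map_unitmx.
  apply: inj_row_free => z /eqP; rewrite mulmxA (mulmx_free_eq0 _ freeZ) => /eqP h.
  by rewrite -[z](mulmxK uT') h mul0mx.
have [||||T2 [uT2 triT2]] := IH (minor0 B1) (row' 0 Z1).
- exact: good1.
- exact: row_free_row'.
- apply/matrixP => i j.
  have e : D (Z1 (lift 0 i) j) = \sum_s iota (B1 (lift 0 i) s) * Z1 s j.
    have := congr1 (fun M : 'M[K]_(q.+1, N) => M (lift 0 i) j) DZ1; rewrite mxE => ->.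
    by rewrite mxE; apply: eq_bigr => s _; rewrite [map_mx iota B1 _ _]mxE.
  rewrite big_ord_recl low rmorph0 mul0r add0r in e.
  rewrite mxE [row' 0 Z1 i j]mxE e mxE; apply: eq_bigr => s _; rewrite [row' 0 Z1 s j]mxE; congr (_ * _).
  by rewrite [RHS]mxE [minor0 B1 i s]mxE.
- by move=> i j; rewrite mxE.
have uL2 : lift0_mx T2 \in unitmx.
  by rewrite unitmxE /lift0_mx det_ublock det1 mul1r -unitmxE.
have invL2 : lift0_mx T2 *m lift0_mx (invmx T2) = 1%:M.
  rewrite /lift0_mx mulmx_block !(mulmx0, mul0mx, mulmx1, addr0, add0r) mulmxV //.
  exact: esym (scalar_mx_block _ _ _).
exists (lift0_mx T2 *m T); split; first by rewrite unitmx_mul uT uL2.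
have inv2 : invmx (lift0_mx T2 *m T) = invmx T *m lift0_mx (invmx T2).
  have uA : lift0_mx T2 *m T \in unitmx by rewrite unitmx_mul uT uL2.
  by apply: (can_inj (mulKmx uA)); rewrite mulmxV // -mulmxA mulKVmx // invL2.
have e2 (M : 'M[C]_q) : map_mx (@ratconst C) (lift0_mx M) = lift0_mx (cst M).
  by rewrite /lift0_mx map_block_mx map_mx1 !map_mx0.
rewrite inv2 !map_mxM !e2 (map_invmx _ T2).
have -> : lift0_mx (cst T2) *m cst T *m B *m (cst (invmx T) *m lift0_mx (invmx (cst T2))) =
   lift0_mx (cst T2) *m B1 *m lift0_mx (invmx (cst T2)).
  by rewrite /B1 !mulmxA.
apply: upper_triangular_lift; first by rewrite map_unitmx.
  apply/matrixP => i j; rewrite [dlsubmx _ _ _]mxE [in LHS]mxE rshift1 (_ : lshift q j = 0) ?low ?mxE //.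
  by apply: val_inj; rewrite /= ord1.
by rewrite drsubmx_minor0 -map_invmx.
Qed.

End Triangularize.

(** * Local normal forms from formal exponents *)

Section LaurentProduct.
Variables (A : pzRingType) (u v : int -> A) (N M : int).
Hypotheses (uN : forall k, k < N -> u k = 0) (vM : forall k, k < M -> v k = 0).

Lemma lmul_shift (n : nat) :
  lmul u v (N + M + n%:Z) = \sum_(i < n.+1) u (N + i%:Z) * v (M + (n - i)%N%:Z).
Proof.
rewrite /lmul (@fsbigE _ _ _ _ _ [seq N + i%:Z | i <- index_iota 0 n.+1]).
- rewrite big_map big_mkcond; under eq_bigr do rewrite in_setT.
  rewrite big_mkord; apply: eq_bigr => i _.
  by congr (_ * v _); have := ltn_ord i; lia.
- by rewrite map_inj_uniq ?iota_uniq // => i j /addrI [].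
- by [].
move=> k _ kn; case: (ltrP k N) => kN; first by rewrite uN ?mul0r.
have kM : N + M + n%:Z - k < M.
  rewrite ltNge; apply: contra kn => h; apply/mapP; exists `|k - N|%N; last by lia.
  by rewrite mem_index_iota; lia.
by rewrite (vM kM) mulr0.
Qed.

Lemma lmul_lt k : k < N + M -> lmul u v k = 0.
Proof.
move=> kNM; rewrite /lmul fsbig1 // => i _.
case: (ltrP i N) => iN; first by rewrite uN ?mul0r.
by rewrite (vM (k := k - i)) ?mulr0 //; lia.
Qed.

End LaurentProduct.

Section LaurentSeries.
Variable C : numClosedFieldType.

Lemma lscP (u : int -> C) : laurent_series u -> exists f : LS C, lsc f = u.
Proof.
move=> [N uN]; exists (lsX C ^ N * ls (mkps (fun n => u (N + n%:Z)))).
apply/funext => k; rewrite lscXn lsc_ls; case E: (k - N) => [m|m].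
  by rewrite psc_mk; congr u; lia.
by rewrite uN //; lia.
Qed.

Lemma lscM (f g : LS C) : lsc (f * g) = lmul (lsc f) (lsc g).
Proof.
have [n [u e]] := ls_clear f; have [m [v e']] := ls_clear g.
have un k : k < - n%:Z -> shiftc n u k = 0.
  by rewrite /shiftc; case E: (_ + _) => [i|//]; lia.
have vm k : k < - m%:Z -> shiftc m v k = 0.
  by rewrite /shiftc; case E: (_ + _) => [i|//]; lia.
have efg : f * g * lsX C ^+ (n + m) = ls (u * v).
  by rewrite lsM -e -e' exprD mulrACA.
apply/funext => k; rewrite (lscE efg) (lscE e) (lscE e') [LHS]/shiftc.
case E: (_ + _) => [i|i]; last by rewrite (lmul_lt un vm) //; lia.
have -> : k = - n%:Z + - m%:Z + i%:Z by lia.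
rewrite (lmul_shift un vm) pscM; apply: eq_bigr => j _.
rewrite /shiftc (_ : - n%:Z + j%:Z + n%:Z = j%:Z) ?addrNK; last by lia.
by rewrite (_ : - m%:Z + (i - j)%N%:Z + m%:Z = (i - j)%N%:Z) //; lia.
Qed.

Lemma lpolyE (P : {poly C}) : lpoly P = lsc (ls (ps_poly P)).
Proof. by apply/funext => k; rewrite lsc_ls. Qed.

(** The equation [denr f] * u = [numr f] has a single solution in the field of Laurent series. *)
Lemma lsc_expand0 (f : ratfun C) (u : int -> C) :
  laurent_expansion f u -> lsc (expand (Some 0) f) = u.
Proof.
move=> [/lscP [g gu]]; rewrite -gu !lpolyE -lscM => e.
have {}e : ls (ps_poly (denr f)) * g = ls (ps_poly (numr f)).
  by apply: lsc_inj => k; rewrite e.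
congr lsc; rewrite [f in LHS]ratfunE fmorph_div !expand_poly !coord_eval0 -e mulrC mulKf //.
by rewrite ls_eq0 ps_poly_eq0 denr_neq0.
Qed.

End LaurentSeries.

Lemma mxMzE (A : pzRingType) m n (M : 'M[A]_(m, n)) (z : int) i j : (M *~ z) i j = M i j *~ z.
Proof. by case: z => z; rewrite /intmul ?mxE mulmxnE. Qed.

Lemma lmul_mxE (A : pzRingType) p (U V : int -> 'M[A]_p) (N M : int) k i j :
  (forall k, k < N -> U k = 0) -> (forall k, k < M -> V k = 0) ->
  lmul U V k i j = \sum_l lmul (fun k => U k i l) (fun k => V k l j) k.
Proof.
move=> UN VM.
have uN l k' : k' < N -> U k' i l = 0 by move=> /UN ->; rewrite mxE.
have vM l k' : k' < M -> V k' l j = 0 by move=> /VM ->; rewrite mxE.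
case: (ltrP k (N + M)) => kNM.
  rewrite (lmul_lt UN VM) // mxE big1 // => l _.
  by rewrite (lmul_lt (uN l) (vM l)).
have -> : k = N + M + (absz (k - (N + M)%R)%R)%:Z by lia.
rewrite (lmul_shift UN VM) summxE.
under [RHS]eq_bigr => l _ do rewrite (lmul_shift (uN l) (vM l)).
by rewrite exchange_big /=; apply: eq_bigr => s _; rewrite -[_ * _]/(_ *m _) mxE.
Qed.

Section Translation.
Variable C : numClosedFieldType.
Variable p : nat.
Implicit Types (B : 'M[ratfun C]_p) (x : sphere C).

Lemma system_atE x B i j : system_at x B i j = expand (Some 0) (local_system B x i j).
Proof. by rewrite expand_local_system !mxE. Qed.

(** The series om_j is lambda_j / t + q_j', the logarithmic derivative of t^(lambda_j) e^(q_j); a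
    derivative has no residue, so the residue of om_j is lambda_j. *)
Lemma formal_equation x B lambda : formal_exponents B x lambda ->
  exists (F : 'M[PS C]_p) (om : 'I_p -> LS C), [/\ map_mx (@ps0 C) F \in unitmx,
    system_at x B *m map_mx (@ls C) F =
      map_mx (@ls_deriv C) (map_mx (@ls C) F) + map_mx (@ls C) F *m diag_mx (\row_j om j) &
    forall j, lsc (om j) (- 1) = lambda j].
Proof.
move=> [L [r [b [T [F [q [BL [_ L0] [uT _] [F0 FT] [hq formal]]]]]]]].
pose E j (k : int) : C := if k <= 0 then (q j)`_`|k| else 0.
pose w j (k : int) : C := (if k == -1 then lambda j else 0) + lderiv (E j) k.
have w0 j k : k < - (r.+1)%:Z -> w j k = 0.
  move=> kr; rewrite /w /lderiv /E; have /negPf -> : k != -1 by lia.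
  have [szq _ _] := hq j; have -> : k + 1 <= 0 by lia.
  by rewrite add0r nth_default ?mul0rz //; apply: leq_trans szq _; lia.
have wl j : laurent_series (w j) by exists (- (r.+1)%:Z); exact: w0.
pose om j := sval (cid (lscP (wl j))).
have omE j : lsc (om j) = w j by rewrite /om; case: cid.
pose F' : 'M[PS C]_p := \matrix_(i, j) mkps (fun n => F n%:Z i j).
have FE i j : lsc (ls (F' i j)) = fun k => F k i j.
  apply/funext => k; rewrite lsc_ls mxE; case: k => n; first by rewrite psc_mk.
  by rewrite F0 ?mxE //; lia.
have wE k : (if k == -1 then diagmx lambda else 0) + lderiv (exponential_part q) k =
    diagmx (fun j => w j k).
  apply/matrixP => i j; rewrite [LHS]mxE /lderiv mxMzE /w /E /exponential_part.
  have [->|ij] := eqVneq i j; rewrite /lderiv.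
    by case: ifP => _; case: ifP => _; rewrite !mxE ?eqxx ?mulr1n.
  by case: ifP => _; case: ifP => _; rewrite !mxE (negPf ij) ?mulr0n ?mul0rz ?addr0.
exists F', om; split.
- rewrite (_ : map_mx _ _ = T) //; apply/matrixP => i j; rewrite !mxE -FT.
  by rewrite /ps0 psc_mk.
- apply/matrixP => i j; apply: lsc_inj => k.
  have e := congr1 (fun G : int -> 'M[C]_p => G k i j) formal.
  have Om0 k' : k' < - (r.+1)%:Z -> diagmx (fun j => w j k') = 0.
    move=> kr; apply/matrixP => i' j'; rewrite !mxE w0 // mul0rn //.
  have -> : lsc ((system_at x B *m map_mx (@ls C) F') i j) k = lmul L F k i j.
    rewrite (lmul_mxE _ _ _ L0 F0) mxE lsc_sum; apply: eq_bigr => l _.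
    by rewrite lscM system_atE (lsc_expand0 (BL i l)) [map_mx _ _ _ _]mxE FE.
  rewrite {}e [LHS]mxE [X in lsc X _]mxE lscD; congr (_ + _).
    by rewrite !(mxE map_mx_key) lsc_deriv FE /lderiv mxMzE mulrzl.
  under eq_fun do rewrite wE.
  rewrite (lmul_mxE _ _ _ F0 Om0) mxE lsc_sum; apply: eq_bigr => l _.
  rewrite lscM [map_mx _ _ _ _]mxE FE; congr (lmul _ _ k); apply/funext => k'.
  by rewrite !mxE; case: eqP => [->|_]; rewrite ?mulr1n ?omE ?mulr0n ?lsc0.
- move=> j; rewrite omE /w eqxx /lderiv addNr mulr0z addr0 //.
Qed.

(** The recursion (n+1) f_(n+1) = sum of L_(n-i) f_i, solvable in characteristic 0. *)
Lemma ps_ode m (L : 'M[PS C]_p) (F0 : 'M[C]_(p, m)) : exists F : 'M[PS C]_(p, m),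
  map_mx (@ps0 C) F = F0 /\ map_mx (@ps_deriv C) F = L *m F.
Proof.
pose coef n : 'M[C]_p := map_mx (fun u => psc u n) L.
pose Phi n (f : nat -> 'M[C]_(p, m)) :=
  if n is k.+1 then k.+1%:R^-1 *: \sum_(i < k.+1) coef (k - i)%N *m f i else F0.
have [|f Hf] := @rec_exists _ Phi 0.
  move=> [|n] f g fg //=; congr (_ *: _); apply: eq_bigr => i _; rewrite fg //.
exists (\matrix_(i, j) mkps (fun n => f n i j)); split.
  by apply/matrixP => i j; rewrite !mxE /ps0 psc_mk Hf.
apply/matrixP => i j; apply: psP => n; rewrite !mxE psc_deriv psc_mk Hf /Phi.
rewrite [X in _ * X]mxE mulVKf ?pnatr_eq0 // summxE psc_sum.
under eq_bigr => s _ do rewrite mxE.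
rewrite exchange_big /=; apply: eq_bigr => l _; rewrite mulrC pscM.
by apply: eq_bigr => s _; rewrite !mxE psc_mk mulrC.
Qed.

(** The formal solution with value 1 at the point is itself a normal form, with every om equal to
    0. *)
Lemma local_form_nonsingular x B : ~ singular_point B x ->
  exists F, local_form x B F (fun=> 0).
Proof.
move=> nsing.
have psB i j : is_ps (system_at x B i j).
  rewrite system_atE; apply: is_ps_finite; apply/negP => h; apply: nsing.
  by exists i, j; rewrite /root.
pose L : 'M[PS C]_p := \matrix_(i, j) sval (cid (psB i j)).
have LE : map_mx (@ls C) L = system_at x B.
  by apply/matrixP => i j; rewrite !(mxE map_mx_key) [L i j]mxE; case: cid.
have [F [F1 DF]] := ps_ode L 1%:M; exists F; split.
- by rewrite F1 unitmx1.
- rewrite -LE -map_mxM -DF; apply/matrixP => i j.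
  by rewrite !mxE big1 ?addr0 ?ls_derivE // => s _; rewrite !mxE mul0rn mulr0.
- by [].
Qed.

(** The residue of c'/c is the order of c, an integer, and it equals e times the difference of the
    residues of u and v. *)
Lemma resonance_free (u v : LS C) (e : nat) (c : LS C) : (0 < e)%N -> c != 0 ->
  ls_deriv c = e%:R * (u - v) * c ->
  exists z : int, lsc u (- 1) - lsc v (- 1) = z%:~R / e%:R.
Proof.
move=> e0 c0 Dc; have [z [f [ef f0]]] := ls_decomp c0; exists z.
have eC : (e%:R : C) != 0 by rewrite pnatr_eq0 -lt0n.
have := lsc_dlog z f0; rewrite -ef Dc mulfK // => <-.
by rewrite -(rmorph_nat (@lsC C)) lscCM lscB mulrC mulKf.
Qed.

End Translation.

Section Hypotheses.
Variable R : realType.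

Lemma ReD (x y : R[i]) : complex.Re (x + y) = complex.Re x + complex.Re y.
Proof. by case: x; case: y. Qed.

Lemma Re_nat n : complex.Re (n%:R : R[i]) = n%:R.
Proof. by elim: n => [//|n IH]; rewrite !mulrS ReD IH. Qed.

Lemma int_div_real (x : R[i]) (z : int) (e : nat) : (0 < e)%N -> x = z%:~R / e%:R ->
  complex.Re x = ratr (z%:~R / e%:R) /\ complex.Im x = 0.
Proof.
move=> e0 ->.
have -> : z%:~R / e%:R = real_complex R (z%:~R / e%:R).
  by rewrite fmorph_div rmorph_int rmorph_nat.
by split=> //=; rewrite fmorph_div rmorph_int rmorph_nat.
Qed.

(** An algebraic relation between two diagonal factors would make the difference of their exponents
    a rational number: equal imaginary parts and a rational difference of real parts, which [gap]
    excludes. *)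
Lemma good_systemP (p n : nat) (B : 'M[ratfun R[i]]_p) (a : 'I_n -> sphere R[i])
    (lambda : 'I_n -> 'I_p -> R[i]) (eps : R) :
  injective a ->
  (forall x, singular_point B x <-> exists i, x = a i) ->
  (forall i, formal_exponents B (a i) (lambda i)) ->
  (forall i j, - eps < complex.Re (lambda i j)) ->
  (forall i (j l : 'I_p), j != l ->
     (forall x : rat, complex.Re (lambda i j) - complex.Re (lambda i l) <> ratr x) \/
     complex.Im (lambda i j) <> complex.Im (lambda i l)) ->
  good_system B (@complex.Re R) a eps.
Proof.
move=> a_inj sing formal bound gap x.
have [/sing [i xi]|nsing] := pselect (singular_point B x); last first.
  have [F FB] := local_form_nonsingular nsing; exists F, (fun=> 0); split=> // j.
  by rewrite lsc0; split=> // -[i xi]; case: nsing; apply/sing; exists i.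
have [F [om [F0 FB omE]]] := formal_equation (formal i).
exists F, om; rewrite xi; split; last first.
  move=> j; rewrite omE; split; last by case; exists i.
  by move=> _; exact: bound.
split=> // j l e c e0 c0 Dc; have [->//|jl] := eqVneq j l.
have [z] := resonance_free e0 c0 Dc; rewrite !omE => lz.
have [] := int_div_real e0 lz.
case: (lambda i j) (lambda i l) (gap i j l jl) => [x1 y1] [x2 y2] /= gap' re0 im0.
by case: gap' => [/(_ _ re0)//|[]]; apply/subr0_eq.
Qed.

End Hypotheses.

(** * Solving triangular systems *)

Section Quadratures.
Variables (K : fieldType) (D : K -> K) (E0 : set K).
Hypotheses (HD : is_derivation D) (HE0 : diff_subfield D E0).

(** The tops of quadrature chains over [E0]; with the chain hidden, fields can be enlarged one
    element at a time. *)
Definition quadrature_field (E : set K) : Prop :=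
  [/\ diff_subfield D E, E0 `<=` E &
      exists m Fs, quadrature_chain D E0 m Fs /\ Fs m = E].

Lemma quadrature_field0 : quadrature_field E0.
Proof. by split=> //; exists 0%N, (fun=> E0); split. Qed.

Lemma quadrature_fieldS E x : quadrature_field E ->
  [\/ algebraic_elt E x, exponential_elt D E x | integral_elt D E x] ->
  exists E', [/\ quadrature_field E', E `<=` E' & E' x].
Proof.
move=> [HE E0E [m [Fs [[F0 FS] Fm]]]] ex; exists (diff_adjoin D E [set x]).
have sub : E `<=` diff_adjoin D E [set x] by exact: sub_diff_adjoin.
split=> //; last by apply: mem_diff_adjoin.
split; [exact: diff_adjoin_subfield | exact: subset_trans sub |].
exists m.+1, (fun i => if (i <= m)%N then Fs i else diff_adjoin D E [set x]).
rewrite ltnn; split=> //; split=> // i.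
rewrite ltnS => im /=; rewrite im; have [->|ni] := eqVneq i m.
  by exists x; rewrite ltnn Fm.
have {}im : (i < m)%N by rewrite ltn_neqAle ni.
by rewrite im; exact: FS.
Qed.

Lemma quadrature_integrals q (x : 'I_q -> K) E : quadrature_field E ->
  (forall i, E (D (x i))) ->
  exists E', [/\ quadrature_field E', E `<=` E' & forall i, E' (x i)].
Proof.
move=> QE Ex.
have : forall n, exists E', [/\ quadrature_field E', E `<=` E' & forall i : 'I_q, (i < n)%N -> E' (x i)].
  elim=> [|n [E1 [Q1 EE1 E1x]]]; first by exists E; split.
  case: (ltnP n q) => nq; last first.
    by exists E1; split=> // i _; apply: E1x; exact: leq_trans (ltn_ord i) nq.
  have [|E2 [Q2 E12 E2x]] := @quadrature_fieldS _ (x (Ordinal nq)) Q1.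
    by apply: Or33; apply: EE1; exact: Ex.
  exists E2; split=> //; first exact: subset_trans E12.
  move=> i; rewrite ltnS leq_eqVlt => /orP[/eqP ni|ni]; last by apply: E12; exact: E1x.
  by rewrite (_ : i = Ordinal nq) //; apply: val_inj.
by move=> /(_ q) [E' [Q' EE' E'x]]; exists E'; split=> // i; exact: E'x.
Qed.

(* Back substitution: once the lower rows of [F] are available, the quotients of
   row [i] by a solution [e] of the scalar equation [e' = U i i * e] are integrals. *)
Lemma triangular_quadratures p (U F : 'M[K]_p) :
  upper_triangular U -> (forall i j, E0 (U i j)) -> map_mx D F = U *m F ->
  (forall i, exists g e, [/\ e != 0, D g = U i i & D e = U i i * e]) ->
  exists E, quadrature_field E /\ forall i j, E (F i j).
Proof.
move=> triU E0U DF scalar.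
(* Here d counts the rows already obtained, from the bottom. *)
have : forall d, exists E, quadrature_field E /\ forall i j : 'I_p, (p <= i + d)%N -> E (F i j).
  elim=> [|d [E [QE EF]]].
    by exists E0; split; [exact: quadrature_field0 | move=> i j; have := ltn_ord i; lia].
  case: (ltnP d p) => dp; last by exists E; split=> // i j _; apply: EF; lia.
  have ip : (p - d.+1 < p)%N by lia.
  pose i := Ordinal ip; have [g [e [e0 Dg De]]] := scalar i.
  have [_ E0E _] := QE.
  (* An exponential is taken of an element of the field, so the integral g of the diagonal entry is
     adjoined before e. *)
  have [|E1 [Q1 EE1 E1g]] := @quadrature_fieldS _ g QE.
    by apply: Or33; rewrite /integral_elt Dg; apply: E0E.
  have [|E2 [Q2 E12 E2e]] := @quadrature_fieldS _ e Q1.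
    by apply: Or32; split=> //; exists g; rewrite ?Dg.
  have EE2 : E `<=` E2 by exact: subset_trans E12.
  have [HE2 E02 _] := Q2; have S2 := diff_subfield_subring HE2.
  have [_ _ divE2 _] := HE2.
  have [|E3 [Q3 E23 E3f]] := @quadrature_integrals _ (fun j => F i j / e) _ Q2.
    move=> j; have -> : D (F i j / e) = (\sum_(l | l != i) U i l * F l j) / e.
      have := congr1 (fun M : 'M[K]_p => M i j) DF; rewrite !mxE (bigD1 i) //= => DFij.
      by rewrite (drvDiv HD) // De DFij; field.
    apply: divE2 => //; apply: (subring_sum S2) => l li; case: (ltnP l i) => hl.
      by rewrite triU // mul0r; exact: subring0 S2.
    apply: (subringM S2); first exact: E02.
    apply: EE2; apply: EF; have : l != i :> nat by []; rewrite /i /= in hl *; lia.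
  exists E3; split=> // i' j hi'; case: (leqP p (i' + d)) => h.
    by apply: E23; apply: EE2; exact: EF.
  have -> : i' = i by apply: val_inj => /=; lia.
  have [HE3 _ _] := Q3; have S3 := diff_subfield_subring HE3.
  by rewrite -[F i j](divfK e0); apply: (subringM S3) => //; exact: E23.
by move=> /(_ p) [E [QE EF]]; exists E; split=> // i j; apply: EF; rewrite leq_addl.
Qed.

End Quadratures.

Section Converse.
Variable C : numClosedFieldType.

Lemma ps_antiderivative (u : PS C) : exists v, ps_deriv v = u.
Proof.
exists (mkps (fun n => if n is k.+1 then psc u k / k.+1%:R else 0)).
by apply: psP => n; rewrite psc_deriv psc_mk mulrC divfK ?pnatr_eq0.
Qed.

Lemma ps_exponential (u : PS C) : exists e, psc e 0 = 1 /\ ps_deriv e = u * e.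
Proof.
have [E [/matrixP/(_ 0 0) E0 /matrixP/(_ 0 0)]] := ps_ode (u%:M : 'M[PS C]_1) 1%:M.
rewrite !mxE big_ord1 !mxE mulr1n => DE; exists (E 0 0); split=> //.
by move: E0; rewrite !mxE.
Qed.

Lemma common_regular_point p (U : 'M[ratfun C]_p) : exists a, forall i j, (denr (U i j)).[a] != 0.
Proof.
pose d := \prod_i \prod_j denr (U i j).
have /closed_nonrootP [a] : d != 0.
  by apply/prodf_neq0 => i _; apply/prodf_neq0 => j _; exact: denr_neq0.
rewrite /root horner_prod => /prodf_neq0 h; exists a => i j.
by have := h i isT; rewrite horner_prod => /prodf_neq0; exact.
Qed.

(** At a point where all entries of U are regular, the diagonal integrals and exponentials are power
    series, so everything takes place in C((t)), whose constants are C. The fundamental matrix of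
    the original system is T^-1 F, F being a formal solution for U. *)
Lemma triangular_solvable p (B : 'M[ratfun C]_p) (T : 'M[C]_p) : T \in unitmx ->
  upper_triangular (map_mx (@ratconst C) T *m B *m map_mx (@ratconst C) (invmx T)) ->
  solvable_by_quadratures B.
Proof.
move=> uT; set U := _ *m _ *m _ => triU.
have [a regU] := common_regular_point U.
pose iota : {rmorphism ratfun C -> LS C} := expand (Some a).
have psU i j : is_ps (iota (U i j)) by exact: is_ps_finite (regU i j).
pose L : 'M[PS C]_p := \matrix_(i, j) sval (cid (psU i j)).
have LE i j : ls (L i j) = iota (U i j) by rewrite [L i j]mxE; case: cid.
have [F [F1 DF]] := ps_ode L 1%:M.
have HD := @ls_deriv_derivation C.
have iotaD f : ls_deriv (iota f) = iota (rderiv f) by rewrite ls_deriv_expand mul1r.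
have iotac c : iota (ratconst c) = lsC c by exact: expand_const.
have HE0 : diff_subfield (@ls_deriv C) (range iota) by exact: range_subfield iotaD.
pose lsF := map_mx (@ls C) F; pose V := map_mx (@lsC C) (invmx T).
have DlsF : map_mx (@ls_deriv C) lsF = map_mx iota U *m lsF.
  have -> : map_mx iota U = map_mx (@ls C) L by apply/matrixP => i j; rewrite !(mxE map_mx_key) LE.
  by rewrite -map_mxM -DF; apply/matrixP => i j; rewrite !mxE ls_derivE.
have uF : lsF \in unitmx.
  rewrite unitmxE unitfE det_map_mx ls_eq0; apply: contraTneq (oner_neq0 C) => e.
  by have := det1 C p; rewrite -F1 det_map_mx e rmorph0 => <-; rewrite eqxx.
have uV : V \in unitmx by rewrite map_unitmx unitmx_inv.
have eU : V *m map_mx iota U = map_mx iota B *m V.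
  have ci M : map_mx iota (map_mx (@ratconst C) M) = map_mx (@lsC C) M :> 'M[LS C]_p.
    by apply/matrixP => i j; rewrite !(mxE map_mx_key) iotac.
  by rewrite /U !map_mxM !ci mulmxA mulmxA -map_mxM mulVmx // map_mx1 mul1mx.
have [E [[HE E0E [m [Fs [chain FsE]]]] EF]] :
    exists E, quadrature_field (@ls_deriv C) (range iota) E /\ forall i j, E (lsF i j).
  apply: (triangular_quadratures HD HE0 (U := map_mx iota U)) => //.
  - by move=> i j ij; rewrite mxE triU // rmorph0.
  - by move=> i j; rewrite mxE; exists (U i j).
  move=> i; have [g Dg] := ps_antiderivative (L i i).
  have [e [e0 De]] := ps_exponential (L i i).
  have ls_e0 : ls e != 0.
    by rewrite ls_eq0; apply: contra_eq_neq e0 => ->; rewrite psc0 eq_sym oner_neq0.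
  exists (ls g), (ls e); split; first exact: ls_e0.
    by rewrite ls_derivE Dg LE [RHS]mxE.
  by rewrite ls_derivE De lsM LE [X in _ = X * _]mxE.
exists (LS C), (@ls_deriv C), iota, (V *m lsF); split.
- by split; [exact: HD | exact: iotaD].
- split; first exact: etrans (unitmx_mul V lsF) (introT andP (conj uV uF)).
  rewrite (map_mx_derivM _ _ HD) DlsF !mulmxA eU.
  have -> : map_mx (@ls_deriv C) V = 0 by apply/matrixP => i j; rewrite !mxE ls_derivC.
  by rewrite mul0mx add0r.
- by move=> x _ /ls_deriv_eq0 [c ->]; exists c; rewrite iotac.
exists m, Fs; split; [exact: chain|]; rewrite FsE; apply: diff_adjoin_min; [exact: HE | exact: E0E | move=> _ [i [j ->]]].
have SE := diff_subfield_subring HE; rewrite mxE; apply: (subring_sum SE) => l _.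
apply: (subringM SE); last exact: EF.
apply: E0E; exists (ratconst (invmx T i l)); first by [].
by rewrite iotac [RHS]mxE.
Qed.

End Converse.

Theorem theorem2 (R : realType) (p n : nat) (B : 'M[ratfun R[i]]_p)
    (a : 'I_n -> sphere R[i]) (lambda : 'I_n -> 'I_p -> R[i]) :
  (2 <= p)%N ->
  injective a ->
  (forall x : sphere R[i], singular_point B x <-> exists i, x = a i) ->
  (forall i, nonresonant_irregular_point B (a i)) ->
  (forall i, formal_exponents B (a i) (lambda i)) ->
  (forall i, injective (lambda i)) ->
  (forall i j, - (n%:R * (p.-1)%:R)^-1 < complex.Re (lambda i j)) ->
  (forall i (j l : 'I_p), j != l ->
     (forall x : rat,
        complex.Re (lambda i j) - complex.Re (lambda i l) <> ratr x) \/
     complex.Im (lambda i j) <> complex.Im (lambda i l)) ->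
  solvable_by_quadratures B <->
  exists C : 'M[R[i]]_p, C \in unitmx /\
    upper_triangular (map_mx (@ratconst R[i]) C *m B
                      *m map_mx (@ratconst R[i]) (invmx C)).
Proof.
move=> _ a_inj sing _ formal _ bound gap; split; last first.
  by move=> [T [uT triT]]; exact: triangular_solvable uT triT.
move=> [K [D [iota [Y [[HD iotaD] [uY DY] _ [m [Fs [chain sub]]]]]]]].
(* With eps = 1/(n(p-1)) the product n eps is 1/(p-1), at most 1; the convention 0^-1 = 0 makes it 0
   when n or p - 1 is 0. *)
have eps_bound : n%:R * (n%:R * p.-1%:R)^-1 <= 1 :> R.
  case: n {a lambda a_inj sing formal bound gap} => [|n]; first by rewrite mul0r ler01.
  rewrite invfM mulVKf ?pnatr_eq0 //; case: (p.-1) => [|q]; first by rewrite invr0 ler01.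
  by rewrite invf_le1 ?ltr0n // ler1n.
apply: (triangularize (@ReD R) (@Re_nat R) a_inj eps_bound HD iotaD chain _ _ DY).
- exact: good_systemP a_inj sing formal bound gap.
- by rewrite row_free_unit.
- by move=> i j; apply: sub; apply: mem_diff_adjoin; exists i, j.
Qed.
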